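(* Let $n$ be an integer with $n\geq 4$. Let $t$ and $r$ be two nonzero complex numbers. Assume that $r^{2k}\neq 1$ for every integer $k$ with $1\leq k\leq n$, and $r^{2k}\neq -1$ for every integer $k$ with $1\leq k\leq n-1$. Then the Cohen--Wales representation of the Artin group of type $D_n$ based on the parameters $t$ and $r$ is irreducible except when $$t\in\{r^{4n-4},\,r^{2n-4},\,-r^{2n-2},\,1,\,r^4,\,-1\},$$ when it is reducible.
   Context: Number the nodes of the Dynkin diagram of type $D_n$ by $1,\dots,n$ so that node $1$ is adjacent to node $3$ only and, for $2\le i\le n-1$, node $i$ is adjacent to node $i+1$ (these are all adjacencies); write $i\sim j$ for adjacent nodes. The Artin group of type $D_n$ has generators $s_1,\dots,s_n$ and relations $s_is_js_i=s_js_is_j$ if $i\sim j$, $s_is_j=s_js_i$ if $i\ne j$, $i\not\sim j$. Cohen--Wales representation. Let $\Phi^+$ be the set of the $n^2-n$ positive roots of a root system of type $D_n$ with simple roots $\alpha_1,\dots,\alpha_n$ and inner product $(\cdot,\cdot)$ normalized by $(\alpha,\alpha)=2$ for all roots $\alpha$. Let $V$ be a vector space with basis $(x_\beta)_{\beta\in\Phi^+}$. For a parameter $\rho$ and $1\le k\le n$ let $\tau_k$ be the linear map with $\tau_k(x_\beta)=0$ if $(\alpha_k,\beta)=2$ (i.e. $\beta=\alpha_k$); $\tau_k(x_\beta)=\rho\,x_{\beta-\alpha_k}$ if $(\alpha_k,\beta)=1$; $\tau_k(x_\beta)=x_\beta$ if $(\alpha_k,\beta)=0$; $\tau_k(x_\beta)=(1-\rho^2)x_\beta+\rho\,x_{\beta+\alpha_k}$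 if $(\alpha_k,\beta)=-1$. For $\rho,t$ indeterminates there is a unique family of elements $T_{k,\beta}\in\mathbb Z[\rho^{\pm1}]$ ($1\le k\le n$, $\beta\in\Phi^+$) with $T_{k,\alpha_k}=\rho^4$ for all $k$ such that, with $T_k(x_\beta)=T_{k,\beta}\,x_{\alpha_k}$, the maps $\sigma_k=\tau_k+t\,T_k$ satisfy the defining relations of the Artin group of type $D_n$. The representation $s_k\mapsto\sigma_k$ can be specialized to nonzero complex values of $\rho$ and $t$. The Cohen--Wales representation based on the parameters $t$ and $r$, in the convention used here, is this representation with $\rho=r^{-1}$ (so the parameter $r$ here is the inverse of the one in the original construction), viewed as a representation on the vector space $V$ over the field $\mathbb Q(t,r)\subset\mathbb C$ generated by the parameters. (For generic parameters this is the representation used by Cohen and Wales to prove linearity of the Artin group, hence it is called faithful.) *)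

(* Defs.v *)
From HB Require Import structures.
From mathcomp Require Import all_boot all_order all_algebra generic_quotient.
From mathcomp Require Import boolp reals complex.

Set Implicit Arguments.
Unset Strict Implicit.
Unset Printing Implicit Defensive.

Import GRing.Theory.
Local Open Scope ring_scope.

(* Everything is indexed from 0: node i of the Dynkin diagram is the ordinal  *)
(* of value i - 1.                                                            *)
Definition dynkinD_edge (a b : nat) : bool :=
  (a == 0)%N && (b == 2)%N || (0 < a)%N && (b == a.+1)%N.

Definition dynkinD_adj n (i j : 'I_n) : bool :=
  dynkinD_edge i j || dynkinD_edge j i.

Definition artinD_relations n (X : Type) (mul : X -> X -> X) (s : 'I_n -> X) :=
  (forall i j, dynkinD_adj i j ->
     mul (mul (s i) (s j)) (s i) = mul (mul (s j) (s i)) (s j)) /\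
  (forall i j, i != j -> ~~ dynkinD_adj i j -> mul (s i) (s j) = mul (s j) (s i)).

(* The Artin group of type D_n: words in the letters (i, true), standing for  *)
(* s_i, and (i, false), standing for s_i^-1, modulo the congruence generated  *)
(* by free cancellation and the Artin relations.                              *)
Definition artin_word n := seq ('I_n * bool).

Inductive artin_eq n : artin_word n -> artin_word n -> Prop :=
| ArtinRefl u : artin_eq u u
| ArtinSym u v : artin_eq u v -> artin_eq v u
| ArtinTrans u v w : artin_eq u v -> artin_eq v w -> artin_eq u w
| ArtinCat u u' v v' :
    artin_eq u u' -> artin_eq v v' -> artin_eq (u ++ v) (u' ++ v')
| ArtinCancel i b : artin_eq [:: (i, b); (i, ~~ b)] [::]
| ArtinBraid i j : dynkinD_adj i j ->
    artin_eq [:: (i, true); (j, true); (i, true)]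
             [:: (j, true); (i, true); (j, true)]
| ArtinComm i j : i != j -> ~~ dynkinD_adj i j ->
    artin_eq [:: (i, true); (j, true)] [:: (j, true); (i, true)].

Section ArtinGroup.
Variable n : nat.

Definition artin_eqb (u v : artin_word n) : bool := `[< artin_eq u v >].

Lemma artin_eqb_refl : reflexive artin_eqb.
Proof. by move=> u; apply/asboolP; exact: ArtinRefl. Qed.

Lemma artin_eqb_sym : symmetric artin_eqb.
Proof. by move=> u v; apply/asboolP/asboolP; exact: ArtinSym. Qed.

Lemma artin_eqb_trans : transitive artin_eqb.
Proof.
by move=> v u w /asboolP uv /asboolP vw; apply/asboolP; exact: ArtinTrans vw.
Qed.

Canonical artin_equiv :=
  EquivRel artin_eqb artin_eqb_refl artin_eqb_sym artin_eqb_trans.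

Local Open Scope quotient_scope.

Definition artin_group := {eq_quot artin_equiv}.

HB.instance Definition _ :=
  Choice.copy artin_group {eq_quot artin_equiv}.

Definition artin_class (u : artin_word n) : artin_group :=
  \pi_({eq_quot artin_equiv}) u.

Lemma artin_classE u v : artin_class u = artin_class v <-> artin_eq u v.
Proof. by split=> [/eqmodP/asboolP | uv] //; apply/eqmodP/asboolP. Qed.

Lemma artin_class_repr (g : artin_group) : artin_class (repr g) = g.
Proof. exact: reprK. Qed.

Definition artin_inv_word (u : artin_word n) : artin_word n :=
  rev [seq (x.1, ~~ x.2) | x <- u].

Definition artin_one : artin_group := artin_class [::].
Definition artin_mul (g h : artin_group) : artin_group :=
  artin_class (repr g ++ repr h).
Definition artin_inv (g : artin_group) : artin_group :=
  artin_class (artin_inv_word (repr g)).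

Lemma artin_classM u v :
  artin_mul (artin_class u) (artin_class v) = artin_class (u ++ v).
Proof.
by apply/artin_classE; apply: ArtinCat; apply/artin_classE;
  rewrite artin_class_repr.
Qed.

Lemma artin_mulA : associative artin_mul.
Proof.
move=> g h k.
rewrite -(artin_class_repr g) -(artin_class_repr h) -(artin_class_repr k).
by rewrite !artin_classM catA.
Qed.

Lemma artin_mul1 : left_id artin_one artin_mul.
Proof. by move=> g; rewrite -(artin_class_repr g) artin_classM. Qed.

Lemma artin_mulr1 : right_id artin_one artin_mul.
Proof. by move=> g; rewrite -(artin_class_repr g) artin_classM cats0. Qed.

Lemma artin_word_inv u : artin_eq (artin_inv_word u ++ u) [::].
Proof.
elim: u => [|[i b] u IHu]; first exact: ArtinRefl.
rewrite /artin_inv_word /= rev_cons cat_rcons.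
have c : artin_eq [:: (i, ~~ b); (i, b)] [::].
  by have := ArtinCancel i (~~ b); rewrite negbK.
apply: ArtinTrans IHu; apply: ArtinCat; first exact: ArtinRefl.
exact: ArtinCat c (ArtinRefl u).
Qed.

Lemma artin_inv_wordK : involutive artin_inv_word.
Proof.
move=> u; rewrite /artin_inv_word map_rev revK -map_comp.
by rewrite -[RHS]map_id; apply: eq_map => -[i b] /=; rewrite negbK.
Qed.

Lemma artin_mulV : left_inverse artin_one artin_inv artin_mul.
Proof.
move=> g; rewrite -{2}(artin_class_repr g) artin_classM.
by apply/artin_classE; exact: artin_word_inv.
Qed.

Lemma artin_mulrV : right_inverse artin_one artin_inv artin_mul.
Proof.
move=> g; rewrite -{1}(artin_class_repr g) artin_classM.
apply/artin_classE; rewrite -{1}[repr g]artin_inv_wordK.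
exact: artin_word_inv.
Qed.

HB.instance Definition _ := isGroup.Build artin_group
  artin_mulA artin_mul1 artin_mulr1 artin_mulV artin_mulrV.

Definition artin_gen (k : 'I_n) : artin_group := artin_class [:: (k, true)].

End ArtinGroup.

Section Representations.
Variables (G : groupType) (F : fieldType) (V : vectType F).

Definition is_representation (phi : G -> 'End(V)) : Prop :=
  phi 1%g = \1%VF /\ forall g h, phi (g * h)%g = (phi g \o phi h)%VF.

Definition invariant_subspace (phi : G -> 'End(V)) (U : {vspace V}) : Prop :=
  forall g, (phi g @: U <= U)%VS.

Definition irreducible_rep (phi : G -> 'End(V)) : Prop :=
  fullv != 0%VS :> {vspace V} /\
  forall U : {vspace V}, invariant_subspace phi U -> U = 0%VS \/ U = fullv.

Definition reducible_rep (phi : G -> 'End(V)) : Prop :=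
  exists U : {vspace V}, [/\ invariant_subspace phi U, U <> 0%VS & U <> fullv].

End Representations.

(* The subfield generated by s, as the intersection of all subfields that     *)
(* contain s (x^-1 = 0 for x = 0, so divring_closed sets are the subfields).  *)
Section GeneratedSubfield.
Variables (F : fieldType) (s : seq F).

Definition gen_subfield : {pred F} := fun x =>
  `[< forall S : {pred F}, divring_closed S -> {subset s <= S} -> x \in S >].

Lemma gen_subfieldP x : reflect
  (forall S : {pred F}, divring_closed S -> {subset s <= S} -> x \in S)
  (x \in gen_subfield).
Proof. exact: asboolP. Qed.

Lemma gen_subfield_closed : divring_closed gen_subfield.
Proof.
split=> [|x y /gen_subfieldP xP /gen_subfieldP yP|
          x y /gen_subfieldP xP /gen_subfieldP yP];
  apply/gen_subfieldP => S Scl sS; have [S1 SB SV] := Scl => //.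
- by apply: SB; [exact: xP | exact: yP].
- by apply: SV; [exact: xP | exact: yP].
Qed.

HB.instance Definition _ :=
  GRing.isDivringClosed.Build F gen_subfield gen_subfield_closed.

Lemma mem_gen_subfield x : x \in s -> x \in gen_subfield.
Proof. by move=> xs; apply/gen_subfieldP => S _; apply. Qed.

Record gen_field := GenField {
  gen_field_val : F;
  gen_field_valP : gen_field_val \in gen_subfield }.

HB.instance Definition _ := [isSub for gen_field_val].
HB.instance Definition _ := [Choice of gen_field by <:].
HB.instance Definition _ :=
  [SubChoice_isSubComUnitRing of gen_field by <:].
HB.instance Definition _ :=
  [SubComUnitRing_isSubIntegralDomain of gen_field by <:].
HB.instance Definition _ := [SubIntegralDomain_isSubField of gen_field by <:].

Definition gen_field_elt x (xs : x \in s) : gen_field :=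
  GenField (mem_gen_subfield xs).

End GeneratedSubfield.

Definition gen_fst (F : fieldType) (x y : F) : gen_field [:: x; y] :=
  gen_field_elt (mem_head x [:: y]).
Definition gen_snd (F : fieldType) (x y : F) : gen_field [:: x; y] :=
  gen_field_elt (mem_last x [:: y] : y \in [:: x; y]).

(* The root system D_n = { +-e_i +- e_j | i != j } in Z^n, with simple roots  *)
(* e_0 + e_1 and e_k - e_(k-1) for 0 < k < n.  The nonnegative combinations   *)
(* of these among the roots are the e_j +- e_i with i < j.                    *)
Section RootsD.
Variable n : nat.

Definition evec (m : nat) : 'rV[int]_n := \row_j (val j == m)%:R.

Definition iprod (u v : 'rV[int]_n) : int := \sum_j u 0 j * v 0 j.

Definition simple_root (k : 'I_n) : 'rV[int]_n :=
  if k == 0 :> nat then evec 0 + evec 1 else evec k - evec k.-1.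

(* (i, j, b) stands for e_j + e_i if b is false and e_j - e_i if b is true.   *)
Definition posroot := {p : 'I_n * 'I_n * bool | (p.1.1 < p.1.2)%N}.

Definition root_vec (b : posroot) : 'rV[int]_n :=
  let: (i, j, neg) := val b in evec j + (-1) ^+ neg *: evec i.

End RootsD.

(* (m, p) stands for the Laurent polynomial p(X) / X^m over Z. *)
Definition laurent := (nat * {poly int})%type.

Definition laurent_eval (F : fieldType) (f : laurent) (x : F) : F :=
  (map_poly intr f.2).[x] / x ^+ f.1.

(* F^o is F as a one-dimensional vector space over itself. *)
Notation cw_space n F := {ffun posroot n -> F^o}.

Section CohenWales.
Variables (n : nat) (F : fieldType).

(* The basis vector x_v if v is a positive root, and 0 otherwise. *)
Definition xvec (v : 'rV[int]_n) : cw_space n F :=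
  [ffun b => (root_vec b == v)%:R].

(* The linear map sending the basis vector indexed by b to f b. *)
Definition lin_ext (f : posroot n -> cw_space n F) : 'End(cw_space n F) :=
  linfun (fun v : cw_space n F => \sum_b (v b : F) *: f b).

Definition cw_tau (rho : F) (k : 'I_n) : 'End(cw_space n F) :=
  lin_ext (fun b =>
    let a := simple_root k in
    let v := root_vec b in
    if iprod a v == 2 then 0
    else if iprod a v == 1 then rho *: xvec (v - a)
    else if iprod a v == 0 then xvec v
    else (1 - rho ^+ 2) *: xvec v + rho *: xvec (v + a)).

Definition cw_T (T : 'I_n -> posroot n -> laurent) (rho : F) (k : 'I_n) :
    'End(cw_space n F) :=
  lin_ext (fun b => laurent_eval (T k b) rho *: xvec (simple_root k)).

Definition cw_sigma (T : 'I_n -> posroot n -> laurent) (rho t : F) (k : 'I_n) :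
    'End(cw_space n F) :=
  cw_tau rho k + t *: cw_T T rho k.

End CohenWales.

(* The field Q(rho, t) of rational functions in two indeterminates. *)
Definition ratfun2 : fieldType := {fraction {poly {poly int}}}.
Definition rho_gen : ratfun2 := tofrac ('X%:P : {poly {poly int}}).
Definition t_gen : ratfun2 := tofrac ('X : {poly {poly int}}).

Definition cw_coefficients n (T : 'I_n -> posroot n -> laurent) : Prop :=
  (forall k b, root_vec b = simple_root k ->
     laurent_eval (T k b) rho_gen = rho_gen ^+ 4) /\
  artinD_relations (fun f g => (f \o g)%VF) (cw_sigma T rho_gen t_gen).

Definition is_cohen_wales (F : fieldType) (t r : F) n
    (phi : artin_group n -> 'End(cw_space n (gen_field [:: t; r]))) : Prop :=
  is_representation phi /\
  exists T : 'I_n -> posroot n -> laurent, cw_coefficients T /\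
    forall k, phi (artin_gen k) = cw_sigma T (gen_snd t r)^-1 (gen_fst t r) k.

(* Main.v *)
(** Write N = n - 1 for the last node (nodes are numbered from 0), q = rho^2 = r^-2,
and S_k for the image of s_k. Then (S_k - 1)(S_k + q) v is a multiple of
x_(alpha_k), with coefficient f_k(v) say.

Irreducibility. Let U be an invariant subspace. If f_N(v) <> 0 for some v in U,
then U contains a simple root vector and is everything. Otherwise U is a module
over the Hecke algebra. Let X be the Jucys-Murphy element of the parabolic
subgroup generated by the first N nodes and Y = S_N X S_N; they commute. The
coordinate c at the highest root is a sum of eigenfunctionals of X with
eigenvalues 1, q a and -a, where a = rho^(2N-2), and c Y = s c with
s = t rho^(4N). Unless s is mu^2 or q mu nu for distinct eigenvalues mu, nu,
which gives the six exceptional values of t, this forces c = 0 on U, and then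
U = 0.

Reducibility. For each exceptional t there is an explicit submodule: the line of
the sum of the rho^(height beta) x_beta (t = r^(4n-4)), two spaces parametrized
by sequences a_0, ..., a_N (t = r^(2n-4) and t = -r^(2n-2)), two graphs over the
coordinates at the roots e_j + e_i (t = r^4 and t = 1), and the common kernel of
the f_k (t = -1).

The elements T_(k,beta) needed for this are determined over Q(rho, t) by the
relations, as Laurent polynomials in rho, and then specialized. *)
Require Import Defs.
From HB Require Import structures.
From mathcomp Require Import all_boot all_order all_algebra.
From mathcomp Require boolp.
From mathcomp Require Import reals complex.
From mathcomp Require Import ring zify.

Set Implicit Arguments.
Unset Strict Implicit.
Unset Printing Implicit Defensive.

Import Order.TTheory GRing.Theory.
Local Open Scope ring_scope.

(** * Coordinates in the root basis *)

(** Only [T N] has a short closed form, and the proof is arranged so that no other T_k is needed in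
    full. The coordinates at e_N - e_i and e_N + e_i are simple-root coordinates for no node k < N,
    so those nodes act on them by formulas free of t and T. Hence X acts on three functionals (c,
    the coordinate d at alpha_N, and a weighted row sum i) by an explicit matrix, and t enters only
    through d(S_N v) = t T_N v; this produces s. On U the quadratic relation gives two values of u(X
    S_N X S_N S_N v) for each eigenfunctional u. With c S_N = c this leaves one linear relation
    between the eigencomponents of c, and its instances at v, X v, X^2 v separate them. The
    assumptions on r make 1 - q, 1 + q, 1 + a and q a - 1 invertible, so the eigenfunctionals exist
    and their eigenvalues differ. For reducibility the missing T_k are bypassed by braid relations:
    they remove the unknown multiple of a simple root vector, and for t = -1 they carry an identity
    checked on the last edge to all edges. *)

Section LinExt.
Variables (n : nat) (F : fieldType) (f : posroot n -> cw_space n F).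

Definition lin_ext_fun (v : cw_space n F) : cw_space n F :=
  \sum_b (v b : F) *: f b.

Fact lin_ext_fun_is_linear : linear lin_ext_fun.
Proof.
move=> a u v; rewrite /lin_ext_fun scaler_sumr -big_split; apply: eq_bigr => b _.
by rewrite !ffunE scalerDl scalerA.
Qed.

HB.instance Definition _ :=
  GRing.isLinear.Build F (cw_space n F) (cw_space n F) _ lin_ext_fun
    lin_ext_fun_is_linear.

Lemma lin_extE v : lin_ext f v = \sum_b (v b : F) *: f b.
Proof. exact: (lfunE lin_ext_fun v). Qed.

End LinExt.

Lemma simple_coord_ge k i j (s : bool) : (i < j)%N ->
  -1 <= (k.+1 == j)%:R + (-1) ^+ s * (k.+1 == i)%:R -
        ((k == j)%:R + (-1) ^+ s * (k == i)%:R) :> int.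
Proof.
move=> ij; case: (k.+1 =P j) => ?; case: (k.+1 =P i) => ?; case: (k =P j) => ?;
  case: (k =P i) => ?; case: s;
  try (exfalso; lia); by [].
Qed.

Section Roots.
Variable N : nat.

Definition root_of (i j : nat) (s : bool) : 'rV[int]_N.+1 :=
  evec N.+1 j + (-1) ^+ s *: evec N.+1 i.

Definition simple (k : nat) : 'rV[int]_N.+1 := simple_root (inord k : 'I_N.+1).

Lemma root_ofE a i j s : (a <= N)%N ->
  root_of i j s 0 (inord a) = (a == j)%:R + (-1) ^+ s * (a == i)%:R.
Proof. by move=> aN; rewrite !mxE /= inordK. Qed.

Lemma root_vecE (b : posroot N.+1) :
  root_vec b = root_of (val b).1.1 (val b).1.2 (val b).2.
Proof. by case: b => [[[i j] s] ?]. Qed.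

Lemma posroot_of i j s : (i < j <= N)%N ->
  exists2 b : posroot N.+1, root_vec b = root_of i j s
    & [/\ (val b).1.1 = i :> nat, (val b).1.2 = j :> nat & (val b).2 = s].
Proof.
move=> /andP[ij jN].
have iK : (inord i : 'I_N.+1) = i :> nat by rewrite inordK //; lia.
have jK : (inord j : 'I_N.+1) = j :> nat by rewrite inordK.
have p : ((inord i : 'I_N.+1, inord j : 'I_N.+1, s).1.1 < (inord i : 'I_N.+1, inord j : 'I_N.+1, s).1.2)%N.
  by rewrite /= iK jK.
by exists (exist _ (inord i, inord j, s) p); rewrite ?root_vecE /= ?iK ?jK.
Qed.

Lemma simple0 : (0 < N)%N -> simple 0 = root_of 0 1 false.
Proof. by move=> N0; rewrite /simple /simple_root inordK //= /root_of expr0 scale1r addrC. Qed.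

Lemma simpleS k : (k < N)%N -> simple k.+1 = root_of k k.+1 true.
Proof. by move=> kN; rewrite /simple /simple_root inordK //= /root_of expr1 scaleN1r. Qed.

Lemma iprodC (u v : 'rV[int]_N.+1) : iprod u v = iprod v u.
Proof. by apply: eq_bigr => j _; rewrite mulrC. Qed.

Lemma iprodDr (u v w : 'rV[int]_N.+1) : iprod u (v + w) = iprod u v + iprod u w.
Proof. by rewrite /iprod -big_split; apply: eq_bigr => j _; rewrite mxE mulrDr. Qed.

Lemma iprodBr (u v w : 'rV[int]_N.+1) : iprod u (v - w) = iprod u v - iprod u w.
Proof. by rewrite /iprod -sumrB; apply: eq_bigr => j _; rewrite !mxE mulrBr. Qed.

Lemma iprod_evec a (u : 'rV[int]_N.+1) : (a <= N)%N ->
  iprod (evec N.+1 a) u = u 0 (inord a).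
Proof.
move=> aN; rewrite /iprod (bigD1 (inord a)) //= mxE /= inordK // eqxx mul1r.
rewrite big1 ?addr0 // => j ja; rewrite mxE /=; case: eqP => [ej|]; last by rewrite mul0r.
by case/eqP: ja; apply: val_inj; rewrite /= inordK.
Qed.

Lemma iprod_simple0 (u : 'rV[int]_N.+1) : (0 < N)%N ->
  iprod (simple 0) u = u 0 (inord 0) + u 0 (inord 1).
Proof.
move=> N0; rewrite iprodC simple0 // /root_of expr0 scale1r iprodDr ![iprod u _]iprodC.
by rewrite !iprod_evec // addrC.
Qed.

Lemma iprod_simpleS k (u : 'rV[int]_N.+1) : (k < N)%N ->
  iprod (simple k.+1) u = u 0 (inord k.+1) - u 0 (inord k).
Proof.
move=> kN; rewrite iprodC simpleS // /root_of expr1 scaleN1r iprodBr ![iprod u _]iprodC.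
by rewrite !iprod_evec // ltnW.
Qed.

(** The last branch of [cw_tau] is a plain else. This bound ensures that it is taken only for inner
    product -1. *)
Lemma iprod_simple_ge k (b : posroot N.+1) : (0 < N)%N -> (k <= N)%N ->
  -1 <= iprod (simple k) (root_vec b).
Proof.
case: b => [[[i j] s] ij] N0; rewrite root_vecE /=; move: ij => /= ij.
case: k => [|k] kN.
  rewrite iprod_simple0 // !root_ofE //.
  by case: s; move: ij; case: i => -[|[|i]] ? /=; case: j => -[|[|j]] ? /=.
rewrite (iprod_simpleS _ kN) (root_ofE _ _ _ kN) (root_ofE _ _ _ (ltnW kN)).
exact: simple_coord_ge.
Qed.

Lemma iprod_simple_simple k : (0 < N)%N -> (k <= N)%N -> iprod (simple k) (simple k) = 2.
Proof.
move=> N0; case: k => [|k] kN.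
  by rewrite iprod_simple0 // simple0 // !root_ofE.
rewrite (iprod_simpleS _ kN) (simpleS kN) (root_ofE _ _ _ kN) (root_ofE _ _ _ (ltnW kN)) !eqxx.
by rewrite (gtn_eqF (ltnSn k)) (ltn_eqF (ltnSn k)).
Qed.

Lemma root_of_inj i j s i' j' s' : (i < j <= N)%N -> (i' < j' <= N)%N ->
  root_of i j s = root_of i' j' s' -> [/\ i = i', j = j' & s = s'].
Proof.
move=> /andP[ij jN] /andP[ij' jN'] e.
have iN := ltnW (leq_trans ij jN).
have E a : (a <= N)%N -> (a == j)%:R + (-1) ^+ s * (a == i)%:R =
   (a == j')%:R + (-1) ^+ s' * (a == i')%:R :> int.
  by move=> aN; rewrite -!root_ofE // e.
have [jj|jj|jj] := ltngtP j j'.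
- have := E j' jN'; rewrite eqxx (gtn_eqF jj) (gtn_eqF (ltn_trans ij jj)) (gtn_eqF ij').
  by rewrite !mulr0 !addr0.
- have := E j jN; rewrite eqxx (gtn_eqF ij) (gtn_eqF jj) (gtn_eqF (ltn_trans ij' jj)).
  by rewrite !mulr0 !addr0.
have := E i iN; rewrite -jj eqxx (ltn_eqF ij).
case: (i =P i') => [ii|_]; last by rewrite mulr0 mulr1; case: s {E e}.
by case: s s' {E e} => [] [] //= _; split.
Qed.

Lemma root_vec_inj : injective (@root_vec N.+1).
Proof.
move=> [[[i j] s] ij] [[[i' j'] s'] ij']; rewrite !root_vecE /= => /root_of_inj.
case; rewrite ?(leq_trans _ (ltn_ord _)) //= ?andbT.
- by rewrite ij -ltnS ltn_ord.
- by rewrite ij' -ltnS ltn_ord.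
by move=> ei ej es; apply: val_inj => /=; congr (_, _, _) => //; exact: val_inj.
Qed.

End Roots.

Section Sigma.
Variables (F : fieldType) (N : nat) (c : 'I_N.+1 -> posroot N.+1 -> F) (rho t : F).
Local Notation V := (cw_space N.+1 F).
Hypothesis N_ge2 : (1 < N)%N.

Let N_gt0 : (0 < N)%N := ltnW N_ge2.

Definition sigma_of (k : 'I_N.+1) : 'End(V) :=
  cw_tau rho k + t *: lin_ext (fun b => c k b *: xvec F (simple_root k)).

Definition sig (k : nat) : 'End(V) := sigma_of (inord k).

(** Written as a sum so that it is total: it is 0 when [u] is not a positive root, and otherwise has
    exactly one term. *)
Definition coord_at (u : 'rV[int]_N.+1) (v : V) : F :=
  \sum_(b | root_vec b == u) v b.

Definition co i j s (v : V) : F := coord_at (root_of N i j s) v.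

Definition tval (k : nat) (v : V) : F := \sum_b v b * c (inord k) b.

Definition xr i j s : V := xvec F (root_of N i j s).

Lemma coord_atD u v w : coord_at u (v + w) = coord_at u v + coord_at u w.
Proof. by rewrite /coord_at -big_split; apply: eq_bigr => b _; rewrite ffunE. Qed.

Lemma coord_atZ u a v : coord_at u (a *: v) = a * coord_at u v.
Proof. by rewrite /coord_at mulr_sumr; apply: eq_bigr => b _; rewrite ffunE. Qed.

Lemma coD i j s v w : co i j s (v + w) = co i j s v + co i j s w.
Proof. exact: coord_atD. Qed.

Lemma coZ i j s a v : co i j s (a *: v) = a * co i j s v.
Proof. exact: coord_atZ. Qed.

Lemma tvalD k v w : tval k (v + w) = tval k v + tval k w.
Proof. by rewrite /tval -big_split; apply: eq_bigr => b _; rewrite ffunE mulrDl. Qed.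

Lemma tvalZ k a v : tval k (a *: v) = a * tval k v.
Proof.
by rewrite /tval mulr_sumr; apply: eq_bigr => b _; rewrite ffunE -mulrA.
Qed.

Lemma coord_at_root b v : coord_at (root_vec b) v = v b.
Proof.
rewrite /coord_at (big_pred1 b) // => b'.
by apply/eqP/eqP => [/root_vec_inj|->].
Qed.

Lemma coord_at_xvec u u' : (exists b : posroot N.+1, root_vec b = u) ->
  coord_at u (xvec F u') = (u == u')%:R.
Proof. by move=> [b <-]; rewrite coord_at_root ffunE. Qed.

Lemma tval_xvec k b : tval k (xvec F (root_vec b)) = c (inord k) b.
Proof.
rewrite /tval (bigD1 b) //= ffunE eqxx mul1r big1 ?addr0 // => b' /negPf ne.
by rewrite ffunE (inj_eq (@root_vec_inj N)) ne mul0r.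
Qed.

Lemma sigE k v b : sig k v b = \sum_b' v b' *
   (let a := simple N k in let u := root_vec b' in
    if iprod a u == 2 then 0
    else if iprod a u == 1 then rho * (root_vec b == u - a)%:R
    else if iprod a u == 0 then (root_vec b == u)%:R
    else (1 - rho ^+ 2) * (root_vec b == u)%:R + rho * (root_vec b == u + a)%:R)
   + t * tval k v * (root_vec b == simple N k)%:R.
Proof.
rewrite /sig /sigma_of add_lfunE scale_lfunE /cw_tau !lin_extE ffunE [in X in _ + X]ffunE.
rewrite !sum_ffunE; congr (_ + _).
  apply: eq_bigr => b' _; rewrite ffunE; congr (_ * _).
  by do 3 (case: ifP => _; first by rewrite ?ffunE); rewrite !ffunE.
rewrite [RHS]mulrAC -mulrA; congr (_ * _).
rewrite /tval mulr_sumr; apply: eq_bigr => b' _; rewrite !ffunE /GRing.scale /=.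
ring.
Qed.

Section OneNode.
Variables (k : nat) (v : V) (b : posroot N.+1).
Hypothesis kN : (k <= N)%N.
Local Notation a := (simple N k).

Let ge b' := iprod_simple_ge b' N_gt0 kN.
Let aa := iprod_simple_simple N_gt0 kN.

Lemma ip_add u w : u = w + a -> iprod a u = iprod a w + 2.
Proof. by move=> ->; rewrite iprodDr aa. Qed.

Lemma ip_sub u w : u = w - a -> iprod a u = iprod a w - 2.
Proof. by move=> ->; rewrite iprodBr aa. Qed.

(** [cw_tau] is given on basis vectors; this lemma and the next three read it by rows. For inner
    product 1 the only basis vector whose image meets b is the one at b - a, which has inner product
    -1. *)
Lemma sig_ip1 : iprod a (root_vec b) = 1 ->
  sig k v b = rho * coord_at (root_vec b - a) v.
Proof.
move=> ib; rewrite sigE /=.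
have -> : (root_vec b == a) = false.
  by apply/eqP => e; move: ib; rewrite e aa.
rewrite mulr0 addr0 /coord_at mulr_sumr [RHS]big_mkcond /=; apply: eq_bigr => b' _.
have [e|ne] := eqVneq (root_vec b') (root_vec b - a).
  have ib' : iprod a (root_vec b') = -1 by rewrite (ip_sub e) ib.
  rewrite ib' /= e subrK eqxx mulr1 (_ : (root_vec b == _) = false) ?mulr0 ?add0r 1?mulrC //.
  by apply/eqP => e'; move: ib'; rewrite e -e' ib.
have -> : (root_vec b == root_vec b' + a) = false.
  by apply: contraNF ne => /eqP->; rewrite addrK.
case: ifP => _; first by rewrite mulr0.
case: (iprod a (root_vec b') =P 1) => [ib'|nib].
  rewrite (_ : (root_vec b == _) = false) ?mulr0 //.
  by apply/eqP => /ip_sub; rewrite ib ib'.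
rewrite (_ : (root_vec b == root_vec b') = false); last first.
  by apply/eqP => e; apply: nib; rewrite -e.
by rewrite !mulr0 addr0; case: ifP; rewrite mulr0.
Qed.

Lemma sig_ip0 : iprod a (root_vec b) = 0 -> sig k v b = v b.
Proof.
move=> ib; rewrite sigE /=.
have -> : (root_vec b == a) = false.
  by apply/eqP => e; move: ib; rewrite e aa.
rewrite mulr0 addr0 (bigD1 b) //= ib /= eqxx mulr1 big1 ?addr0 // => b' /negPf ne.
rewrite (inj_eq (@root_vec_inj N)) [b == b']eq_sym ne.
case: ifP => _; first by rewrite mulr0.
case: (iprod a (root_vec b') =P 1) => [ib'|nib].
  rewrite (_ : (root_vec b == _) = false) ?mulr0 //.
  by apply/eqP => /ip_sub; rewrite ib ib'.
case: ifP => _; rewrite ?mulr0 // add0r (_ : (root_vec b == _) = false) ?mulr0 //.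
apply/eqP => /ip_add; rewrite ib => /eqP; rewrite eq_sym addr_eq0 => /eqP e.
by have := ge b'; rewrite e.
Qed.

Lemma sig_ipN1 : iprod a (root_vec b) = -1 ->
  sig k v b = (1 - rho ^+ 2) * v b + rho * coord_at (root_vec b + a) v.
Proof.
move=> ib; rewrite sigE /=.
have -> : (root_vec b == a) = false.
  by apply/eqP => e; move: ib; rewrite e aa.
rewrite mulr0 addr0 /coord_at mulr_sumr [in RHS]big_mkcond /= (bigD1 b) //=.
rewrite [in RHS](bigD1 b) //= ib /= eqxx mulr1.
have -> : (root_vec b == root_vec b + a) = false.
  by apply/eqP => /ip_add; rewrite ib.
rewrite mulr0 addr0 add0r mulrC; congr (_ + _); apply: eq_bigr => b' /negPf ne.
rewrite (inj_eq (@root_vec_inj N)) [b == b']eq_sym ne.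
have [e|neq] := eqVneq (root_vec b') (root_vec b + a).
  by rewrite (ip_add e) ib /= e addrK eqxx mulr1 mulrC.
case: ifP => _; first by rewrite mulr0.
case: (iprod a (root_vec b') =P 1) => [ib'|nib].
  rewrite (_ : (root_vec b == _) = false) ?mulr0 //.
  by apply/eqP => e; move: neq; rewrite e subrK eqxx.
case: ifP => _; rewrite ?mulr0 // add0r (_ : (root_vec b == _) = false) ?mulr0 //.
apply/eqP => /ip_add; rewrite ib => e.
by have := ge b'; rewrite (_ : iprod a (root_vec b') = - 3) //; apply: (addIr 2); rewrite -e.
Qed.

Lemma sig_ip2 : root_vec b = a -> sig k v b = t * tval k v.
Proof.
move=> e; rewrite sigE /= e eqxx mulr1 big1 ?add0r // => b' _.
case: ifP => [_|n2]; first by rewrite mulr0.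
case: (iprod a (root_vec b') =P 1) => [ib'|nib].
  rewrite (_ : (a == _) = false) ?mulr0 //.
  by apply/eqP => /ip_sub; rewrite ib' aa.
have nab : (a == root_vec b') = false.
  by apply/eqP => e'; move: n2; rewrite -e' aa.
case: (iprod a (root_vec b') =P 0) => [ib'|nib']; first by rewrite nab mulr0.
rewrite nab (_ : (a == _ + _) = false) ?mulr0 ?addr0 ?mulr0 //.
apply/eqP => /ip_add; rewrite aa => e'.
by apply: nib'; apply: (addIr 2); rewrite -e'.
Qed.

End OneNode.

Section Pair.
Variables (k i j i' j' : nat) (s s' : bool).
Hypotheses (kN : (k <= N)%N) (ij : (i < j <= N)%N) (ij' : (i' < j' <= N)%N).
Hypothesis up : root_of N i' j' s' = root_of N i j s + simple N k.
Hypothesis ip : iprod (simple N k) (root_of N i j s) = -1.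

Let ip' : iprod (simple N k) (root_of N i' j' s') = 1.
Proof. by rewrite up iprodDr ip iprod_simple_simple. Qed.

Lemma co_up v : co i j s (sig k v) = (1 - rho ^+ 2) * co i j s v + rho * co i' j' s' v.
Proof.
have [b rb _] := posroot_of s ij.
by rewrite /co up -rb !coord_at_root sig_ipN1 // rb.
Qed.

Lemma co_down v : co i' j' s' (sig k v) = rho * co i j s v.
Proof.
have [b rb _] := posroot_of s' ij'.
by rewrite /co -rb !coord_at_root sig_ip1 // rb // up addrK.
Qed.

End Pair.

Lemma co_fix k i j s v : (k <= N)%N -> (i < j <= N)%N ->
  iprod (simple N k) (root_of N i j s) = 0 -> co i j s (sig k v) = co i j s v.
Proof.
move=> kN /(posroot_of s)[b rb _] ip.
by rewrite /co -rb !coord_at_root sig_ip0 // rb.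
Qed.

Lemma co_xr i j s i' j' s' : (i < j <= N)%N -> (i' < j' <= N)%N ->
  co i j s (xr i' j' s') = [&& i == i', j == j' & s == s']%:R.
Proof.
move=> ij ij'; rewrite /co /xr coord_at_xvec; last by have [b] := posroot_of s ij; exists b.
congr ((nat_of_bool _)%:R); apply/eqP/and3P => [/(root_of_inj ij ij')[-> -> ->]//|].
by case=> /eqP-> /eqP-> /eqP->.
Qed.

Lemma coP v w : (forall i j s, (i < j <= N)%N -> co i j s v = co i j s w) -> v = w.
Proof.
move=> vw; apply/ffunP => b; have := vw (val b).1.1 (val b).1.2 (val b).2.
rewrite /co -root_vecE !coord_at_root; apply.
by rewrite (valP b) -ltnS ltn_ord.
Qed.

End Sigma.

Ltac decide_coords :=
  repeat match goal with
  | |- context [@eq_op _ ?x ?y] => case: (x =P y) => ?; try (exfalso; lia)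
  end; by [].

Section Rules.
Variables (F : fieldType) (N : nat) (c : 'I_N.+1 -> posroot N.+1 -> F) (rho t : F).
Hypothesis N_ge2 : (1 < N)%N.
Local Notation S := (sig c rho t).
Local Notation q := (rho ^+ 2).

Let N_gt0 : (0 < N)%N := ltnW N_ge2.

Lemma ip_S k i j s : (k < N)%N -> iprod (simple N k.+1) (root_of N i j s) =
  (k.+1 == j)%:R + (-1) ^+ s * (k.+1 == i)%:R - ((k == j)%:R + (-1) ^+ s * (k == i)%:R).
Proof. by move=> kN; rewrite (iprod_simpleS _ kN) (root_ofE _ _ _ kN) (root_ofE _ _ _ (ltnW kN)). Qed.

Lemma ip_0 i j s : iprod (simple N 0) (root_of N i j s) =
  (0%N == j)%:R + (-1) ^+ s * (0%N == i)%:R + ((1%N == j)%:R + (-1) ^+ s * (1%N == i)%:R).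
Proof. by rewrite iprod_simple0 // (root_ofE _ _ _ (leq0n _)) (root_ofE _ _ _ N_gt0). Qed.

Section JRule.
Variables (k i : nat) (s : bool).
Hypotheses (ik : (i < k)%N) (kN : (k < N)%N).
Let up : root_of N i k.+1 s = root_of N i k s + simple N k.+1.
Proof. by rewrite simpleS // /root_of expr1; apply/rowP => a; rewrite !mxE; ring. Qed.
Let ip : iprod (simple N k.+1) (root_of N i k s) = -1.
Proof. by rewrite ip_S //; case: s; decide_coords. Qed.
Let v1 : (i < k <= N)%N. Proof. by rewrite ik ltnW. Qed.
Let v2 : (i < k.+1 <= N)%N. Proof. by rewrite ltnW. Qed.

Lemma co_j_up v : co i k s (S k.+1 v) = (1 - q) * co i k s v + rho * co i k.+1 s v.
Proof. exact: (co_up c rho t N_ge2 kN v1 up ip). Qed.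
Lemma co_j_down v : co i k.+1 s (S k.+1 v) = rho * co i k s v.
Proof. exact: (co_down c rho t N_ge2 kN v2 up ip). Qed.
End JRule.

Section IRule.
Variables (k j : nat).
Hypothesis (kj : (k.+1 < j <= N)%N).
Let kN : (k < N)%N. Proof. by lia. Qed.
Let v1 : (k < j <= N)%N. Proof. by lia. Qed.
Let up : root_of N k.+1 j false = root_of N k j false + simple N k.+1.
Proof. by rewrite simpleS // /root_of expr1 expr0; apply/rowP => a; rewrite !mxE; ring. Qed.
Let ip : iprod (simple N k.+1) (root_of N k j false) = -1.
Proof. by rewrite ip_S //; decide_coords. Qed.
Let upm : root_of N k j true = root_of N k.+1 j true + simple N k.+1.
Proof. by rewrite simpleS // /root_of expr1; apply/rowP => a; rewrite !mxE; ring. Qed.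
Let ipm : iprod (simple N k.+1) (root_of N k.+1 j true) = -1.
Proof. by rewrite ip_S //; decide_coords. Qed.

(** Adding e_(k+1) - e_k raises the index i in e_j + e_i but lowers it in e_j - e_i, so the rules
    for the two signs run in opposite directions. *)
Lemma co_p_up v :
  co k j false (S k.+1 v) = (1 - q) * co k j false v + rho * co k.+1 j false v.
Proof. exact: (co_up c rho t N_ge2 kN v1 up ip). Qed.
Lemma co_p_down v : co k.+1 j false (S k.+1 v) = rho * co k j false v.
Proof. exact: (co_down c rho t N_ge2 kN kj up ip). Qed.
Lemma co_m_up v :
  co k.+1 j true (S k.+1 v) = (1 - q) * co k.+1 j true v + rho * co k j true v.
Proof. exact: (co_up c rho t N_ge2 kN kj upm ipm). Qed.
Lemma co_m_down v : co k j true (S k.+1 v) = rho * co k.+1 j true v.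
Proof. exact: (co_down c rho t N_ge2 kN v1 upm ipm). Qed.
End IRule.

Section ZeroRule.
Variable (j : nat).
Hypothesis (lj : (1 < j <= N)%N).
Let v0 : (0 < j <= N)%N. Proof. by lia. Qed.
Let up : root_of N 1 j false = root_of N 0 j true + simple N 0.
Proof. by rewrite simple0 // /root_of expr1 !expr0; apply/rowP => a; rewrite !mxE; ring. Qed.
Let ip : iprod (simple N 0) (root_of N 0 j true) = -1.
Proof. by rewrite ip_0; decide_coords. Qed.
Let upm : root_of N 0 j false = root_of N 1 j true + simple N 0.
Proof. by rewrite simple0 // /root_of expr1 !expr0; apply/rowP => a; rewrite !mxE; ring. Qed.
Let ipm : iprod (simple N 0) (root_of N 1 j true) = -1.
Proof. by rewrite ip_0; decide_coords. Qed.

(** Adding e_0 + e_1 sends e_j - e_0 to e_j + e_1 and e_j - e_1 to e_j + e_0: index and sign change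
    together. *)
Lemma co_0_up v :
  co 0 j true (S 0 v) = (1 - q) * co 0 j true v + rho * co 1 j false v.
Proof. exact: (co_up c rho t N_ge2 (leq0n _) v0 up ip). Qed.
Lemma co_1p_down v : co 1 j false (S 0 v) = rho * co 0 j true v.
Proof. exact: (co_down c rho t N_ge2 (leq0n _) lj up ip). Qed.
Lemma co_1_up v :
  co 1 j true (S 0 v) = (1 - q) * co 1 j true v + rho * co 0 j false v.
Proof. exact: (co_up c rho t N_ge2 (leq0n _) lj upm ipm). Qed.
Lemma co_0p_down v : co 0 j false (S 0 v) = rho * co 1 j true v.
Proof. exact: (co_down c rho t N_ge2 (leq0n _) v0 upm ipm). Qed.
End ZeroRule.

Lemma co_fixS k i j s v : (k < N)%N -> (i < j <= N)%N ->
  i != k -> i != k.+1 -> j != k -> j != k.+1 -> co i j s (S k.+1 v) = co i j s v.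
Proof.
move=> kN ij /eqP h1 /eqP h2 /eqP h3 /eqP h4; apply: co_fix => //.
by rewrite ip_S //; case: s; decide_coords.
Qed.

Lemma co_fixS_p k v : (k < N)%N -> co k k.+1 false (S k.+1 v) = co k k.+1 false v.
Proof.
move=> kN; apply: co_fix => //; first by rewrite ltnSn.
by rewrite ip_S //; decide_coords.
Qed.

Lemma co_fix0 i j s v : (1 < i)%N -> (i < j <= N)%N -> co i j s (S 0 v) = co i j s v.
Proof.
move=> i1 ij; apply: co_fix => //.
by rewrite ip_0 //; case: s; decide_coords.
Qed.

Lemma co_fix0_m v : co 0 1 true (S 0 v) = co 0 1 true v.
Proof. by apply: co_fix => //; rewrite ip_0. Qed.

End Rules.

Lemma co_onto (F : fieldType) (N : nat) (f : nat -> nat -> bool -> F) :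
  exists v : cw_space N.+1 F, forall i j s, (i < j <= N)%N -> co i j s v = f i j s.
Proof.
exists [ffun b : posroot N.+1 => f (val b).1.1 (val b).1.2 (val b).2] => i j s ij.
have [b e [<- <- <-]] := posroot_of s ij.
by rewrite /co -root_vecE coord_at_root ffunE.
Qed.

Lemma xr_ind (F : fieldType) (N : nat) (P : cw_space N.+1 F -> Prop) : P 0 ->
  (forall a u v, P u -> P v -> P (a *: u + v)) ->
  (forall i j s, (i < j <= N)%N -> P (xr F N i j s)) -> forall v, P v.
Proof.
move=> P0 Plin Px v.
have -> : v = \sum_b (v b : F) *: xvec F (root_vec b).
  apply/ffunP => b; rewrite sum_ffunE (bigD1 b) //= !ffunE eqxx big1 ?addr0.
    by rewrite /GRing.scale /= mulr1.
  move=> b' /negPf ne; rewrite !ffunE (inj_eq (@root_vec_inj N)) eq_sym ne.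
  by rewrite /GRing.scale /= mulr0.
elim/big_ind: _ => [//|u w Pu Pw|b _].
  by rewrite -[u]scale1r; apply: Plin.
rewrite -[_ *: _]addr0; apply: Plin => //; rewrite root_vecE; apply: Px.
by rewrite (valP b) -ltnS ltn_ord.
Qed.

Section VecRules.
Variables (F : fieldType) (N : nat) (c : 'I_N.+1 -> posroot N.+1 -> F) (rho t : F).
Local Notation V := (cw_space N.+1 F).
Hypothesis N_ge2 : (1 < N)%N.
Local Notation S := (sig c rho t).
Local Notation q := (rho ^+ 2).
Local Notation x := (xr F N).
Local Notation T := (tval c).

Let N_gt0 : (0 < N)%N := ltnW N_ge2.

Definition alpha (k : nat) : V := xvec F (simple N k).

Lemma lin_ext_xvec (f : posroot N.+1 -> V) b : lin_ext f (xvec F (root_vec b)) = f b.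
Proof.
rewrite lin_extE (bigD1 b) //= ffunE eqxx scale1r big1 ?addr0 // => b' /negPf ne.
by rewrite ffunE (inj_eq (@root_vec_inj N)) ne scale0r.
Qed.

Lemma sig_xvec k b : let u := root_vec b in let a := simple N k in
  S k (xvec F u) = (if iprod a u == 2 then 0
    else if iprod a u == 1 then rho *: xvec F (u - a)
    else if iprod a u == 0 then xvec F u
    else (1 - q) *: xvec F u + rho *: xvec F (u + a))
  + (t * T k (xvec F u)) *: alpha k.
Proof.
rewrite /= /sig /sigma_of add_lfunE scale_lfunE /cw_tau !lin_ext_xvec scalerA.
by rewrite tval_xvec.
Qed.

Lemma alpha0 : alpha 0 = x 0 1 false.
Proof. by rewrite /alpha simple0. Qed.

Lemma alphaS k : (k < N)%N -> alpha k.+1 = x k k.+1 true.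
Proof. by move=> kN; rewrite /alpha simpleS. Qed.

Lemma simple_root_vec k : (k <= N)%N -> exists b : posroot N.+1, root_vec b = simple N k.
Proof.
case: k => [|k] kN.
  have [|b e _] := @posroot_of N 0 1 false; first by lia.
  by exists b; rewrite e simple0.
have [|b e _] := @posroot_of N k k.+1 true; first by lia.
by exists b; rewrite e simpleS.
Qed.

Lemma sig_alpha k : (k <= N)%N -> S k (alpha k) = (t * T k (alpha k)) *: alpha k.
Proof.
move=> kN; have [b e] := simple_root_vec kN.
by rewrite /alpha -e sig_xvec /= e iprod_simple_simple // eqxx add0r.
Qed.

Section PairVec.
Variables (k i j i' j' : nat) (s s' : bool).
Hypotheses (kN : (k <= N)%N) (ij : (i < j <= N)%N) (ij' : (i' < j' <= N)%N).
Hypothesis up : root_of N i' j' s' = root_of N i j s + simple N k.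
Hypothesis ip : iprod (simple N k) (root_of N i j s) = -1.

Lemma x_up : S k (x i j s) =
  (1 - q) *: x i j s + rho *: x i' j' s' + (t * T k (x i j s)) *: alpha k.
Proof.
have [b e _] := posroot_of s ij.
by rewrite /xr up -e sig_xvec /= e ip.
Qed.

Lemma x_down : S k (x i' j' s') = rho *: x i j s + (t * T k (x i' j' s')) *: alpha k.
Proof.
have [b e _] := posroot_of s' ij'.
have ip' : iprod (simple N k) (root_of N i' j' s') = 1.
  by rewrite up iprodDr ip iprod_simple_simple.
by rewrite /xr -e sig_xvec /= e ip' /= up addrK.
Qed.

End PairVec.

Lemma x_fix k i j s : (k <= N)%N -> (i < j <= N)%N ->
  iprod (simple N k) (root_of N i j s) = 0 ->
  S k (x i j s) = x i j s + (t * T k (x i j s)) *: alpha k.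
Proof.
move=> kN /(posroot_of s)[b e _] ip.
by rewrite /xr -e sig_xvec /= e ip.
Qed.

Section JRule.
Variables (k i : nat) (s : bool).
Hypotheses (ik : (i < k)%N) (kN : (k < N)%N).
Let up : root_of N i k.+1 s = root_of N i k s + simple N k.+1.
Proof. by rewrite simpleS // /root_of expr1; apply/rowP => a; rewrite !mxE; ring. Qed.
Let ip : iprod (simple N k.+1) (root_of N i k s) = -1.
Proof. by rewrite ip_S //; case: s; decide_coords. Qed.
Let v1 : (i < k <= N)%N. Proof. by rewrite ik ltnW. Qed.
Let v2 : (i < k.+1 <= N)%N. Proof. by rewrite ltnW. Qed.

Lemma x_j_down : S k.+1 (x i k.+1 s) =
  rho *: x i k s + (t * T k.+1 (x i k.+1 s)) *: alpha k.+1.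
Proof. exact: (x_down kN v2 up ip). Qed.
End JRule.

Section IRule.
Variables (k j : nat).
Hypothesis (kj : (k.+1 < j <= N)%N).
Let kN : (k < N)%N. Proof. by lia. Qed.
Let v1 : (k < j <= N)%N. Proof. by lia. Qed.
Let up : root_of N k.+1 j false = root_of N k j false + simple N k.+1.
Proof. by rewrite simpleS // /root_of expr1 expr0; apply/rowP => a; rewrite !mxE; ring. Qed.
Let ip : iprod (simple N k.+1) (root_of N k j false) = -1.
Proof. by rewrite ip_S //; decide_coords. Qed.
Let upm : root_of N k j true = root_of N k.+1 j true + simple N k.+1.
Proof. by rewrite simpleS // /root_of expr1; apply/rowP => a; rewrite !mxE; ring. Qed.
Let ipm : iprod (simple N k.+1) (root_of N k.+1 j true) = -1.
Proof. by rewrite ip_S //; decide_coords. Qed.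

Lemma x_p_up : S k.+1 (x k j false) = (1 - q) *: x k j false +
  rho *: x k.+1 j false + (t * T k.+1 (x k j false)) *: alpha k.+1.
Proof. exact: (x_up v1 up ip). Qed.
Lemma x_p_down : S k.+1 (x k.+1 j false) =
  rho *: x k j false + (t * T k.+1 (x k.+1 j false)) *: alpha k.+1.
Proof. exact: (x_down kN kj up ip). Qed.
Lemma x_m_up : S k.+1 (x k.+1 j true) = (1 - q) *: x k.+1 j true +
  rho *: x k j true + (t * T k.+1 (x k.+1 j true)) *: alpha k.+1.
Proof. exact: (x_up kj upm ipm). Qed.
End IRule.

Section ZeroRule.
Variable (j : nat).
Hypothesis (lj : (1 < j <= N)%N).
Let upm : root_of N 0 j false = root_of N 1 j true + simple N 0.
Proof. by rewrite simple0 // /root_of expr1 !expr0; apply/rowP => a; rewrite !mxE; ring. Qed.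
Let ipm : iprod (simple N 0) (root_of N 1 j true) = -1.
Proof. by rewrite ip_0; decide_coords. Qed.

Lemma x_1m_up : S 0 (x 1 j true) =
  (1 - q) *: x 1 j true + rho *: x 0 j false + (t * T 0 (x 1 j true)) *: alpha 0.
Proof. exact: (x_up lj upm ipm). Qed.
End ZeroRule.

Lemma x_fixS_p k : (k < N)%N ->
  S k.+1 (x k k.+1 false) = x k k.+1 false + (t * T k.+1 (x k k.+1 false)) *: alpha k.+1.
Proof.
move=> kN; apply: x_fix => //; first by rewrite ltnSn.
by rewrite ip_S //; decide_coords.
Qed.

End VecRules.

(** * The representation in terms of coordinates *)

Definition adj (i j : nat) : bool := dynkinD_edge i j || dynkinD_edge j i.

Lemma adjC i j : adj i j = adj j i.
Proof. by rewrite /adj orbC. Qed.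

Section SimpleRoots.
Variable N : nat.
Hypothesis N_ge2 : (1 < N)%N.

Let N_gt0 : (0 < N)%N := ltnW N_ge2.

Lemma simple_inj i j : (i <= N)%N -> (j <= N)%N -> simple N i = simple N j -> i = j.
Proof.
case: i => [|i]; case: j => [|j] // iN jN; rewrite ?simpleS ?simple0 //;
  by case/root_of_inj=> //; lia.
Qed.

Lemma ip_simple_nonadj i j : (i <= N)%N -> (j <= N)%N -> i != j -> ~~ adj i j ->
  iprod (simple N i) (simple N j) = 0.
Proof.
wlog ij : i j / (i < j)%N.
  move=> IH iN jN ij nij; have [h|h|e] := ltngtP i j; first exact: IH.
    by rewrite iprodC IH // 1?eq_sym // adjC.
  by rewrite e eqxx in ij.
case: j ij => // j ij iN jN _; rewrite simpleS //.
case: i ij iN => [|i] ij iN; rewrite /adj /dynkinD_edge /= => nadj.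
  rewrite ip_0 //; case: j ij jN nadj => [|[|j]] //.
rewrite ip_S //; decide_coords.
Qed.

Lemma ip_simple_adj i j : (i <= N)%N -> (j <= N)%N -> adj i j ->
  iprod (simple N i) (simple N j) = -1.
Proof.
wlog ij : i j / (i < j)%N.
  move=> IH iN jN ij; have [h|h|e] := ltngtP i j; first exact: IH.
    by rewrite iprodC IH // adjC.
  by exfalso; move: ij; rewrite e /adj /dynkinD_edge; lia.
case: j ij => // j ij iN jN; rewrite simpleS //.
case: i ij iN => [|i] ij iN; rewrite /adj /dynkinD_edge /= => ad.
  by rewrite ip_0 //; case: j ij jN ad => [|[|j]].
rewrite ip_S //; decide_coords.
Qed.

Lemma simple_add_root i j : (i <= N)%N -> (j <= N)%N -> adj i j ->
  exists b : posroot N.+1, root_vec b = simple N i + simple N j.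
Proof.
wlog ij : i j / (i < j)%N.
  move=> IH iN jN ij; have [h|h|e] := ltngtP i j; first exact: IH.
    by rewrite addrC; apply: IH => //; rewrite adjC.
  by exfalso; move: ij; rewrite e /adj /dynkinD_edge; lia.
case: j ij => // j ij iN jN; rewrite simpleS //.
case: i ij iN => [|i] ij iN; rewrite /adj /dynkinD_edge /= => ad.
  have e : j = 1%N by lia.
  have [|b eb _] := @posroot_of N 0 2 false; first by lia.
  exists b; rewrite eb e simple0 // /root_of !expr0 expr1.
  by apply/rowP => a; rewrite !mxE; ring.
have e : j = i.+1 by lia.
have [|b eb _] := @posroot_of N i i.+2 true; first by lia.
exists b; rewrite eb e simpleS // /root_of !expr1.
by apply/rowP => a; rewrite !mxE; ring.
Qed.

End SimpleRoots.

Section RankTwo.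
Variables (F : fieldType) (N : nat) (c : 'I_N.+1 -> posroot N.+1 -> F) (rho t : F).
Local Notation V := (cw_space N.+1 F).
Hypothesis N_ge2 : (1 < N)%N.
Local Notation S := (sig c rho t).
Local Notation q := (rho ^+ 2).
Local Notation T := (tval c).
Local Notation alpha := (alpha F N).
Local Notation ca k := (coord_at (simple N k)).

Let N_gt0 : (0 < N)%N := ltnW N_ge2.

Lemma simple_add0 : simple N 0 + simple N 2 = root_of N 0 2 false.
Proof.
rewrite simple0 // simpleS // /root_of !expr0 expr1.
by apply/rowP => a; rewrite !mxE; ring.
Qed.

Lemma simple_addS k : (k.+1 < N)%N -> simple N k.+1 + simple N k.+2 = root_of N k k.+2 true.
Proof.
move=> kN; rewrite !simpleS ?(ltnW kN) // /root_of !expr1.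
by apply/rowP => a; rewrite !mxE; ring.
Qed.

Definition beta i j : V := xvec F (simple N i + simple N j).
Definition cb i j (v : V) : F := coord_at (simple N i + simple N j) v.

Lemma ca_alpha i j : (i <= N)%N -> (j <= N)%N -> ca i (alpha j) = (i == j)%:R.
Proof.
move=> iN jN; rewrite coord_at_xvec; last exact: simple_root_vec.
by congr ((nat_of_bool _)%:R); apply/eqP/eqP => [/simple_inj->|->].
Qed.

Lemma ca_self k v : (k <= N)%N -> ca k (S k v) = t * T k v.
Proof.
by move=> kN; have [b e] := simple_root_vec N_ge2 kN; rewrite -e coord_at_root sig_ip2.
Qed.

Lemma ca_nonadj i j v : (i <= N)%N -> (j <= N)%N -> i != j -> ~~ adj i j ->
  ca i (S j v) = ca i v.
Proof.
move=> iN jN ij nij; have [b e] := simple_root_vec N_ge2 iN.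
by rewrite -e !coord_at_root sig_ip0 // e iprodC ip_simple_nonadj.
Qed.

Lemma S_nonadj i j : (i <= N)%N -> (j <= N)%N -> i != j -> ~~ adj i j ->
  S i (alpha j) = alpha j + (t * T i (alpha j)) *: alpha i.
Proof.
move=> iN jN ij nij; have [b e] := simple_root_vec N_ge2 jN.
by rewrite /alpha -e sig_xvec /= e ip_simple_nonadj.
Qed.

Section Adj.
Variables (i j : nat).
Hypotheses (iN : (i <= N)%N) (jN : (j <= N)%N) (ij : adj i j).

Let ij_neq : i != j.
Proof. by apply: contraTneq ij => ->; rewrite /adj /dynkinD_edge; lia. Qed.

Let ip := ip_simple_adj N_ge2 iN jN ij.

Lemma ca_adj v : ca i (S j v) = (1 - q) * ca i v + rho * cb i j v.
Proof.
have [b e] := simple_root_vec N_ge2 iN.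
by rewrite /cb -e !coord_at_root sig_ipN1 // e iprodC ip.
Qed.

Lemma cb_adj v : cb i j (S j v) = rho * ca i v.
Proof.
have [b e] := simple_add_root N_ge2 iN jN ij.
rewrite /cb -e !coord_at_root sig_ip1 //; first by rewrite e addrK.
by rewrite e iprodDr iprodC ip iprod_simple_simple.
Qed.

Lemma S_adj : S i (alpha j) =
  (1 - q) *: alpha j + rho *: beta i j + (t * T i (alpha j)) *: alpha i.
Proof.
have [b e] := simple_root_vec N_ge2 jN.
by rewrite /alpha -e sig_xvec /= e ip /= [simple N j + _]addrC.
Qed.

Lemma S_beta : S i (beta i j) = rho *: alpha j + (t * T i (beta i j)) *: alpha i.
Proof.
have [b e] := simple_add_root N_ge2 iN jN ij.
rewrite /beta -e sig_xvec /= e iprodDr ip iprod_simple_simple //= [simple N i + _]addrC.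
by rewrite addrK.
Qed.

Lemma simple_neq_add : [/\ simple N i != simple N i + simple N j,
  simple N j != simple N i + simple N j & simple N i != simple N j].
Proof.
split; apply/eqP => e.
- by have := iprod_simple_simple N_gt0 iN; rewrite {2}e iprodDr ip iprod_simple_simple.
- have := iprod_simple_simple N_gt0 jN.
  by rewrite {2}e iprodDr iprodC ip iprod_simple_simple.
by have := iprod_simple_simple N_gt0 iN; rewrite {2}e ip.
Qed.

Lemma coord_rank2 :
  [/\ cb i j (alpha i) = 0, cb i j (alpha j) = 0 & cb i j (beta i j) = 1] /\
  [/\ ca i (alpha i) = 1, ca i (alpha j) = 0 & ca i (beta i j) = 0].
Proof.
have [n1 n2 n3] := simple_neq_add.
have rt := simple_add_root N_ge2 iN jN ij; have ri := simple_root_vec N_ge2 iN.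
rewrite /cb !coord_at_xvec // !eqxx (negPf n1) (negPf n3).
by rewrite ![_ + _ == _]eq_sym (negPf n1) (negPf n2).
Qed.

End Adj.

End RankTwo.

Section Model.
Variables (F : fieldType) (N : nat) (rho t : F) (V : lmodType F).
Variables (S : nat -> V -> V) (T : nat -> V -> F).
Variables (co : nat -> nat -> bool -> V -> F) (x : nat -> nat -> bool -> V).
Local Notation q := (rho ^+ 2).

Definition sroot k : V := if k is k'.+1 then x k' k true else x 0 1 false.
Definition scoord k : V -> F := if k is k'.+1 then co k' k true else co 0 1 false.
(* Only meaningful for adjacent [i] and [j]. *)
Definition sroot2 i j : V :=
  if (i == 0) || (j == 0) then x 0 2 false else x (minn i j).-1 (maxn i j) true.
Definition scoord2 i j : V -> F :=
  if (i == 0) || (j == 0) then co 0 2 false else co (minn i j).-1 (maxn i j) true.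

(** An interface with natural indices and an abstract space, since the same theory is needed twice:
    over Q(rho, t), where it determines the coefficients, and over the field of the actual
    representation. It holds for an arbitrary family of coefficients; the braid relations are kept
    apart, in [artin_action]. *)
Record cw_model : Prop := CwModel {
  S_lin : forall k a u v, S k (a *: u + v) = a *: S k u + S k v;
  T_lin : forall k a u v, T k (a *: u + v) = a * T k u + T k v;
  co_lin : forall i j s a u v, co i j s (a *: u + v) = a * co i j s u + co i j s v;
  co_x : forall i j s i' j' s', (i < j <= N)%N -> (i' < j' <= N)%N ->
    co i j s (x i' j' s') = [&& i == i', j == j' & s == s']%:R;
  co_ext : forall u v, (forall i j s, (i < j <= N)%N -> co i j s u = co i j s v) -> u = v;
  co_surj : forall f : nat -> nat -> bool -> F, exists v,
    forall i j s, (i < j <= N)%N -> co i j s v = f i j s;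
  x_ind : forall P : V -> Prop, P 0 -> (forall a u v, P u -> P v -> P (a *: u + v)) ->
    (forall i j s, (i < j <= N)%N -> P (x i j s)) -> forall v, P v;
  coj_up : forall k i s v, (i < k)%N -> (k < N)%N ->
    co i k s (S k.+1 v) = (1 - q) * co i k s v + rho * co i k.+1 s v;
  coj_dn : forall k i s v, (i < k)%N -> (k < N)%N ->
    co i k.+1 s (S k.+1 v) = rho * co i k s v;
  cop_up : forall k j v, (k.+1 < j <= N)%N ->
    co k j false (S k.+1 v) = (1 - q) * co k j false v + rho * co k.+1 j false v;
  cop_dn : forall k j v, (k.+1 < j <= N)%N ->
    co k.+1 j false (S k.+1 v) = rho * co k j false v;
  com_up : forall k j v, (k.+1 < j <= N)%N ->
    co k.+1 j true (S k.+1 v) = (1 - q) * co k.+1 j true v + rho * co k j true v;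
  com_dn : forall k j v, (k.+1 < j <= N)%N ->
    co k j true (S k.+1 v) = rho * co k.+1 j true v;
  co0m_up : forall j v, (1 < j <= N)%N ->
    co 0 j true (S 0 v) = (1 - q) * co 0 j true v + rho * co 1 j false v;
  co1p_dn : forall j v, (1 < j <= N)%N -> co 1 j false (S 0 v) = rho * co 0 j true v;
  co1m_up : forall j v, (1 < j <= N)%N ->
    co 1 j true (S 0 v) = (1 - q) * co 1 j true v + rho * co 0 j false v;
  co0p_dn : forall j v, (1 < j <= N)%N -> co 0 j false (S 0 v) = rho * co 1 j true v;
  co_fxS : forall k i j s v, (k < N)%N -> (i < j <= N)%N ->
    i != k -> i != k.+1 -> j != k -> j != k.+1 -> co i j s (S k.+1 v) = co i j s v;
  co_fxSp : forall k v, (k < N)%N -> co k k.+1 false (S k.+1 v) = co k k.+1 false v;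
  co_fx0 : forall i j s v, (1 < i)%N -> (i < j <= N)%N -> co i j s (S 0 v) = co i j s v;
  co_fx0m : forall v, co 0 1 true (S 0 v) = co 0 1 true v;
  xj_dn : forall k i s, (i < k)%N -> (k < N)%N -> S k.+1 (x i k.+1 s) =
    rho *: x i k s + (t * T k.+1 (x i k.+1 s)) *: sroot k.+1;
  xp_up : forall k j, (k.+1 < j <= N)%N -> S k.+1 (x k j false) =
    (1 - q) *: x k j false + rho *: x k.+1 j false + (t * T k.+1 (x k j false)) *: sroot k.+1;
  xp_dn : forall k j, (k.+1 < j <= N)%N -> S k.+1 (x k.+1 j false) =
    rho *: x k j false + (t * T k.+1 (x k.+1 j false)) *: sroot k.+1;
  xm_up : forall k j, (k.+1 < j <= N)%N -> S k.+1 (x k.+1 j true) =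
    (1 - q) *: x k.+1 j true + rho *: x k j true + (t * T k.+1 (x k.+1 j true)) *: sroot k.+1;
  x1m_up : forall j, (1 < j <= N)%N -> S 0 (x 1 j true) =
    (1 - q) *: x 1 j true + rho *: x 0 j false + (t * T 0 (x 1 j true)) *: sroot 0;
  xp_fx : forall k, (k < N)%N -> S k.+1 (x k k.+1 false) =
    x k k.+1 false + (t * T k.+1 (x k k.+1 false)) *: sroot k.+1;
  sc_self : forall k v, (k <= N)%N -> scoord k (S k v) = t * T k v;
  sc_nonadj : forall i j v, (i <= N)%N -> (j <= N)%N -> i != j -> ~~ adj i j ->
    scoord i (S j v) = scoord i v;
  sc_adj : forall i j v, (i <= N)%N -> (j <= N)%N -> adj i j ->
    scoord i (S j v) = (1 - q) * scoord i v + rho * scoord2 i j v;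
  sc2_adj : forall i j v, (i <= N)%N -> (j <= N)%N -> adj i j ->
    scoord2 i j (S j v) = rho * scoord i v;
  S_self : forall k, (k <= N)%N -> S k (sroot k) = (t * T k (sroot k)) *: sroot k;
  S_nadj : forall i j, (i <= N)%N -> (j <= N)%N -> i != j -> ~~ adj i j ->
    S i (sroot j) = sroot j + (t * T i (sroot j)) *: sroot i;
  S_adjr : forall i j, (i <= N)%N -> (j <= N)%N -> adj i j -> S i (sroot j) =
    (1 - q) *: sroot j + rho *: sroot2 i j + (t * T i (sroot j)) *: sroot i;
  S_root2 : forall i j, (i <= N)%N -> (j <= N)%N -> adj i j ->
    S i (sroot2 i j) = rho *: sroot j + (t * T i (sroot2 i j)) *: sroot i;
  sc_sroot : forall i j, (i <= N)%N -> (j <= N)%N -> scoord i (sroot j) = (i == j)%:R;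
  sc_rank2 : forall i j, (i <= N)%N -> (j <= N)%N -> adj i j ->
    [/\ scoord2 i j (sroot i) = 0, scoord2 i j (sroot j) = 0,
        scoord2 i j (sroot2 i j) = 1 & scoord i (sroot2 i j) = 0] }.

End Model.

Section Instance.
Variables (F : fieldType) (N : nat) (c : 'I_N.+1 -> posroot N.+1 -> F) (rho t : F).
Hypothesis N_ge2 : (1 < N)%N.
Local Notation V := (cw_space N.+1 F).

Let N_gt0 : (0 < N)%N := ltnW N_ge2.

Lemma sroot_alpha k : (k <= N)%N -> sroot (xr F N) k = alpha F N k.
Proof. by case: k => [|k] kN /=; rewrite ?alpha0 // alphaS. Qed.

Lemma scoordE k v : (k <= N)%N -> scoord (@co F N) k v = coord_at (simple N k) v.
Proof. by case: k => [|k] kN /=; rewrite /co ?simple0 // simpleS. Qed.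

Lemma adj_simple_add i j : (i <= N)%N -> (j <= N)%N -> adj i j ->
  simple N i + simple N j = if (i == 0) || (j == 0) then root_of N 0 2 false
    else root_of N (minn i j).-1 (maxn i j) true.
Proof.
wlog ij : i j / (i < j)%N.
  move=> IH iN jN ij; have [h|[h|e]] : (i < j)%N \/ (j < i)%N \/ i = j by lia.
    exact: IH.
    by rewrite addrC (IH j i) // 1?adjC // orbC minnC maxnC.
  by exfalso; move: ij; rewrite e /adj /dynkinD_edge; lia.
case: j ij => // j ij iN jN.
case: i ij iN => [|i] ij iN; rewrite /adj /dynkinD_edge => ad.
  have -> : j = 1%N by lia.
  exact: simple_add0.
have -> : j = i.+1 by lia.
rewrite simple_addS /=; last by lia.
by congr root_of; lia.
Qed.

Lemma sroot2_beta i j : (i <= N)%N -> (j <= N)%N -> adj i j ->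
  sroot2 (xr F N) i j = beta F N i j.
Proof. by move=> iN jN ij; rewrite /sroot2 /beta adj_simple_add //; case: ifP. Qed.

Lemma scoord2E i j v : (i <= N)%N -> (j <= N)%N -> adj i j ->
  scoord2 (@co F N) i j v = cb i j v.
Proof. by move=> iN jN ij; rewrite /scoord2 /cb adj_simple_add //; case: ifP. Qed.

Lemma cw_modelP : @cw_model F N rho t V (fun k v => sig c rho t k v) (tval c)
  (@co F N) (xr F N).
Proof.
have sr k kN := @sroot_alpha k kN.
split.
- by move=> k a u v; rewrite linearP.
- by move=> k a u v; rewrite tvalD tvalZ.
- by move=> i j s a u v; rewrite coD coZ.
- exact: co_xr.
- exact: coP.
- exact: co_onto.
- exact: xr_ind.
- by move=> *; apply: co_j_up.
- by move=> *; apply: co_j_down.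
- by move=> *; apply: co_p_up.
- by move=> *; apply: co_p_down.
- by move=> *; apply: co_m_up.
- by move=> *; apply: co_m_down.
- by move=> *; apply: co_0_up.
- by move=> *; apply: co_1p_down.
- by move=> *; apply: co_1_up.
- by move=> *; apply: co_0p_down.
- by move=> *; apply: co_fixS.
- by move=> *; apply: co_fixS_p.
- by move=> *; apply: co_fix0.
- by move=> *; apply: co_fix0_m.
- by move=> k i s ik kN; rewrite sr //; apply: x_j_down.
- by move=> k j kj; rewrite sr; [apply: x_p_up|lia].
- by move=> k j kj; rewrite sr; [apply: x_p_down|lia].
- by move=> k j kj; rewrite sr; [apply: x_m_up|lia].
- by move=> j lj; rewrite sr //; apply: x_1m_up.
- by move=> k kN; rewrite sr //; apply: x_fixS_p.
- by move=> k v kN; rewrite scoordE // ca_self.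
- by move=> i j v iN jN ne nad; rewrite !scoordE // ca_nonadj.
- by move=> i j v iN jN ad; rewrite !scoordE // scoord2E // ca_adj.
- by move=> i j v iN jN ad; rewrite !scoordE // !scoord2E // cb_adj.
- by move=> k kN; rewrite sr // sig_alpha.
- by move=> i j iN jN ne nad; rewrite !sr // S_nonadj.
- by move=> i j iN jN ad; rewrite !sr // sroot2_beta // S_adj.
- by move=> i j iN jN ad; rewrite !sr // sroot2_beta // S_beta.
- by move=> i j iN jN; rewrite sr // scoordE // ca_alpha.
move=> i j iN jN ad; rewrite !sr // !scoord2E // sroot2_beta // scoordE //.
by have [[-> -> ->] [_ _ ->]] := coord_rank2 F N_ge2 iN jN ad.
Qed.

End Instance.

(** * The elements T_(k,beta) *)

Definition artin_action N (V : nmodType) (S : nat -> V -> V) : Prop :=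
  (forall i j v, (i <= N)%N -> (j <= N)%N -> adj i j ->
     S i (S j (S i v)) = S j (S i (S j v))) /\
  (forall i j v, (i <= N)%N -> (j <= N)%N -> i != j -> ~~ adj i j ->
     S i (S j v) = S j (S i v)).

(** Used throughout with an explicit multiplier [k] as certificate: the goal becomes a polynomial
    identity for [ring]. *)
Lemma eqr_lin (R : pzRingType) (k x y a b : R) : a = b -> x - y = k * (a - b) -> x = y.
Proof. by move=> ->; rewrite subrr mulr0 => /eqP; rewrite subr_eq0 => /eqP. Qed.

Lemma eqr_lin2 (R : pzRingType) (k l x y a b c d : R) : a = b -> c = d ->
  x - y = k * (a - b) + l * (c - d) -> x = y.
Proof.
by move=> -> ->; rewrite !subrr !mulr0 addr0 => /eqP; rewrite subr_eq0 => /eqP.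
Qed.

Section ModelTheory.
Variables (F : fieldType) (N : nat) (rho t : F) (V : lmodType F).
Variables (S : nat -> V -> V) (T : nat -> V -> F).
Variables (co : nat -> nat -> bool -> V -> F) (x : nat -> nat -> bool -> V).
Hypothesis M : cw_model N rho t S T co x.
Local Notation q := (rho ^+ 2).
Local Notation sr := (sroot x).
Local Notation sr2 := (sroot2 x).
Local Notation sc := (scoord co).
Local Notation sc2 := (scoord2 co).

Lemma S_D k u v : S k (u + v) = S k u + S k v.
Proof. by have := S_lin M k 1 u v; rewrite !scale1r. Qed.
Lemma S_0 k : S k 0 = 0.
Proof. by have := S_lin M k (-1) 0 0; rewrite scaler0 add0r scaleN1r addNr. Qed.
Lemma S_Z k a u : S k (a *: u) = a *: S k u.
Proof. by have := S_lin M k a u 0; rewrite !addr0 S_0 addr0. Qed.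
Lemma S_B k u v : S k (u - v) = S k u - S k v.
Proof. by rewrite -scaleN1r S_D S_Z scaleN1r. Qed.

Lemma T_D k u v : T k (u + v) = T k u + T k v.
Proof. by have := T_lin M k 1 u v; rewrite scale1r mul1r. Qed.
Lemma T_0 k : T k 0 = 0.
Proof. by have := T_lin M k (-1) 0 0; rewrite scaler0 add0r mulN1r addNr. Qed.
Lemma T_Z k a u : T k (a *: u) = a * T k u.
Proof. by have := T_lin M k a u 0; rewrite !addr0 T_0 addr0. Qed.
Lemma co_D i j s u v : co i j s (u + v) = co i j s u + co i j s v.
Proof. by have := co_lin M i j s 1 u v; rewrite scale1r mul1r. Qed.
Lemma co_0 i j s : co i j s 0 = 0.
Proof. by have := co_lin M i j s (-1) 0 0; rewrite scaler0 add0r mulN1r addNr. Qed.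
Lemma co_Z i j s a u : co i j s (a *: u) = a * co i j s u.
Proof. by have := co_lin M i j s a u 0; rewrite !addr0 co_0 addr0. Qed.
Lemma co_B i j s u v : co i j s (u - v) = co i j s u - co i j s v.
Proof. by rewrite -scaleN1r co_D co_Z mulN1r. Qed.

Lemma sc_D k u v : sc k (u + v) = sc k u + sc k v.
Proof. by case: k => [|k]; rewrite /scoord co_D. Qed.
Lemma sc_Z k a u : sc k (a *: u) = a * sc k u.
Proof. by case: k => [|k]; rewrite /scoord co_Z. Qed.
Lemma sc2_D i j u v : sc2 i j (u + v) = sc2 i j u + sc2 i j v.
Proof. by rewrite /scoord2; case: ifP; rewrite co_D. Qed.
Lemma sc2_Z i j a u : sc2 i j (a *: u) = a * sc2 i j u.
Proof. by rewrite /scoord2; case: ifP; rewrite co_Z. Qed.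

Lemma sr2C i j : sr2 i j = sr2 j i.
Proof. by rewrite /sroot2 orbC minnC maxnC. Qed.
Lemma sc2C i j v : sc2 i j v = sc2 j i v.
Proof. by rewrite /scoord2 orbC minnC maxnC. Qed.

Lemma adj_neq i j : adj i j -> i != j.
Proof. by apply: contraTneq => ->; rewrite /adj /dynkinD_edge; lia. Qed.

Hypothesis act : artin_action N S.
Hypothesis T_self : forall k, (k <= N)%N -> T k (sr k) = rho ^+ 4.
Hypotheses (rho0 : rho != 0) (t0 : t != 0).

(** Compare the coordinates at alpha_i of the two sides of the braid relation. On the right S_j
    brings in the coordinate at alpha_i + alpha_j, which S_i turns back into the one at alpha_j,
    hence the term in [T j]. *)
Lemma tval_braid i j v : (i <= N)%N -> (j <= N)%N -> adj i j ->
  T i (S j (S i v)) = (1 - q) * T i (S j v) + q * T j v.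
Proof.
move=> iN jN ij; have ji : adj j i by rewrite adjC.
have := congr1 (sc i) (act.1 i j v iN jN ij).
rewrite (sc_self M) // (sc_adj M) // (sc_self M) // sc2C (sc2_adj M) // (sc_self M) //.
by move=> E; apply: (mulfI t0); rewrite E; ring.
Qed.

Lemma tval_comm i j v : (i <= N)%N -> (j <= N)%N -> i != j -> ~~ adj i j ->
  T i (S j v) = T i v.
Proof.
move=> iN jN ne nad; have := congr1 (sc i) (act.2 i j v iN jN ne nad).
by rewrite (sc_self M) // (sc_nonadj M) // (sc_self M) // => /(mulfI t0).
Qed.

Section Generic.
Hypotheses (tn1 : t * rho ^+ 4 != 1) (tnq : t * rho ^+ 4 != - q).

(** [T i] is invariant under [S j], for which [sr j] is an eigenvector with eigenvalue t rho^4. At t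
    = r^4 this eigenvalue is 1 and the argument breaks down, so it is carried out for an
    indeterminate t. *)
Lemma tval_sroot_nonadj i j : (i <= N)%N -> (j <= N)%N -> i != j -> ~~ adj i j ->
  T i (sr j) = 0.
Proof.
move=> iN jN ne nad; have := tval_comm (sr j) iN jN ne nad.
rewrite (S_self M) // T_Z T_self // => /eqP.
by rewrite -subr_eq0 -{2}[T i _]mul1r -mulrBl mulf_eq0 subr_eq0 (negPf tn1) => /eqP.
Qed.

(** Apply the braid relation to [sr i] and read the coordinates at alpha_i and alpha_i + alpha_j.
    Eliminating one unknown leaves T_j(alpha_i) times (t rho^4 - 1)(t rho^4 + q) equal to 0. *)
Lemma tval_sroot_adj i j : (i <= N)%N -> (j <= N)%N -> adj i j ->
  T j (sr i) = 0 /\ T i (sr2 i j) = rho ^+ 5 - rho ^+ 3.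
Proof.
move=> iN jN ij.
have ji : adj j i by rewrite adjC.
have E := act.1 i j (sr i) iN jN ij.
have [c1 c2 c3 c4] := sc_rank2 M iN jN ij.
have d1 : sc i (sr i) = 1 by rewrite (sc_sroot M) ?eqxx.
have d2 : sc i (sr j) = 0 by rewrite (sc_sroot M) ?(negPf (adj_neq ij)).
have Eb := congr1 (sc2 i j) E; have Ei := congr1 (sc i) E.
move: Eb Ei.
rewrite !((S_self M iN), (S_self M jN), (S_adjr M iN jN ij), (S_adjr M jN iN ji), sr2C j i,
  (S_root2 M iN jN ij), S_D, S_Z).
have -> : S j (sr2 i j) = rho *: sr i + (t * T j (sr2 i j)) *: sr j.
  by rewrite sr2C (S_root2 M jN iN ji).
rewrite !(sc_D, sc_Z, sc2_D, sc2_Z, c1, c2, c3, c4, d1, d2) T_self //.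
set a := T i (sr j); set b := T j (sr i); set p := T i (sr2 i j).
move=> Eb Ei.
(* [A] is the coefficient of [sr i] in S_i S_j (sr i). The coordinate at alpha_i + alpha_j expresses
   it through [b]. *)
pose A := (1 - q) * (t * rho ^+ 4) + rho * (t * p) + t * b * (t * a).
have EA : A = t ^+ 2 * rho ^+ 4 * b.
  by apply: (mulfI rho0); apply: (eqr_lin (k := -1) Eb); rewrite /A; ring.
have Eb0 : t * b * ((t * rho ^+ 4 - 1) * (t * rho ^+ 4 - (- q))) = 0.
  by apply: (eqr_lin2 (k := 1) (l := 1 - q - t * rho ^+ 4) Ei EA); rewrite /A; ring.
have b0 : b = 0.
  move/eqP: Eb0; rewrite !mulf_eq0 (negPf t0) !subr_eq0 (negPf tn1) (negPf tnq) !orbF.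
  by move/eqP.
split=> //; move: EA; rewrite /A b0 !(mulr0, mul0r, addr0) => EA.
apply: (mulfI t0); apply: (mulfI rho0).
by apply: (eqr_lin (k := 1) EA); ring.
Qed.

End Generic.
End ModelTheory.

Section TopCoefficients.
Variables (F : fieldType) (N : nat) (rho t : F) (V : lmodType F).
Variables (S : nat -> V -> V) (T : nat -> V -> F).
Variables (co : nat -> nat -> bool -> V -> F) (x : nat -> nat -> bool -> V).
Hypothesis M : cw_model N rho t S T co x.
Local Notation q := (rho ^+ 2).
Local Notation sr := (sroot x).
Local Notation sr2 := (sroot2 x).

Hypothesis act : artin_action N S.
Hypothesis T_self : forall k, (k <= N)%N -> T k (sr k) = rho ^+ 4.
Hypotheses (rho0 : rho != 0) (t0 : t != 0).
Hypotheses (tn1 : t * rho ^+ 4 != 1) (tnq : t * rho ^+ 4 != - q).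
Local Notation p := (rho ^+ 5 - rho ^+ 3).

Lemma tval_sroot i j : (i <= N)%N -> (j <= N)%N -> i != j -> T i (sr j) = 0.
Proof.
move=> iN jN ne; have [ij|nij] := boolP (adj i j).
  by rewrite adjC in ij; have [] := tval_sroot_adj M act T_self rho0 t0 tn1 tnq jN iN ij.
exact: (tval_sroot_nonadj M act T_self t0 tn1).
Qed.

Lemma tval_sroot2 i j : (i <= N)%N -> (j <= N)%N -> adj i j -> T i (sr2 i j) = p.
Proof. by move=> iN jN ij; have [] := tval_sroot_adj M act T_self rho0 t0 tn1 tnq iN jN ij. Qed.

Let TD := (T_D M, T_Z M).

Lemma tval_S_sroot i j : (i <= N)%N -> (j <= N)%N -> adj i j -> T i (S j (sr i)) = 0.
Proof.
move=> iN jN ij; have ji : adj j i by rewrite adjC.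
rewrite (S_adjr M jN iN ji) !TD T_self // sr2C tval_sroot2 //.
by rewrite (tval_sroot iN jN (adj_neq ij)) mulr0 addr0; ring.
Qed.

Section Row.
Variables (m j i0 : nat).
Hypotheses (mN : (m <= N)%N) (j1 : (1 < j <= N)%N) (i01 : (0 < i0)%N) (i0j : (i0 < j)%N).
Hypothesis nad : forall k, (k <= i0)%N -> (k != m) && ~~ adj m k.

Let inv k v : (k <= i0)%N -> T m (S k v) = T m v.
Proof. by move=> ki; have /andP[? ?] := nad ki; apply: (tval_comm M act t0) => //; lia. Qed.
Let zer k : (k <= i0)%N -> T m (sr k) = 0.
Proof. by move=> ki; have /andP[? ?] := nad ki; apply: tval_sroot => //; lia. Qed.

Let row_eq (y y' : V) : forall z, z = (1 - q) *: y + rho *: y' -> T m z = T m y -> T m y' = rho * T m y.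
Proof.
move=> z ->; rewrite !TD => e; apply: (mulfI rho0).
by apply: (eqr_lin (k := 1) e); ring.
Qed.

(** Node m commutes with the nodes up to i0, so [T m] is invariant under them and kills their simple
    roots. Applied to S_k y = (1 - q) y + rho y' + ..., this gives T_m(y') = rho T_m(y): each step
    up the row costs one factor rho. *)
Lemma tval_row_m d : (d <= i0)%N -> T m (x (i0 - d) j true) = rho ^+ d * T m (x i0 j true).
Proof.
elim: d => [|d IH] di; first by rewrite subn0 expr0 mul1r.
rewrite exprS -mulrA -IH; last by lia.
have kj : ((i0 - d.+1).+1 < j <= N)%N by lia.
have := inv (x (i0 - d.+1).+1 j true) (_ : ((i0 - d.+1).+1 <= i0)%N).
rewrite (xm_up M) // (_ : (i0 - d.+1).+1 = (i0 - d)%N); last by lia.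
move=> /(_ (leq_subr _ _)) e; apply: (row_eq (erefl _)).
by rewrite -[RHS]e !TD zer ?leq_subr // mulr0 addr0.
Qed.

(** The row goes down to e_j - e_1, passes to e_j + e_0 by node 0, and climbs from there. The first
    stretch has i0 - 1 steps and the passage one. *)
Lemma tval_row_p d : (d <= i0)%N -> T m (x d j false) = rho ^+ (i0 + d) * T m (x i0 j true).
Proof.
elim: d => [|d IH] di.
  have e := inv (x 1 j true) (leq0n _); rewrite (x1m_up M) // in e.
  rewrite addn0 (_ : rho ^+ i0 = rho * rho ^+ i0.-1); last by rewrite -exprS prednK.
  rewrite -mulrA -tval_row_m; last by lia.
  rewrite (_ : (i0 - i0.-1)%N = 1%N); last by lia.
  by apply: (row_eq (erefl _)); rewrite -[RHS]e !TD zer // mulr0 addr0.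
rewrite addnS exprS -mulrA -IH; last by lia.
have e := inv (x d j false) di; rewrite (xp_up M) in e; last by lia.
by apply: (row_eq (erefl _)); rewrite -[RHS]e !TD zer // mulr0 addr0.
Qed.

End Row.

Lemma tval_low m i j s : (2 < m <= N)%N -> (i < j < m)%N -> T m (x i j s) = 0.
Proof.
move=> mN ij; have [j1|j1] := leqP j 1.
  have [-> ->] : i = 0%N /\ j = 1%N by lia.
  case: s.
    by rewrite (_ : x 0 1 true = sr 1) // tval_sroot //; lia.
  by rewrite (_ : x 0 1 false = sr 0) // tval_sroot //; lia.
have base : T m (x j.-1 j true) = 0.
  have -> : x j.-1 j true = sr j by case: (j) j1.
  by rewrite tval_sroot //; lia.
have nad k : (k <= j.-1)%N -> (k != m) && ~~ adj m k.
  by move=> kj; rewrite /adj /dynkinD_edge; lia.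
case: s.
  rewrite -(subKn (_ : i <= j.-1)%N); last by lia.
  by rewrite (tval_row_m (i0 := j.-1)) ?base ?mulr0 //; lia.
by rewrite (tval_row_p (i0 := j.-1)) ?base ?mulr0 //; lia.
Qed.

Lemma tval_top m i : (2 < m <= N)%N -> (i.+1 < m)%N ->
  T m (x i m true) = rho ^+ (m - i.+2) * p /\ T m (x i m false) = rho ^+ (m + i - 2) * p.
Proof.
move=> mN im.
have base : T m (x (m - 2) m true) = p.
  have -> : x (m - 2) m true = sr2 m m.-1.
    rewrite /sroot2 (_ : (m == 0) || _ = false); last by lia.
    by congr (x _ _ true); lia.
  by rewrite tval_sroot2 //; rewrite /adj /dynkinD_edge; lia.
have nad k : (k <= m - 2)%N -> (k != m) && ~~ adj m k.
  by move=> kj; rewrite /adj /dynkinD_edge; lia.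
split.
  rewrite -[in LHS](subKn (_ : i <= m - 2)%N); last by lia.
  rewrite (tval_row_m (i0 := m - 2)) ?base //; try lia.
  by congr (_ ^+ _ * _); lia.
rewrite (tval_row_p (i0 := m - 2)) ?base //; try lia.
by congr (_ ^+ _ * _); lia.
Qed.

(** No commuting node reaches e_(k+1) + e_k. Induction instead: at the next root X of this kind the
    braid identity for the pair (k+2, k+1) gives T_(k+1)(X), and the one for (k+1, k+2) then
    expresses T_(k+2)(X) through T_(k+1)(X) and the previous case. *)
Lemma tval_highest k : (k < N)%N ->
  T k.+1 (x k k.+1 false) = (q - q ^+ 2) * (1 - rho ^+ (2 * k)).
Proof.
elim: k => [|k IH] kN.
  rewrite (_ : x 0 1 false = sr 0) // tval_sroot // muln0 expr0; ring.
have a12 : adj k.+2 k.+1 by rewrite /adj /dynkinD_edge; lia.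
have a21 : adj k.+1 k.+2 by rewrite adjC.
have kN' : (k.+1 <= N)%N by lia.
set X := x k.+1 k.+2 false.
have e1 : S k.+2 X = X + (t * T k.+2 X) *: sr k.+2 by rewrite (xp_fx M).
have e2 : S k.+1 X = rho *: x k k.+2 false + (t * T k.+1 X) *: sr k.+1.
  by rewrite (xp_dn M) // ltnSn.
have e3 : S k.+2 (x k k.+2 false) =
    rho *: x k k.+1 false + (t * T k.+2 (x k k.+2 false)) *: sr k.+2.
  by rewrite (xj_dn M).
have z1 : T k.+2 (sr k.+1) = 0 by rewrite tval_sroot //; lia.
have z2 : T k.+1 (sr k.+2) = 0 by rewrite tval_sroot //; lia.
have y1 : T k.+2 (x k k.+2 false) = rho ^+ (2 * k) * p.
  have [k0|k0] := posnP k.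
    by rewrite k0 muln0 expr0 mul1r -(tval_sroot2 (_ : 2 <= N)%N (leq0n N)) //; lia.
  have [|//|_ ->] := @tval_top k.+2 k; first by lia.
  by congr (_ ^+ _ * _); lia.
have r1 := tval_braid M act t0 X kN kN' a12.
have r2 := tval_braid M act t0 X kN' kN a21.
move: r1 r2; rewrite e1 e2 !(S_D M, S_Z M) e2 e3 !TD z1 z2 !tval_S_sroot // y1 IH; last by lia.
set Y := T k.+1 X; rewrite !(mulr0, addr0) => r1 r2.
have Y1 : Y = rho ^+ (2 * k) * rho * p.
  have q0 : q != 0 by rewrite expf_neq0.
  by apply: (mulfI q0); apply: (eqr_lin (k := -1) r1); ring.
have q0 : q != 0 by rewrite expf_neq0.
apply: (mulfI q0).
rewrite (_ : rho ^+ (2 * k.+1) = rho ^+ (2 * k) * q); last first.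
  by rewrite -exprD; congr (_ ^+ _); lia.
by apply: (eqr_lin2 (k := -1) (l := -(1 - q)) r2 Y1); ring.
Qed.

End TopCoefficients.

(* The sum of [rho ^+ (h - 1)] times the coordinate at [e_N -+ e_i], over      *)
(* [i < m] and both signs, divided by [rho ^+ (N - m)]; [h] is the height.     *)
Fixpoint rowI (R : pzRingType) (V : Type) N (rho : R) (co : nat -> nat -> bool -> V -> R)
    m v : R :=
  if m is m'.+1 then rho * rowI N rho co m' v + co m' N true v + rho ^+ (2 * m') * co m' N false v
  else 0.

(* [jm S m] is the Jucys-Murphy element L_(m+2), where L_2 = s_1 s_0 and       *)
(* L_(k+1) = s_k L_k s_k.                                                      *)
Fixpoint jm (V : Type) (S : nat -> V -> V) m v : V :=
  if m is m'.+1 then S m.+1 (jm S m' (S m.+1 v)) else S 1 (S 0 v).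

(** * Jucys-Murphy elements acting on the coordinates at the e_N - e_i and e_N + e_i *)

Section JucysMurphy.
Variables (F : fieldType) (N : nat) (rho t : F) (V : lmodType F).
Variables (S : nat -> V -> V) (T : nat -> V -> F).
Variables (co : nat -> nat -> bool -> V -> F) (x : nat -> nat -> bool -> V).
Hypothesis M : cw_model N rho t S T co x.
Local Notation q := (rho ^+ 2).
Local Notation I := (rowI N rho co).
Local Notation L := (jm S).

Lemma expr2S m : rho ^+ (2 * m.+1) = rho ^+ (2 * m) * q.
Proof. by rewrite -exprD mulnS addnC. Qed.

Lemma rowIS m v :
  I m.+1 v = rho * I m v + co m N true v + rho ^+ (2 * m) * co m N false v.
Proof. by []. Qed.

Lemma rowI_D m u v : I m (u + v) = I m u + I m v.
Proof. by elim: m => [|m IH] /=; rewrite ?addr0 // IH !(co_D M); ring. Qed.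

Lemma rowI_Z m a v : I m (a *: v) = a * I m v.
Proof. by elim: m => [|m IH] /=; rewrite ?mulr0 // IH !(co_Z M); ring. Qed.

Lemma rowI_low m k v : (m <= k)%N -> (k.+1 < N)%N -> I m (S k.+1 v) = I m v.
Proof. by elim: m => [|m IH] mk kN //=; rewrite IH ?(co_fxS M) //; lia. Qed.

(** A node acts on a pair of neighbouring coordinates by rows (1 - q, rho) and (rho, 0), for which
    (1, rho) is a left eigenvector of eigenvalue 1. The weights in [rowI] have this ratio on each
    exchanged pair. *)
Lemma rowI_S m v : (m.+2 < N)%N -> I m.+3 (S m.+2 v) = I m.+3 v.
Proof.
move=> mN; rewrite !(rowIS m.+2) !(rowIS m.+1) rowI_low //.
rewrite (com_up M) ?(com_dn M) ?(cop_up M) ?(cop_dn M); try lia.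
by rewrite !(expr2S m.+1); ring.
Qed.

Lemma jm_fix m i s v : (m.+1 < i < N)%N -> co i N s (L m v) = co i N s v.
Proof.
elim: m v => [|m IH] v iN /=.
  by rewrite (co_fxS M) ?(co_fx0 M) //; lia.
by rewrite (co_fxS M) ?IH ?(co_fxS M) //; lia.
Qed.

Lemma jm_p m v : (m.+1 < N)%N ->
  co m.+1 N false (L m v) = rho ^+ (2 * m.+1) * co m.+1 N true v.
Proof.
elim: m v => [|m IH] v mN /=.
  by rewrite (cop_dn M) ?(co0p_dn M); [rewrite muln1; ring|lia..].
rewrite (cop_dn M) ?IH ?(com_dn M); [|lia..].
by rewrite (expr2S m.+1); ring.
Qed.

(** With [jm_p] and [rowI_jm] this says that the coordinates at e_N - e_(m+1) and e_N + e_(m+1),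
    together with I_(m+2), span a space of functionals stable under L. *)
Lemma jm_m m v : (m.+1 < N)%N -> co m.+1 N true (L m v) =
  rho ^+ (2 * m.+2) * co m.+1 N false v +
  (1 - q) * (I m.+2 v - rho ^+ (2 * m.+1) * co m.+1 N true v).
Proof.
elim: m v => [|m IH] v mN.
  rewrite /= (com_up M) ?(co0m_up M) ?(co1m_up M); [|lia..].
  by rewrite !muln0 !muln1 !expr0; ring.
rewrite [L _ _]/= (com_up M) ?(@jm_fix m m.+2) ?IH; [|lia..].
rewrite (com_up M) ?(com_dn M) ?(cop_up M); [|lia..].
rewrite [in LHS](rowIS m.+1) (rowIS m.+2) (rowIS m.+1) rowI_low // (com_dn M) ?(cop_up M); [|lia..].
rewrite !(expr2S m.+2) !(expr2S m.+1); ring.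
Qed.

Lemma rowI_jm m v : (m.+1 < N)%N -> I m.+2 (L m v) = I m.+2 v.
Proof.
elim: m v => [|m IH] v mN.
  rewrite /= !(com_up M, com_dn M, cop_up M, cop_dn M); [|lia..].
  by rewrite !(co0m_up M, co1m_up M, co0p_dn M, co1p_dn M); [ring|lia..].
rewrite [L _ _]/= rowI_S // rowIS IH; last by lia.
by rewrite !jm_fix ?leqnn ?ltnSn // -rowIS rowI_S.
Qed.

Lemma jm_S_comm m k v : artin_action N S -> (m.+2 < k <= N)%N -> L m (S k v) = S k (L m v).
Proof.
move=> act; elim: m v => [|m IH] v kN /=.
  have n0 : ~~ adj 0 k by rewrite /adj /dynkinD_edge; lia.
  have n1 : ~~ adj 1 k by rewrite /adj /dynkinD_edge; lia.
  by rewrite (act.2 0 k) ?(act.2 1 k) //; lia.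
have n1 : ~~ adj m.+2 k by rewrite /adj /dynkinD_edge; lia.
by rewrite (act.2 m.+2 k) // ?IH ?(act.2 m.+2 k) //; lia.
Qed.

(** Consecutive Jucys-Murphy elements commute: L commutes with s L s. The base case rests on the
    fork, where nodes 0 and 1 commute and are both joined to node 2. *)
Lemma jm_comm m v : artin_action N S -> (m.+2 <= N)%N ->
  L m (S m.+2 (L m (S m.+2 v))) = S m.+2 (L m (S m.+2 (L m v))).
Proof.
move=> act; elim: m v => [|m IH] v mN.
  have a02 : adj 0 2 by []. have a12 : adj 1 2 by [].
  have C w : S 1 (S 0 w) = S 0 (S 1 w) by apply: (act.2) => //; lia.
  have B0 w : S 0 (S 2 (S 0 w)) = S 2 (S 0 (S 2 w)) by apply: (act.1) => //; lia.
  have B1 w : S 1 (S 2 (S 1 w)) = S 2 (S 1 (S 2 w)) by apply: (act.1) => //; lia.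
  rewrite /= [in RHS](C v) (B0 (S 1 v)) -(B1 (S 0 _)) (C (S 2 (S 1 v))) (B1 v).
  by rewrite -(B0 (S 1 (S 2 v))) -(C (S 2 v)).
have a : adj m.+2 m.+3 by rewrite /adj /dynkinD_edge; lia.
have B w : S m.+2 (S m.+3 (S m.+2 w)) = S m.+3 (S m.+2 (S m.+3 w)).
  by apply: (act.1) => //; lia.
have C w : L m (S m.+3 w) = S m.+3 (L m w) by apply: jm_S_comm => //; lia.
have mN' : (m.+2 <= N)%N by lia.
rewrite /= (B (L m (S m.+2 (S m.+3 v)))) (C (S m.+2 (S m.+3 (L m _)))) -(C (S m.+2 (S m.+3 v))) -(B v).
rewrite (B (L m (S m.+2 v))) (C (S m.+2 (S m.+3 (L m _)))) -(C (S m.+2 v)) -(B (L m (S m.+2 _))).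
by rewrite -(IH _ mN').
Qed.

End JucysMurphy.

(** * Irreducibility *)

Section LinearMaps.
Variables (F : fieldType) (V W : lmodType F) (f : V -> W) (g : V -> F).
Hypotheses (f_lin : forall a v w, f (a *: v + w) = a *: f v + f w)
  (g_lin : forall a v w, g (a *: v + w) = a * g v + g w).

Lemma lmap0 : f 0 = 0.
Proof. by have := f_lin (-1) 0 0; rewrite scaler0 addr0 scaleN1r addNr. Qed.
Lemma lmapZ a v : f (a *: v) = a *: f v.
Proof. by have := f_lin a v 0; rewrite lmap0 !addr0. Qed.
Lemma lmapD v w : f (v + w) = f v + f w.
Proof. by have := f_lin 1 v w; rewrite !scale1r. Qed.
Lemma lmapB v w : f (v - w) = f v - f w.
Proof. by rewrite -scaleN1r lmapD lmapZ scaleN1r. Qed.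

Lemma lform0 : g 0 = 0.
Proof. by have := g_lin (-1) 0 0; rewrite scaler0 addr0 mulN1r addNr. Qed.
Lemma lformZ a v : g (a *: v) = a * g v.
Proof. by have := g_lin a v 0; rewrite lform0 !addr0. Qed.
Lemma lformD v w : g (v + w) = g v + g w.
Proof. by have := g_lin 1 v w; rewrite scale1r mul1r. Qed.
Lemma lformB v w : g (v - w) = g v - g w.
Proof. by rewrite -scaleN1r lformD lformZ mulN1r. Qed.

End LinearMaps.

(** * Joint eigenfunctionals of X and X S X S on a module over the Hecke algebra *)

Section Eigenfunctionals.
Variables (F : fieldType) (V : lmodType F) (X S : V -> V) (P : V -> Prop).
Variables (q s m1 m2 m3 : F) (u1 u2 u3 : V -> F).
Hypotheses (X_lin : forall a v w, X (a *: v + w) = a *: X v + X w)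
  (S_lin : forall a v w, S (a *: v + w) = a *: S v + S w).
Hypotheses (PX : forall v, P v -> P (X v)) (PS : forall v, P v -> P (S v))
  (P_lin : forall a v w, P v -> P w -> P (a *: v + w)).
Hypothesis S_quad : forall v, P v -> S (S v) = (1 - q) *: S v + q *: v.

Definition eigenfunctional m (u : V -> F) : Prop :=
  [/\ forall a v w, u (a *: v + w) = a * u v + u w,
      forall v, P v -> u (X v) = m * u v
    & forall v, P v -> u (X (S (X (S v)))) = s * u v].

Section One.
Variables (m : F) (u : V -> F).
Hypotheses (m0 : m != 0) (eu : eigenfunctional m u).

(** Evaluate u(X S X S (S v)) in two ways: it is s u(S v), and the quadratic relation for S S v
    turns it into (1 - q) s u(v) + q m u(S X v). *)
Lemma eigenfunctional_S v : P v -> u (S (q * m *: X v - s *: v)) = - (1 - q) * s * u v.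
Proof.
have [u_lin uX uXS] := eu; move=> Pv.
have Pw := PX (PS Pv).
have := uXS _ (PS Pv); rewrite S_quad // (lmapD X_lin) !(lmapZ X_lin) (lmapD S_lin).
rewrite !(lmapZ S_lin) (lmapD X_lin) !(lmapZ X_lin) (lformD u_lin) !(lformZ u_lin).
rewrite uXS // uX; last by apply: PS; apply: PX.
rewrite (lmapB S_lin) !(lmapZ S_lin) (lformB u_lin) !(lformZ u_lin) => e.
by apply: (eqr_lin (k := 1) e); ring.
Qed.

End One.

Hypotheses (e1 : eigenfunctional m1 u1) (e2 : eigenfunctional m2 u2)
  (e3 : eigenfunctional m3 u3).
Hypotheses (m12 : m1 != m2) (m13 : m1 != m3) (m23 : m2 != m3) (q0 : q != 0).
Hypotheses (m1_0 : m1 != 0) (m2_0 : m2 != 0) (m3_0 : m3 != 0).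
Hypothesis sum_S : forall v, P v -> u1 (S v) + u2 (S v) + u3 (S v) = u1 v + u2 v + u3 v.

Let pol m v := q * m *: X v - s *: v.

Let P_pol m v : P v -> P (pol m v).
Proof.
move=> Pv; have P0 : P 0 by rewrite -(addNr v) -scaleN1r; apply: P_lin.
rewrite /pol; apply: P_lin; first exact: PX.
by rewrite -scaleNr -[_ *: v]addr0; apply: P_lin.
Qed.

Let u_pol m n u v : eigenfunctional n u -> P v -> u (pol m v) = (q * m * n - s) * u v.
Proof.
by move=> [u_lin uX _] Pv; rewrite /pol (lformB u_lin) !(lformZ u_lin) uX //; ring.
Qed.

Let pol_comm m n v : pol m (pol n v) = pol n (pol m v).
Proof.
rewrite /pol !(lmapB X_lin) !(lmapZ X_lin) !scalerBr !scalerA.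
rewrite (_ : q * m * (q * n) = q * n * (q * m)); last by ring.
rewrite [s * (q * n)]mulrC [s * (q * m)]mulrC !opprD !opprK !addrA; congr (_ + _).
by rewrite addrAC.
Qed.

(** At w = [pol m1 (pol m2 (pol m3 v))] each u_i(S w) is known, because the [pol] commute and the
    i-th can be put outermost. It then contributes -(1 - q) s where u_i(w) has q m_i^2 - s; the
    difference is q (m_i^2 - s). *)
Let comb v : P v ->
  (q * m1 * m2 - s) * (q * m1 * m3 - s) * (q * (m1 ^+ 2 - s)) * u1 v +
  (q * m1 * m2 - s) * (q * m2 * m3 - s) * (q * (m2 ^+ 2 - s)) * u2 v +
  (q * m1 * m3 - s) * (q * m2 * m3 - s) * (q * (m3 ^+ 2 - s)) * u3 v = 0.
Proof.
move=> Pv; pose w := pol m1 (pol m2 (pol m3 v)).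
have Pw : P w by do 3 apply: P_pol.
have E := sum_S Pw.
have E1 : u1 (S w) = - (1 - q) * s * u1 (pol m2 (pol m3 v)).
  by apply: eigenfunctional_S => //; do 2 apply: P_pol.
have E2 : u2 (S w) = - (1 - q) * s * u2 (pol m1 (pol m3 v)).
  by rewrite /w pol_comm; apply: eigenfunctional_S => //; do 2 apply: P_pol.
have E3 : u3 (S w) = - (1 - q) * s * u3 (pol m1 (pol m2 v)).
  rewrite /w [pol m2 (pol m3 v)]pol_comm pol_comm.
  by apply: eigenfunctional_S => //; do 2 apply: P_pol.
move: E; rewrite E1 E2 E3 /w !(u_pol _ e1, u_pol _ e2, u_pol _ e3) //;
  try by repeat apply: P_pol.
by move=> E; apply: (eqr_lin (k := -1) E); ring.
Qed.

(* Evaluating [sum_S] at [prod_j (q m_j X - s) v] and separating the           *)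
(* eigenvalues of [X] forces [s = m_i ^+ 2] or [s = q m_i m_j], [i != j].       *)
Lemma eigenfunctionals_vanish v : P v ->
  s \notin [:: m1 ^+ 2; m2 ^+ 2; m3 ^+ 2; q * m1 * m2; q * m1 * m3; q * m2 * m3] ->
  u1 v + u2 v + u3 v = 0.
Proof.
rewrite !inE !negb_or => Pv /and5P[s1 s2 s3 s12 /andP[s13 s23]].
rewrite eq_sym -subr_eq0 in s1; rewrite eq_sym -subr_eq0 in s2.
rewrite eq_sym -subr_eq0 in s3; rewrite eq_sym -subr_eq0 in s12.
rewrite eq_sym -subr_eq0 in s13; rewrite eq_sym -subr_eq0 in s23.
(* X multiplies the i-th term by m_i, so the three relations form a Vandermonde system in the terms
   g_i u_i(v). *)
have c0 := comb Pv; have c1 := comb (PX Pv); have c2 := comb (PX (PX Pv)).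
have [_ X1 _] := e1; have [_ X2 _] := e2; have [_ X3 _] := e3.
rewrite !X1 ?X2 ?X3 // in c1; rewrite !(X1, X2, X3) // in c2; try exact: PX.
have n12 : m1 - m2 != 0 by rewrite subr_eq0.
have n13 : m1 - m3 != 0 by rewrite subr_eq0.
have n23 : m2 - m3 != 0 by rewrite subr_eq0.
move: c0 c1 c2.
set g1 := _ * (q * (m1 ^+ 2 - s)); set g2 := _ * (q * (m2 ^+ 2 - s)).
set g3 := _ * (q * (m3 ^+ 2 - s)) => c0 c1 c2.
have g1_0 : g1 != 0 by rewrite /g1 !mulf_neq0.
have g2_0 : g2 != 0 by rewrite /g2 !mulf_neq0.
have g3_0 : g3 != 0 by rewrite /g3 !mulf_neq0.
have -> : u1 v = 0.
  apply: (mulfI g1_0); apply: (mulfI n12); apply: (mulfI n13).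
  transitivity ((g1 * (m1 * (m1 * u1 v)) + g2 * (m2 * (m2 * u2 v)) + g3 * (m3 * (m3 * u3 v)))
    - (m2 + m3) * (g1 * (m1 * u1 v) + g2 * (m2 * u2 v) + g3 * (m3 * u3 v))
    + m2 * m3 * (g1 * u1 v + g2 * u2 v + g3 * u3 v)); first by ring.
  by rewrite c0 c1 c2; ring.
have -> : u2 v = 0.
  apply: (mulfI g2_0); apply: (mulfI n12); apply: (mulfI n23).
  transitivity (- ((g1 * (m1 * (m1 * u1 v)) + g2 * (m2 * (m2 * u2 v)) + g3 * (m3 * (m3 * u3 v)))
    - (m1 + m3) * (g1 * (m1 * u1 v) + g2 * (m2 * u2 v) + g3 * (m3 * u3 v))
    + m1 * m3 * (g1 * u1 v + g2 * u2 v + g3 * u3 v))); first by ring.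
  by rewrite c0 c1 c2; ring.
have -> : u3 v = 0.
  apply: (mulfI g3_0); apply: (mulfI n13); apply: (mulfI n23).
  transitivity ((g1 * (m1 * (m1 * u1 v)) + g2 * (m2 * (m2 * u2 v)) + g3 * (m3 * (m3 * u3 v)))
    - (m1 + m2) * (g1 * (m1 * u1 v) + g2 * (m2 * u2 v) + g3 * (m3 * u3 v))
    + m1 * m2 * (g1 * u1 v + g2 * u2 v + g3 * u3 v)); first by ring.
  by rewrite c0 c1 c2; ring.
by rewrite !addr0.
Qed.

End Eigenfunctionals.

(** All that is retained of the coefficients after specialization. [T_top] is the one functional
    known on every root; the other nodes are known only on simple roots and sums of two adjacent
    ones. *)
Record cw_action (F : fieldType) (N : nat) (rho t : F) (V : lmodType F)
    (S : nat -> V -> V) (T : nat -> V -> F)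
    (co : nat -> nat -> bool -> V -> F) (x : nat -> nat -> bool -> V) : Prop := CwAction {
  cwM :> cw_model N rho t S T co x;
  cw_act : artin_action N S;
  T_self : forall k, (k <= N)%N -> T k (sroot x k) = rho ^+ 4;
  T_off : forall i j, (i <= N)%N -> (j <= N)%N -> i != j -> T i (sroot x j) = 0;
  T_root2 : forall i j, (i <= N)%N -> (j <= N)%N -> adj i j ->
    T i (sroot2 x i j) = rho ^+ 5 - rho ^+ 3;
  T_top : forall v, T N v = rho ^+ 2 * co N.-1 N true v -
    (rho ^+ 2 - rho ^+ 4) * (rowI N rho co N v - co N.-1 N false v) }.

Definition subspace_pred (F : fieldType) (V : lmodType F) (U : V -> Prop) : Prop :=
  U 0 /\ forall a v w, U v -> U w -> U (a *: v + w).

Section SubspacePred.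
Variables (F : fieldType) (V : lmodType F) (U : V -> Prop).
Hypothesis US : subspace_pred U.

Lemma subspace_D v w : U v -> U w -> U (v + w).
Proof. by move=> Uv Uw; rewrite -[v]scale1r; apply: US.2. Qed.
Lemma subspace_Z a v : U v -> U (a *: v).
Proof. by move=> Uv; rewrite -[_ *: _]addr0; apply: US.2 => //; exact: US.1. Qed.
Lemma subspace_B v w : U v -> U w -> U (v - w).
Proof. by move=> Uv Uw; rewrite -scaleN1r; apply: subspace_D => //; apply: subspace_Z. Qed.
Lemma subspace_Zv a v : a != 0 -> U (a *: v) -> U v.
Proof. by move=> a0 /(subspace_Z a^-1); rewrite scalerA mulVf // scale1r. Qed.

End SubspacePred.

Section Irreducibility.
Variables (F : fieldType) (K : nat) (rho t : F) (V : lmodType F).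
Variables (S : nat -> V -> V) (T : nat -> V -> F).
Variables (co : nat -> nat -> bool -> V -> F) (x : nat -> nat -> bool -> V).
Local Notation N := K.+3.
Hypothesis A : cw_action N rho t S T co x.
Local Notation q := (rho ^+ 2).
Local Notation sr := (sroot x).
Local Notation sr2 := (sroot2 x).
Let M := cwM A.

(** Away from alpha_k the coordinates are fixed by S_k or occur in blocks with rows (1 - q, rho) and
    (rho, 0), of characteristic polynomial (z - 1)(z + q). *)
Lemma hecke_coord k i j s v : (k <= N)%N -> (i < j <= N)%N ->
  ~~ (if k is k'.+1 then [&& i == k', j == k & s] else [&& i == 0, j == 1 & ~~ s])%N ->
  co i j s (S k (S k v)) = (1 - q) * co i j s (S k v) + q * co i j s v.
Proof.
case: k => [|k] kN ij ne.
  case: i ij ne => [|[|i]] ij ne; last by rewrite !(co_fx0 M) //; ring.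
    have [j1|j1] := leqP j 1.
      have e : j = 1%N by lia.
      by move: ne; rewrite e; case: s => // _; rewrite !(co_fx0m M); ring.
    have lj : (1 < j <= N)%N by lia.
    by case: s {ne}; rewrite ?(co0m_up M) ?(co1p_dn M) ?(co0p_dn M) ?(co1m_up M) //; ring.
  have lj : (1 < j <= N)%N by lia.
  by case: s {ne}; rewrite ?(co1m_up M) ?(co0p_dn M) ?(co1p_dn M) ?(co0m_up M) //; ring.
have [e|jk1] := eqVneq j k.+1.
  rewrite e in ij ne *; have [e'|ik] := eqVneq i k.
    by rewrite e' !eqxx in ne *; case: s ne => // _; rewrite !(co_fxSp M) //; ring.
  by rewrite !(coj_dn M) ?(coj_up M); [ring|lia..].
have [e|jk] := eqVneq j k.
  by rewrite e in ij *; rewrite !(coj_up M) ?(coj_dn M); [ring|lia..].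
have [e|ik] := eqVneq i k.
  by rewrite e in ij *; case: s {ne};
    rewrite ?(com_dn M) ?(com_up M) ?(cop_up M) ?(cop_dn M); first [lia | ring].
have [e|ik1] := eqVneq i k.+1.
  by rewrite e in ij *; case: s {ne};
    rewrite ?(com_up M) ?(com_dn M) ?(cop_dn M) ?(cop_up M); first [lia | ring].
by rewrite !(co_fxS M) //; ring.
Qed.

Lemma hecke_mod k v : (k <= N)%N ->
  exists f, S k (S k v) - (1 - q) *: S k v - q *: v = f *: sr k.
Proof.
move=> kN; set y := _ - q *: v.
exists (scoord co k y); apply: (co_ext M) => i j s ij.
have [e|ne] := boolP (if k is k'.+1 then [&& i == k', j == k & s]
  else [&& i == 0, j == 1 & ~~ s])%N; last first.
  rewrite /y !(co_B M) !(co_Z M) hecke_coord //.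
  have -> : co i j s (sr k) = 0.
    case: k kN ne {y} => [|k] kN ne; rewrite /sroot (co_x M) ?ltnSn ?eqb_id ?(negPf ne) //.
    by case: s ne => /=; rewrite ?andbF // !andbT => /negPf ->.
  by rewrite mulr0; ring.
rewrite (co_Z M); case: k kN e {y} (y) => [|k] kN /and3P[/eqP-> /eqP-> es] y.
  by rewrite (negPf es) /= (co_x M) //= mulr1.
by rewrite es /= (co_x M) ?ltnSn //= !eqxx mulr1.
Qed.

Hypotheses (rho0 : rho != 0) (t0 : t != 0).
Variable U : V -> Prop.
Hypotheses (Usub : subspace_pred U) (UinvS : forall k v, (k <= N)%N -> U v -> U (S k v)).

Lemma sroot_adj_mem i j : (i <= N)%N -> (j <= N)%N -> adj i j -> U (sr i) -> U (sr j).
Proof.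
move=> iN jN ij Ui; have ji : adj j i by rewrite adjC.
have Ur : U (sr2 i j).
  apply: (subspace_Zv Usub rho0).
  have -> : rho *: sr2 i j = S j (sr i) - (1 - q) *: sr i.
    rewrite (S_adjr M jN iN ji) (T_off A jN iN) ?adj_neq // mulr0 scale0r addr0.
    by rewrite sr2C addrC addKr.
  by apply: (subspace_B Usub); [exact: UinvS|exact: subspace_Z].
apply: (subspace_Zv Usub rho0).
have -> : rho *: sr j = S i (sr2 i j) - (t * T i (sr2 i j)) *: sr i.
  by rewrite (S_root2 M iN jN ij) addrK.
by apply: (subspace_B Usub); [exact: UinvS|exact: subspace_Z].
Qed.

Lemma sroot_all_mem k : (k <= N)%N -> U (sr k) -> forall j, (j <= N)%N -> U (sr j).
Proof.
move=> kN Uk.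
have U2 : U (sr 2).
  have down m : (m.+2 <= N)%N -> U (sr m.+2) -> U (sr 2).
    elim: m => [//|m IH] mN Um; apply: IH; first by lia.
    by apply: sroot_adj_mem Um; rewrite // /adj /dynkinD_edge; lia.
  case: k kN Uk => [|[|k]] kN Uk; last exact: down Uk.
    by apply: sroot_adj_mem Uk; rewrite // /adj /dynkinD_edge.
  by apply: sroot_adj_mem Uk; rewrite // /adj /dynkinD_edge.
have up m : (m.+2 <= N)%N -> U (sr m.+2).
  elim: m => [//|m IH] mN.
  have Um : U (sr m.+2) by apply: IH; lia.
  by apply: sroot_adj_mem Um; rewrite // /adj /dynkinD_edge; lia.
case=> [|[|j]] jN; last exact: up.
  by apply: sroot_adj_mem U2; rewrite // /adj /dynkinD_edge.
by apply: sroot_adj_mem U2; rewrite // /adj /dynkinD_edge.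
Qed.

(** All simple root vectors lie in U, so terms along them can be subtracted, and the raising rules
    then yield the basis vectors root by root. *)
Lemma sroot_mem_full k : (k <= N)%N -> U (sr k) -> forall v, U v.
Proof.
move=> kN Uk; have Us := sroot_all_mem kN Uk.
have step m y z b : (m <= N)%N -> U y -> S m y = (1 - q) *: y + rho *: z + b *: sr m -> U z.
  move=> mN Uy e; apply: (subspace_Zv Usub rho0).
  have -> : rho *: z = S m y - b *: sr m - (1 - q) *: y by rewrite e addrK addrC addKr.
  by do 2 (apply: (subspace_B Usub); last by apply: subspace_Z => //; exact: Us);
    exact: UinvS.
have Um d j : (0 < j <= N)%N -> (d < j)%N -> U (x (j.-1 - d) j true).
  move=> jN; elim: d => [|d IH] dj; first by rewrite subn0; case: j jN dj => // j jN _; exact: (Us j.+1).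
  have kj : ((j.-1 - d.+1).+1 < j <= N)%N by lia.
  have := xm_up M kj; rewrite (_ : (j.-1 - d.+1).+1 = j.-1 - d)%N; last by lia.
  by apply: step; [lia|apply: IH; lia].
have Up i j : (i < j <= N)%N -> U (x i j false).
  have [j1 ij|j1] := leqP j 1.
    have [-> ->] : i = 0%N /\ j = 1%N by lia.
    exact: (Us 0).
  elim: i => [|i IH] ij.
    have lj : (1 < j <= N)%N by lia.
    have U1 : U (x 1 j true).
      by rewrite (_ : 1 = j.-1 - (j.-1 - 1))%N; [apply: Um; lia|lia].
    by apply: (step _ _ _ _ _ U1 (x1m_up M lj)).
  have Ui : U (x i j false) by apply: IH; lia.
  by apply: (step _ _ _ _ _ Ui (xp_up M ij)); lia.
apply: (x_ind M Usub.1 Usub.2) => i j [] ij; last exact: Up.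
by rewrite -(subKn (_ : i <= j.-1)%N); [apply: Um; lia|lia].
Qed.

(** A lowering rule reads co_b(S_k v) = rho co_(b - alpha_k)(v), so vanishing on an invariant U
    passes from b to b - alpha_k. From the highest root every positive root is reached. *)
Lemma coords_vanish : (forall v, U v -> co K.+2 N false v = 0) -> forall v, U v -> v = 0.
Proof.
move=> U0.
have step m y z v : (m <= N)%N -> (forall v, U v -> y v = 0) -> U v ->
    y (S m v) = rho * z v -> z v = 0.
  move=> mN y0 Uv e; apply: (mulfI rho0).
  by rewrite -e y0 ?mulr0 //; exact: UinvS.
have P1 d v : (d <= K.+2)%N -> U v -> co (K.+2 - d) N false v = 0.
  elim: d v => [|d IH] v dK Uv; first by rewrite subn0 U0.
  apply: (step (K.+2 - d)%N _ _ _ _ (fun w Uw => IH w (ltnW dK) Uw)) => //; first by lia.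
  by rewrite (_ : K.+2 - d = (K.+2 - d.+1).+1)%N ?(cop_dn M) //; lia.
have P2 d i v : (i < N - d)%N -> U v -> co i (N - d) false v = 0.
  elim: d i v => [|d IH] i v iN Uv.
    by rewrite subn0 -(subKn (_ : i <= K.+2)%N); [apply: P1 => //; lia|lia].
  apply: (step (N - d)%N (co i (N - d) false)) => //; first by lia.
    by move=> w Uw; apply: IH => //; lia.
  by rewrite (_ : N - d = (N - d.+1).+1)%N ?(coj_dn M) //; lia.
have P i j v : (i < j <= N)%N -> U v -> co i j false v = 0.
  by move=> ij Uv; rewrite -(subKn (_ : j <= N)%N); [apply: P2 => //; lia|lia].
have Q j v : (1 < j <= N)%N -> U v -> co 0 j true v = 0 /\ co 1 j true v = 0.
  move=> lj Uv; split.
    by apply: (step 0 (co 1 j false)) => //; [move=> w; apply: P|rewrite (co1p_dn M)].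
  by apply: (step 0 (co 0 j false)) => //; [move=> w; apply: P; lia|rewrite (co0p_dn M)].
have Qm i j v : (i < j)%N -> (1 < j <= N)%N -> U v -> co i j true v = 0.
  elim: i v => [|i IH] v ij lj Uv; first by have [] := Q j v lj Uv.
  apply: (step i.+1 (co i j true)) => //; first by lia.
    by move=> w Uw; apply: IH => //; lia.
  by rewrite (com_dn M) //; lia.
move=> v Uv; apply: (co_ext M) => i j s ij; rewrite (co_0 M).
case: s; last exact: P.
have [j1|j1] := leqP j 1; last by apply: Qm => //; lia.
have [-> ->] : i = 0%N /\ j = 1%N by lia.
apply: (step 2 (co 0 2 true)) => //; first by move=> w Uw; apply: Qm.
by rewrite (coj_dn M).
Qed.

End Irreducibility.

Section Irreducible.
Variables (F : fieldType) (K : nat) (rho t : F) (V : lmodType F).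
Variables (S : nat -> V -> V) (T : nat -> V -> F).
Variables (co : nat -> nat -> bool -> V -> F) (x : nat -> nat -> bool -> V).
Local Notation N := K.+3.
Hypothesis A : cw_action N rho t S T co x.
Local Notation q := (rho ^+ 2).
Local Notation a := (rho ^+ (2 * K.+2)).
Local Notation I := (rowI N rho co).
Hypotheses (rho0 : rho != 0) (t0 : t != 0).
Hypotheses (q1 : q != 1) (qN1 : q != -1) (aN1 : a != -1) (qa1 : q * a != 1).
Let M := cwM A.

Local Notation X := (jm S K.+1).
Local Notation c := (co K.+2 N false).
Local Notation d := (co K.+2 N true).
Local Notation i := (I N).

Lemma jm_lin m b v w : jm S m (b *: v + w) = b *: jm S m v + jm S m w.
Proof. by elim: m v w => [|m IH] v w /=; rewrite ?(S_lin M) ?IH ?(S_lin M). Qed.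

Lemma rowI_lin m b v w : I m (b *: v + w) = b * I m v + I m w.
Proof. by rewrite (rowI_D M) (rowI_Z M). Qed.

Let cX v : c (X v) = a * d v.
Proof. by rewrite (jm_p M). Qed.
Let dX v : d (X v) = q * a * c v + (1 - q) * (i v - a * d v).
Proof. by rewrite (jm_m M) // (expr2S _ K.+2) [a * q]mulrC. Qed.
Let iX v : i (X v) = i v.
Proof. exact: (rowI_jm M). Qed.
Let cS v : c (S N v) = c v.
Proof. exact: (co_fxSp M). Qed.
Let dS v : d (S N v) = t * T N v.
Proof. exact: (sc_self M v (leqnn N)). Qed.

(** The contributions of d and i cancel. As S_N fixes c and d(S_N v) = t T_N v, this is what makes c
    an eigenfunctional of Y, of eigenvalue t (a q)^2. *)
Let TX v : T N (X v) = q ^+ 2 * a * c v.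
Proof. by rewrite (T_top A) dX iX cX; ring. Qed.

Local Notation s := (t * (a * q) ^+ 2).
Local Notation Y v := (X (S N (X (S N v)))).

Let a0 : a != 0. Proof. by rewrite expf_neq0. Qed.

Let cY v : c (Y v) = s * c v.
Proof. by rewrite cX dS TX cS; ring. Qed.

Let XY v : X (Y v) = Y (X v).
Proof. by congr (X _); apply: (jm_comm (m := K.+1) v (cw_act A)). Qed.

Let dY v : d (Y v) = s * d v.
Proof.
apply: (mulfI a0); rewrite -cX XY cY cX; ring.
Qed.

(** [dX] expresses (1 - q) i through c, d and d X. Since X and Y commute, the eigenvalue s passes
    from c and d to i. *)
Let iY v : i (Y v) = s * i v.
Proof.
have q1' : 1 - q != 0 by rewrite subr_eq0 eq_sym.
apply: (mulfI q1').
have := dX (Y v); rewrite XY dY dX cY dY => e.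
by apply: (eqr_lin (k := -1) e); ring.
Qed.

Lemma cw_irreducible (U : V -> Prop) : subspace_pred U ->
  (forall k v, (k <= N)%N -> U v -> U (S k v)) ->
  s \notin [:: 1; (q * a) ^+ 2; a ^+ 2; q * (q * a); - (q * a); - (q ^+ 2 * a ^+ 2)] ->
  (forall v, U v -> v = 0) \/ (forall v, U v).
Proof.
move=> Usub UinvS sn.
have [[v Uv ne]|H] := boolp.EM (exists2 v, U v & S N (S N v) <> (1 - q) *: S N v + q *: v).
  right; have [f e] := hecke_mod A v (leqnn N).
  have f0 : f != 0.
    apply/eqP => f0; apply: ne; move: e; rewrite f0 scale0r => /eqP.
    by rewrite -addrA -opprD subr_eq0 => /eqP.
  apply: (sroot_mem_full A rho0 t0 Usub UinvS (leqnn N)).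
  apply: (subspace_Zv Usub f0); rewrite -e.
  have USv := UinvS _ _ (leqnn N) Uv.
  do 2 (apply: (subspace_B Usub); last exact: subspace_Z).
  exact: UinvS.
left; apply: (coords_vanish A rho0 t0 UinvS) => v Uv.
have quad w : U w -> S N (S N w) = (1 - q) *: S N w + q *: w.
  by move=> Uw; case: (boolp.EM (S N (S N w) = (1 - q) *: S N w + q *: w)) => // ne; case: H; exists w.
have UX w : U w -> U (X w).
  suff UL m : (m.+1 < N)%N -> U w -> U (jm S m w) by move=> Uw; apply: UL.
  have inv k y : (k < N)%N -> U y -> U (S k y) by move/ltnW; exact: UinvS.
  elim: m w => [|m IH] w mN Uw /=; first exact/(inv 1%N)/(inv 0%N).
  by apply: (inv m.+2) => //; apply: IH; [exact: ltnW|exact: (inv m.+2)].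
have p1 : 1 + q != 0 by rewrite addrC addr_eq0.
have p2 : q * a - 1 != 0 by rewrite subr_eq0.
have p3 : a + 1 != 0 by rewrite addr_eq0.
have p4 : 1 - q != 0 by rewrite subr_eq0 eq_sym.
(* Modulo i, X acts on the span of c and d with eigenfunctionals c + d (eigenvalue q a) and q c - d
   (eigenvalue -a). The constants [z2] and [z3] are the corrections by i that make them exact, and
   [u1] is what remains of c. *)
pose z2 := (1 - q) / (q * a - 1); pose z3 := - (1 - q) / (a + 1).
have Z2 : z2 * (q * a - 1) = 1 - q by rewrite divfK.
have Z3 : z3 * (a + 1) = - (1 - q) by rewrite divfK.
clearbody z2 z3.
pose u1 w := (z3 - z2) / (1 + q) * i w.
pose u2 w := (1 + q)^-1 * (c w + d w + z2 * i w).
pose u3 w := (1 + q)^-1 * (q * c w - d w - z3 * i w).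
have sum w : u1 w + u2 w + u3 w = c w by rewrite /u1 /u2 /u3; field.
have e1 : eigenfunctional X (S N) U s 1 u1.
  split=> [b y w|w _|w _]; rewrite /u1 ?iY ?rowI_lin ?iX; ring.
have e2 : eigenfunctional X (S N) U s (q * a) u2.
  split=> [b y w|w _|w _]; rewrite /u2.
  - by rewrite rowI_lin !(co_lin M); ring.
  - rewrite cX dX iX [RHS]mulrCA; congr (_ * _).
    by apply: (eqr_lin (k := - i w) Z2); ring.
  - by rewrite cY dY iY; ring.
have e3 : eigenfunctional X (S N) U s (- a) u3.
  split=> [b y w|w _|w _]; rewrite /u3.
  - by rewrite rowI_lin !(co_lin M); ring.
  - rewrite cX dX iX [RHS]mulrCA; congr (_ * _).
    by apply: (eqr_lin (k := - i w) Z3); ring.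
  - by rewrite cY dY iY; ring.
rewrite -sum; apply: (eigenfunctionals_vanish _ _ UX _ Usub.2 quad e1 e2 e3) => //.
- by move=> *; apply: jm_lin.
- by move=> *; apply: (S_lin M).
- by move=> w; apply: UinvS.
- by rewrite eq_sym.
- by apply: contraNneq aN1 => e; rewrite -[a]opprK -e.
- have e : q * a - (- a) = (1 + q) * a by ring.
  by rewrite -subr_eq0 e mulf_neq0.
- by rewrite expf_neq0.
- by move=> w Uw; rewrite !sum cS.
have e : q * (q * a) * a = q ^+ 2 * a ^+ 2 by ring.
by rewrite expr1n sqrrN !mulr1 !mulrN e.
Qed.

End Irreducible.

(** * A criterion for submodules *)

Section Steps.
Variables (F : fieldType) (N : nat) (rho : F) (V : lmodType F).
Variable co : nat -> nat -> bool -> V -> F.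
Local Notation q := (rho ^+ 2).

(* [v'] is [s_(k+1) v] up to a multiple of the basis vector at the simple root *)
(* of the node [k+1].                                                          *)
Record stepS (k : nat) (v v' : V) : Prop := StepS {
  stj_up : forall i s, (i < k)%N -> co i k s v' = (1 - q) * co i k s v + rho * co i k.+1 s v;
  stj_dn : forall i s, (i < k)%N -> co i k.+1 s v' = rho * co i k s v;
  stp_up : forall j, (k.+1 < j <= N)%N ->
    co k j false v' = (1 - q) * co k j false v + rho * co k.+1 j false v;
  stp_dn : forall j, (k.+1 < j <= N)%N -> co k.+1 j false v' = rho * co k j false v;
  stm_up : forall j, (k.+1 < j <= N)%N ->
    co k.+1 j true v' = (1 - q) * co k.+1 j true v + rho * co k j true v;
  stm_dn : forall j, (k.+1 < j <= N)%N -> co k j true v' = rho * co k.+1 j true v;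
  st_fx : forall i j s, (i < j <= N)%N -> i != k -> i != k.+1 -> j != k -> j != k.+1 ->
    co i j s v' = co i j s v;
  st_fxp : co k k.+1 false v' = co k k.+1 false v }.

(* The same for the node [0]. *)
Record step0 (v v' : V) : Prop := Step0 {
  st0m_up : forall j, (1 < j <= N)%N ->
    co 0 j true v' = (1 - q) * co 0 j true v + rho * co 1 j false v;
  st1p_dn : forall j, (1 < j <= N)%N -> co 1 j false v' = rho * co 0 j true v;
  st1m_up : forall j, (1 < j <= N)%N ->
    co 1 j true v' = (1 - q) * co 1 j true v + rho * co 0 j false v;
  st0p_dn : forall j, (1 < j <= N)%N -> co 0 j false v' = rho * co 1 j true v;
  st0_fx : forall i j s, (1 < i)%N -> (i < j <= N)%N -> co i j s v' = co i j s v;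
  st0_fxm : co 0 1 true v' = co 0 1 true v }.

End Steps.

Section Reducibility.
Variables (F : fieldType) (K : nat) (rho t : F) (V : lmodType F).
Variables (S : nat -> V -> V) (T : nat -> V -> F).
Variables (co : nat -> nat -> bool -> V -> F) (x : nat -> nat -> bool -> V).
Local Notation N := K.+3.
Hypothesis A : cw_action N rho t S T co x.
Local Notation q := (rho ^+ 2).
Local Notation sr := (sroot x).
Local Notation sr2 := (sroot2 x).
Hypothesis rho0 : rho != 0.
Let M := cwM A.

Local Notation stepS := (stepS N rho co).
Local Notation step0 := (step0 N rho co).

Lemma stepS_sub k v b : (k < N)%N -> stepS k v (S k.+1 v - b *: sr k.+1).
Proof.
move=> kN; have z i j s : (i < j <= N)%N -> ~~ [&& i == k, j == k.+1 & s] ->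
    co i j s (sr k.+1) = 0.
  by move=> ij ne; rewrite /= (co_x M) ?ltnSn ?eqb_id ?(negPf ne).
have e i j s : (i < j <= N)%N -> ~~ [&& i == k, j == k.+1 & s] ->
    co i j s (S k.+1 v - b *: sr k.+1) = co i j s (S k.+1 v).
  by move=> ij ne; rewrite (co_B M) (co_Z M) z // mulr0 subr0.
split.
- by move=> i s ik; rewrite e ?(coj_up M) //; lia.
- by move=> i s ik; rewrite e ?(coj_dn M) //; lia.
- by move=> j kj; rewrite e ?(cop_up M) //; lia.
- by move=> j kj; rewrite e ?(cop_dn M) //; lia.
- by move=> j kj; rewrite e ?(com_up M) //; lia.
- by move=> j kj; rewrite e ?(com_dn M) //; lia.
- by move=> i j s ij n1 n2 n3 n4; rewrite e ?(co_fxS M) // (negPf n1).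
- by rewrite e ?(co_fxSp M) ?ltnSn ?andbF.
Qed.

Lemma step0_sub v b : step0 v (S 0 v - b *: sr 0).
Proof.
have z i j s : (i < j <= N)%N -> ~~ [&& i == 0, j == 1 & ~~ s]%N -> co i j s (sr 0) = 0.
  move=> ij ne; rewrite /= (co_x M) //.
  by case: s ne => /=; rewrite ?andbF // !andbT => /negPf ->.
have e i j s : (i < j <= N)%N -> ~~ [&& i == 0, j == 1 & ~~ s]%N ->
    co i j s (S 0 v - b *: sr 0) = co i j s (S 0 v).
  by move=> ij ne; rewrite (co_B M) (co_Z M) z // mulr0 subr0.
split.
- by move=> j lj; rewrite e ?(co0m_up M) //; lia.
- by move=> j lj; rewrite e ?(co1p_dn M) //; lia.
- by move=> j lj; rewrite e ?(co1m_up M) //; lia.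
- by move=> j lj; rewrite e ?(co0p_dn M) //; lia.
- by move=> i j s i1 ij; rewrite e ?(co_fx0 M) //; lia.
- by rewrite e ?(co_fx0m M).
Qed.

Lemma co_sub_sroot k v b : (k <= N)%N -> scoord co k (S k v - b *: sr k) = t * T k v - b.
Proof.
move=> kN; have sB u w : scoord co k (u - w) = scoord co k u - scoord co k w.
  by case: (k) => [|k']; rewrite /scoord (co_B M).
by rewrite sB (sc_Z M) (sc_self M) // (sc_sroot M) // eqxx mulr1.
Qed.

(* It suffices to know that U is stable under the last node, and under the other *)
(* nodes up to multiples of the simple root vectors: stability passes from a node *)
(* to its neighbours by the braid relation.                                       *)
Section Criterion.
Variable U : V -> Prop.
Hypothesis Usub : subspace_pred U.

(** Write S_k v = u2 + b alpha_k with u2 in U. Expanding both sides of S_k S_j S_k v = S_j S_k S_j v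
    modulo U leaves a combination of alpha_j + alpha_k, alpha_k and alpha_j lying in U, whose
    coefficient at alpha_j is -b q; the last hypothesis forces b = 0. *)
Lemma transport j k : (j <= N)%N -> (k <= N)%N -> adj j k ->
  (forall v, U v -> U (S j v)) ->
  (forall v, U v -> exists b, U (S k v - b *: sr k)) ->
  (forall e f g, U (e *: sr2 j k + f *: sr k + g *: sr j) -> e = 0 /\ g = 0) ->
  forall v, U v -> U (S k v).
Proof.
move=> jN kN jk Sj Sk ind v Uv; have kj : adj k j by rewrite adjC.
have [b Ub] := Sk v Uv.
set u2 := S k v - b *: sr k in Ub; have e2 : S k v = u2 + b *: sr k by rewrite subrK.
have [f Uf] := Sk _ (Sj _ Uv).
set u1 := S k (S j v) - f *: sr k in Uf.
have e1 : S k (S j v) = u1 + f *: sr k by rewrite subrK.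
have [g Ug] := Sk _ (Sj _ Ub).
set u3 := S k (S j u2) - g *: sr k in Ug.
have e3 : S k (S j u2) = u3 + g *: sr k by rewrite subrK.
clearbody u3 u1 u2.
have Ejk : S j (sr k) = (1 - q) *: sr k + rho *: sr2 j k.
  by rewrite (S_adjr M) // (T_off A) ?adj_neq // mulr0 scale0r addr0.
(* The value rho^5 - rho^3 of [T_root2] cancels the term (1 - q) t rho^4 along [sr k]. *)
have Ekjk : S k (S j (sr k)) = q *: sr j.
  rewrite Ejk (S_D M) !(S_Z M) (S_self M) // sr2C (S_root2 M) // (T_self A) // (T_root2 A) //.
  rewrite !scalerDr !scalerA addrC -addrA -scalerDl -[RHS]addr0; congr (_ + _).
  by rewrite (_ : _ + _ = 0) ?scale0r //; ring.
have := (cw_act A).1 j k v jN kN jk.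
rewrite e1 e2 !(S_D M) !(S_Z M) e3 Ekjk Ejk => br.
have US1 : U (S j u1) by exact: Sj.
have e4 : u3 = S j u1 + f *: ((1 - q) *: sr k + rho *: sr2 j k) - b *: (q *: sr j) - g *: sr k.
  by rewrite br !addrK.
have [fr bq] : f * rho = 0 /\ - (b * q) = 0.
  apply: (ind _ (f * (1 - q) - g)).
  rewrite (_ : _ + _ = u3 - S j u1); first exact: (subspace_B Usub).
  rewrite e4 scalerDr !scalerA scalerBl scaleNr.
  have gen (y a b' c' d : V) : y + (a + b') - c' - d - y = b' + (a - d) - c'.
    rewrite -[_ - c' - d]addrA addrAC [y + _]addrC addrK [a + b']addrC -!addrA.
    by rewrite [- c' - d]addrC.
  by rewrite gen.
have b0 : b = 0 by move/eqP: bq; rewrite oppr_eq0 mulf_eq0 expf_eq0 (negPf rho0) andbF orbF => /eqP.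
by rewrite b0 scale0r addr0.
Qed.

Hypothesis step_weak : forall k v, (k < N)%N -> U v ->
  exists z, forall v', stepS k v v' -> co k k.+1 true v' = z -> U v'.
Hypothesis step0_weak : forall v, U v ->
  exists z, forall v', step0 v v' -> co 0 1 false v' = z -> U v'.
Hypothesis step_top : forall v v', U v -> stepS K.+2 v v' ->
  co K.+2 N true v' = t * T N v -> U v'.
Hypothesis plus_zero : forall v, U v ->
  (forall i j, (i < j <= N)%N -> co i j false v = 0) -> v = 0.
Hypothesis fork_zero : forall v, U v ->
  (forall i j s, (i < j <= N)%N -> (if s then (i != 1) || (j != 2) else (i != 0) || (2 < j))%N ->
     co i j s v = 0) -> co 0 1 false v = 0 /\ co 0 2 false v = 0.

Let rank2_zero j k e f g : (j <= N)%N -> (k <= N)%N -> adj j k ->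
  e *: sr2 j k + f *: sr k + g *: sr j = 0 -> e = 0 /\ g = 0.
Proof.
move=> jN kN jk y0.
have [c1 c2 c3 c4] := sc_rank2 M jN kN jk.
have y2 := congr1 (scoord2 co j k) y0; have y1 := congr1 (scoord co j) y0.
move: y1 y2; rewrite !(sc_D M, sc_Z M, sc2_D M, sc2_Z M) c1 c2 c3 c4 !(sc_sroot M) //.
rewrite (negPf (adj_neq jk)) eqxx !mulr0 !mulr1 !addr0 !add0r.
have z0 : scoord co j (0 : V) = 0 by case: (j) => [|?]; rewrite /scoord (co_0 M).
have z2 : scoord2 co j k (0 : V) = 0 by rewrite /scoord2; case: ifP; rewrite (co_0 M).
by rewrite z0 z2.
Qed.

Let weak k v : (k <= N)%N -> U v -> exists b, U (S k v - b *: sr k).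
Proof.
case: k => [|k] kN Uv.
  have [z Hz] := step0_weak Uv; exists (t * T 0 v - z).
  by apply: Hz; [exact: step0_sub|have /= -> := co_sub_sroot v _ kN; rewrite subKr].
have [z Hz] := step_weak kN Uv; exists (t * T k.+1 v - z).
by apply: Hz; [exact: stepS_sub|have /= -> := co_sub_sroot v _ kN; rewrite subKr].
Qed.

(** Stability travels from N down to 1, then from 2 to 0. Along the chain the rank two vectors live
    on roots e_j - e_i, where [plus_zero] applies. The edge from 2 to 0 also involves e_1 + e_0 and
    e_2 + e_0, which [fork_zero] removes first. *)
Lemma cw_criterion k v : (k <= N)%N -> U v -> U (S k v).
Proof.
move=> kN Uv.
have top w : U w -> U (S N w).
  move=> Uw; have /= := step_top Uw (stepS_sub w 0 (ltnSn K.+2)).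
  by rewrite scale0r subr0; apply; exact: (sc_self M w (leqnn N)).
have chain d w : (d < N)%N -> U w -> U (S (N - d)%N w).
  elim: d w => [|d IH] w dN Uw; first by rewrite subn0; exact: top.
  have e1 : (N - d = (N - d.+1).+1)%N by lia.
  have e2 : (N - d.+1 = (N - d.+1).-1.+1)%N by lia.
  have jk : adj (N - d) (N - d.+1) by rewrite /adj /dynkinD_edge; lia.
  apply: (transport _ _ jk) => //; try lia.
  - by move=> u; apply: IH; lia.
  - by move=> u; apply: weak; lia.
  move=> e f g Uy; apply: (@rank2_zero (N - d)%N (N - d.+1)%N e f g) => //; try lia.
  apply: (plus_zero Uy) => i j ij.
  rewrite e1 e2 /sroot2 /= !(co_D M) !(co_Z M) !(co_x M) ?andbF ?mulr0 ?addr0 //; lia.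
case: k kN => [|k] kN; last first.
  by rewrite -(subKn kN); apply: chain => //; lia.
apply: (transport (isT : 2 <= N)%N _ (isT : adj 2 0)) => //.
- by move=> u; rewrite (_ : 2 = N - K.+1)%N; [apply: chain; lia|lia].
- by move=> u; apply: weak.
move=> e f g Uy; apply: (@rank2_zero 2 0 e f g) => //.
have [z1 z2] : co 0 1 false (e *: sr2 2 0 + f *: sr 0 + g *: sr 2) = 0 /\
    co 0 2 false (e *: sr2 2 0 + f *: sr 0 + g *: sr 2) = 0.
  apply: (fork_zero Uy) => i j s ij ne.
  rewrite /sroot2 /= !(co_D M) !(co_Z M) !(co_x M) //.
  case: s ne => ne; rewrite !(andbF, andbT) /=.
    have -> : ((i == 1) && (j == 2) = false)%N by lia.
    by rewrite !mulr0 !addr0.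
  have -> : ((i == 0) && (j == 2) = false)%N by lia.
  have -> : ((i == 0) && (j == 1) = false)%N by lia.
  by rewrite !mulr0 !addr0.
apply: (plus_zero Uy) => i j ij.
have [/andP[i0 j2]|ne] := boolP ((i == 0) && (j <= 2))%N.
  have [[-> ->]|[-> ->]] : i = 0%N /\ j = 1%N \/ i = 0%N /\ j = 2%N by lia.
  - by [].
  by [].
rewrite /sroot2 /= !(co_D M) !(co_Z M) !(co_x M) // !(andbF, andbT).
have -> : ((i == 0) && (j == 2) = false)%N by lia.
have -> : ((i == 0) && (j == 1) = false)%N by lia.
by rewrite !mulr0 !addr0.
Qed.

End Criterion.
End Reducibility.

(** * Submodules for t = r^4 and t = 1 *)

Lemma big_nat_pair (R : nmodType) (n k : nat) (h : nat -> R) : (k.+1 < n)%N ->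
  \sum_(0 <= l < n) h l =
  h k + h k.+1 + \sum_(0 <= l < n | (l != k) && (l != k.+1)) h l.
Proof.
move=> kn.
rewrite (bigD1_seq k) ?mem_index_iota ?iota_uniq //=; last exact: ltnW.
rewrite big_mkcond (bigD1_seq k.+1) ?mem_index_iota ?iota_uniq //= gtn_eqF //= addrA.
by congr (_ + _); rewrite -big_mkcondr; apply: eq_bigl => l; rewrite andbC.
Qed.

Section PairSums.
Variables (F : fieldType) (N : nat) (rho : F).
Local Notation q := (rho ^+ 2).

(** The powers rho^l make the sum along row j invariant under nodes not touching j. The jump by
    rho^2 at l = j serves the nodes touching j: they fix the coordinate at e_k + e_(k+1), so its
    weights rho^(k+2) in row k+1 and rho^(k+1) in row k must differ by one factor rho. *)
Definition pweight (j l : nat) : F := if (l < j)%N then rho ^+ l.+2 else rho ^+ l.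

Definition psum (p : nat -> nat -> F) (j i : nat) : F :=
  \sum_(0 <= l < N.+1) if (i <= l)%N && (l != j) then pweight j l * p l j else 0.

Lemma psum_step p j i : (i <= N)%N -> i != j ->
  psum p j i = pweight j i * p i j + psum p j i.+1.
Proof.
move=> iN ij; rewrite /psum (bigD1_seq i) ?mem_index_iota ?iota_uniq //= leqnn ij; congr (_ + _).
rewrite [RHS](bigD1_seq i) ?mem_index_iota ?iota_uniq //= ltnn add0r.
by apply: eq_bigr => l li; rewrite [(i < l)%N]ltn_neqAle [i == l]eq_sym li.
Qed.

Lemma psum_skip p j : psum p j j = psum p j j.+1.
Proof.
apply: eq_bigr => l _; rewrite [(j < l)%N]ltn_neqAle [j == l]eq_sym.
by case: (l != j); rewrite ?andbF.
Qed.

Lemma psum_over p j i : (N < i)%N -> psum p j i = 0.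
Proof.
move=> iN; rewrite /psum big_nat_cond big1 // => l /andP[/andP[_ lN] _].
by rewrite leqNgt (leq_trans lN).
Qed.

Lemma eq_psum p p' j i : (forall l, (i <= l <= N)%N -> l != j -> p l j = p' l j) ->
  psum p j i = psum p' j i.
Proof.
move=> e; apply: eq_big_nat => l lN; case: ifP => // /andP[il lj].
by rewrite e // il.
Qed.

Lemma psum_lin a p p' p'' j i : (forall l, p'' l j = a * p l j + p' l j) ->
  psum p'' j i = a * psum p j i + psum p' j i.
Proof.
move=> e; rewrite /psum mulr_sumr -big_split; apply: eq_bigr => l _ /=.
by case: ifP => _; rewrite ?e ?mulr0 ?addr0 //; ring.
Qed.

(* How the coordinates at the [e_l + e_j] change under the node [k+1].         *)
Record pair_swap (k : nat) (p p' : nat -> nat -> F) : Prop := PairSwap {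
  ps_sym : forall l j, p l j = p j l;
  ps_sym' : forall l j, p' l j = p' j l;
  ps_dn : forall j, (j <= N)%N -> j != k -> j != k.+1 -> p' k.+1 j = rho * p k j;
  ps_up : forall j, (j <= N)%N -> j != k -> j != k.+1 ->
    p' k j = (1 - q) * p k j + rho * p k.+1 j;
  ps_kk : p' k k.+1 = p k k.+1;
  ps_fx : forall l j, (l <= N)%N -> (j <= N)%N -> l != j -> l != k -> l != k.+1 -> j != k -> j != k.+1 ->
    p' l j = p l j }.

Section Swap.
Variables (k : nat) (p p' : nat -> nat -> F).
Hypotheses (kN : (k < N)%N) (sw : pair_swap k p p').

Let pw_below j : (k.+1 < j)%N -> pweight j k.+1 = rho * pweight j k.
Proof. by move=> kj; rewrite /pweight kj ltnW // -exprS. Qed.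
Let pw_above j : (j < k)%N -> pweight j k.+1 = rho * pweight j k.
Proof.
by move=> kj; rewrite /pweight !ltnNge (ltnW kj) (leqW (ltnW kj)) /= -exprS.
Qed.
Let pw_eq l : l != k -> l != k.+1 -> pweight k.+1 l = pweight k l.
Proof. by move=> lk lk1; rewrite /pweight ltnS leq_eqVlt (negPf lk). Qed.
Let kS : (k == k.+1) = false. Proof. by rewrite ltn_eqF. Qed.
Let Sk : (k.+1 == k) = false. Proof. by rewrite gtn_eqF. Qed.

(** The condition [i != k.+1] is essential: a sum starting at k+1 would contain only one term of the
    exchanged pair. *)
Lemma psum_swap_other j i : (j <= N)%N -> j != k -> j != k.+1 -> i != k.+1 ->
  psum p' j i = psum p j i.
Proof.
move=> jN jk jk1 ik1; rewrite /psum !(big_nat_pair (k := k)) //; congr (_ + _).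
  have [ik|ki] := leqP i k.
    rewrite (leq_trans ik) //= ![k == j]eq_sym ![k.+1 == j]eq_sym jk jk1.
    rewrite (ps_dn sw) // (ps_up sw) //.
    have -> : pweight j k.+1 = rho * pweight j k.
      by have [kj|jk'] := ltnP k j; [apply: pw_below; lia|apply: pw_above; lia].
    by ring.
  by have /ltn_geF-> : (k.+1 < i)%N by lia.
rewrite big_nat_cond [RHS]big_nat_cond; apply: eq_bigr => l /andP[/andP[_ lN] /andP[lk lk1]].
by case: ifP => // /andP[_ lj]; rewrite (ps_fx sw).
Qed.

Lemma psum_swap_dn i : i != k.+1 -> psum p' k.+1 i = rho * psum p k i.
Proof.
move=> ik1; rewrite /psum !(big_nat_pair (k := k)) // mulrDr mulr_sumr; congr (_ + _).
  rewrite !eqxx kS Sk !andbF !andbT addr0 add0r.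
  have [ik|ki] := leqP i k.
    by rewrite (leq_trans ik) // (ps_kk sw) (ps_sym sw) /pweight ltnSn ltnNge leqnSn !exprS /=; ring.
  have /ltn_geF-> : (k.+1 < i)%N by lia.
  by rewrite mulr0.
rewrite big_nat_cond [RHS]big_nat_cond; apply: eq_bigr => l /andP[/andP[_ lN] /andP[lk lk1]].
rewrite lk lk1; case: ifP => _; last by rewrite mulr0.
by rewrite (ps_sym' sw) (ps_dn sw) // (ps_sym sw) pw_eq //; ring.
Qed.

Lemma psum_swap_up i : (i <= k)%N ->
  psum p' k i = (1 - q) * psum p k i + rho * psum p k.+1 i.
Proof.
move=> ik; rewrite /psum !(big_nat_pair (k := k)) // !mulrDr !mulr_sumr addrACA -big_split /=.
congr (_ + _).
  rewrite !eqxx kS Sk ik (leq_trans ik) //= !mulr0 !add0r !addr0.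
  by rewrite [p' _ _](ps_sym' sw) (ps_kk sw) (ps_sym sw k) /pweight ltnSn ltnNge leqnSn !exprS /=; ring.
rewrite big_nat_cond [RHS]big_nat_cond; apply: eq_bigr => l /andP[/andP[_ lN] /andP[lk lk1]] /=.
rewrite lk lk1; case: ifP => _; last by rewrite !mulr0 addr0.
by rewrite (ps_sym' sw) (ps_up sw) // (ps_sym sw k) (ps_sym sw k.+1) pw_eq //; ring.
Qed.

End Swap.
End PairSums.

Section GraphSubspaces.
Variables (F : fieldType) (K : nat) (rho t : F) (V : lmodType F).
Variables (S : nat -> V -> V) (T : nat -> V -> F).
Variables (co : nat -> nat -> bool -> V -> F) (x : nat -> nat -> bool -> V).
Local Notation N := K.+3.
Hypothesis A : cw_action N rho t S T co x.
Local Notation q := (rho ^+ 2).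
Let M := cwM A.
Local Notation stepS := (stepS N rho co).
Local Notation R := (psum N rho).

Definition plus_coord (v : V) (l j : nat) : F := co (minn l j) (maxn l j) false v.
Local Notation P := plus_coord.

Lemma plus_coordC v l j : P v l j = P v j l.
Proof. by rewrite /P minnC maxnC. Qed.

Lemma plus_coordE v l j : (l < j)%N -> P v l j = co l j false v.
Proof. by move=> lj; rewrite /P (minn_idPl (ltnW lj)) (maxn_idPr (ltnW lj)). Qed.

Lemma step_pair_swap k v v' : (k < N)%N -> stepS k v v' -> pair_swap N rho k (P v) (P v').
Proof.
move=> kN st; split.
- exact: plus_coordC.
- exact: plus_coordC.
- move=> j jN jk jk1; have [kj|jk'] := ltnP k j.
    by rewrite !plus_coordE ?(stp_dn st) //; lia.
  by rewrite !(plus_coordC _ _ j) !plus_coordE ?(stj_dn st) //; lia.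
- move=> j jN jk jk1; have [kj|jk'] := ltnP k j.
    by rewrite !plus_coordE ?(stp_up st) //; lia.
  by rewrite !(plus_coordC _ _ j) !plus_coordE ?(stj_up st) //; lia.
- by rewrite !plus_coordE // (st_fxp st).
move=> l j lN jN lj lk lk1 jk jk1; rewrite /P (st_fx st) //; lia.
Qed.

(* kappa = -1 gives t = r^4, and kappa = q, closed = true gives t = 1. *)
Variables (kappa : F) (closed : bool).

(* The coordinates at the [e_j - e_i] as functions of those at the [e_j + e_i]. *)
Definition graph_rel (v : V) (i j : nat) : Prop :=
  rho ^+ i.+4 * co i j true v = kappa * (rho ^+ i.+4 * P v i j - (1 - q) * R (P v) j i.+1).

(** In the closed case the full row sums must vanish as well. This is what makes node 0 act on the
    plus coordinates as node 1 does, and what kills [rowI] when [kappa] is q. *)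
Definition graph_space (v : V) : Prop :=
  (forall i j, (i < j <= N)%N -> graph_rel v i j) /\
  (closed -> forall j, (j <= N)%N -> R (P v) j 0 = 0).

Lemma plus_coord_lin a v w l j : P (a *: v + w) l j = a * P v l j + P w l j.
Proof. by rewrite /P (co_lin M). Qed.

Lemma plus_psum_lin a v w j i : R (P (a *: v + w)) j i = a * R (P v) j i + R (P w) j i.
Proof. by apply: psum_lin => l; exact: plus_coord_lin. Qed.

Lemma graph_space_sub : subspace_pred graph_space.
Proof.
split=> [|a v w [v1 v2] [w1 w2]].
  have P0 l j : P 0 l j = 0 by rewrite /P (co_0 M).
  have R0 j i : R (P 0) j i = 0.
    by rewrite /psum big1 // => l _; rewrite P0 mulr0 if_same.
  by split=> [i j ij|_ j jN]; rewrite ?/graph_rel ?(co_0 M) ?P0 ?R0 // !mulr0 subr0 mulr0.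
split=> [i j ij|c j jN].
  rewrite /graph_rel (co_lin M) plus_psum_lin plus_coord_lin.
  by apply: (eqr_lin2 (k := a) (l := 1) (v1 i j ij) (w1 i j ij)); ring.
by rewrite plus_psum_lin v2 // w2 // mulr0 addr0.
Qed.

Lemma graph_step k v v' : (k < N)%N -> graph_space v -> stepS k v v' ->
  rho ^+ k.+4 * co k k.+1 true v' =
    kappa * (rho ^+ k.+4 * co k k.+1 false v - (1 - q) * (rho * R (P v) k k.+2)) ->
  graph_space v'.
Proof.
move=> kN [rel cl] st zE; have sw := step_pair_swap kN st.
have PE := plus_coordE.
split=> [i j ij|c j jN]; last first.
  have [e|jk] := eqVneq j k.
    by rewrite e (psum_swap_up kN sw) // !cl ?mulr0 ?addr0 //; lia.
  have [e|jk1] := eqVneq j k.+1.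
    by rewrite e (psum_swap_dn kN sw) // cl ?mulr0 //; lia.
  by rewrite (psum_swap_other kN sw) // cl.
rewrite /graph_rel PE; last by lia.
have relP a b : (a < b <= N)%N -> rho ^+ a.+4 * co a b true v =
    kappa * (rho ^+ a.+4 * co a b false v - (1 - q) * R (P v) b a.+1).
  by move=> ab; have := rel _ _ ab; rewrite /graph_rel PE //; lia.
have [e|jk1] := eqVneq j k.+1.
  have [e'|ik] := eqVneq i k.
    rewrite e e' psum_skip (psum_swap_dn kN sw) ?zE ?(st_fxp st) //; lia.
  rewrite e (psum_swap_dn kN sw) 2?(stj_dn st) ?eqSS //; try lia.
  by apply: (eqr_lin (k := rho) (relP i k _)); [lia|ring].
have [e|jk] := eqVneq j k.
  rewrite e (psum_swap_up kN sw) 2?(stj_up st) //; try lia.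
  by apply: (eqr_lin2 (k := 1 - q) (l := rho) (relP i k _) (relP i k.+1 _)); [lia|lia|ring].
have [e|ik] := eqVneq i k.
  rewrite e psum_step //; try lia.
  rewrite (psum_swap_other kN sw) //; try lia.
  rewrite /pweight (_ : (k.+1 < j)%N); last by lia.
  rewrite plus_coordE; last by lia.
  rewrite (stm_dn st) ?(stp_up st) ?(stp_dn st) //; try lia.
  by apply: (eqr_lin (k := 1) (relP k.+1 j _)); [lia|rewrite !exprS; ring].
have [e|ik1] := eqVneq i k.+1.
  rewrite e (psum_swap_other kN sw) ?(stm_up st) ?(stp_dn st) //; try lia.
  have := relP k j; rewrite psum_step; try lia.
  rewrite /pweight (_ : (k.+1 < j)%N) ?PE; try lia.
  move=> rk; apply: (eqr_lin2 (k := 1 - q) (l := q) (relP k.+1 j _) (rk _)); [lia|lia|rewrite !exprS; ring].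
by rewrite (psum_swap_other kN sw) ?(st_fx st) ?relP //; lia.
Qed.

(** At m = N the truncated sums vanish and (1 + kappa) times the full row sum is left, up to a power
    of rho. It is zero in both cases of interest. *)
Lemma graph_rowI v m : graph_space v -> (m <= N)%N ->
  rho ^+ m.+3 * rowI N rho co m v =
  rho ^+ (2 * m) * (R (P v) N 0 - R (P v) N m) + kappa * (rho ^+ (2 * m) * R (P v) N 0 - R (P v) N m).
Proof.
move=> [rel cl]; elim: m => [|m IH] mN.
  by rewrite /= muln0 expr0; ring.
have /= := IH (ltnW mN); have := rel m N; rewrite /graph_rel plus_coordE //.
rewrite (@psum_step _ _ _ _ N m) //; try lia.
rewrite /pweight mN plus_coordE // => r IHm.
apply: (eqr_lin2 (k := q) (l := 1) IHm (r _)); first by lia.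
by rewrite expr2S mul2n -addnn exprD !exprS; ring.
Qed.

Hypothesis rho0 : rho != 0.
Hypothesis kc : kappa = -1 /\ closed = false \/ kappa = q /\ closed = true.

(** As [rowI] vanishes, T_N v is q kappa + q - q^2 times the coordinate at the highest root, while
    the graph requires the new coordinate at alpha_N to be kappa times it. This equation fixes t. *)
Lemma graph_top v v' : t * (q * kappa + q - q ^+ 2) = kappa ->
  graph_space v -> stepS K.+2 v v' -> co K.+2 N true v' = t * T N v -> graph_space v'.
Proof.
move=> tk Uv st zE; apply: (graph_step _ Uv st) => //.
have r4 m : rho ^+ m != 0 by rewrite expf_neq0.
have RN : R (P v) N N = 0 by rewrite psum_skip psum_over.
have I0 : rowI N rho co N v = 0.
  apply: (mulfI (r4 N.+3)); rewrite (graph_rowI Uv) // RN !subr0 mulr0.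
  have [[-> _]|[_ c]] := kc; first by rewrite mulN1r subrr.
  by rewrite (Uv.2 c) // !mulr0 addr0.
have Q : co K.+2 N true v = kappa * co K.+2 N false v.
  apply: (mulfI (r4 K.+2.+4)); rewrite (Uv.1 K.+2 N) ?leqnn // RN plus_coordE //; ring.
rewrite zE (T_top A) I0 Q psum_over // -[in RHS]tk; ring.
Qed.

End GraphSubspaces.

Section GraphReducibility.
Variables (F : fieldType) (K : nat) (rho t : F) (V : lmodType F).
Variables (S : nat -> V -> V) (T : nat -> V -> F).
Variables (co : nat -> nat -> bool -> V -> F) (x : nat -> nat -> bool -> V).
Local Notation N := K.+3.
Hypothesis A : cw_action N rho t S T co x.
Local Notation q := (rho ^+ 2).
Hypothesis rho0 : rho != 0.
Let M := cwM A.
Local Notation stepS := (stepS N rho co).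
Local Notation step0 := (step0 N rho co).
Local Notation R := (psum N rho).
Local Notation P := (plus_coord co).
Local Notation U := (graph_space K rho co).

Let rX m : rho ^+ m != 0. Proof. by rewrite expf_neq0. Qed.

Lemma graph_relE kappa v i j : (i < j <= N)%N -> graph_rel K rho co kappa v i j ->
  rho ^+ i.+4 * co i j true v =
  kappa * (rho ^+ i.+4 * co i j false v - (1 - q) * R (P v) j i.+1).
Proof. by move=> ij; rewrite /graph_rel plus_coordE //; lia. Qed.

Lemma psum_head p j i : (1 < j <= N)%N -> (i <= 1)%N ->
  R p j i = (if i == 0%N then q * p 0%N j else 0) + rho ^+ 3 * p 1%N j + R p j 2.
Proof.
move=> /andP[j1 jN] i1; have j0 := ltnW j1.
have e1 : R p j 1 = rho ^+ 3 * p 1%N j + R p j 2.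
  by rewrite psum_step ?ltn_eqF // /pweight j1.
case: i i1 => [|[|//]] _ /=; last by rewrite add0r.
by rewrite psum_step ?ltn_eqF // /pweight j0 e1 addrA.
Qed.

Lemma step0_psum v v' j i : step0 v v' -> (1 < j <= N)%N -> (1 < i)%N ->
  R (P v') j i = R (P v) j i.
Proof.
move=> st jN i1; apply: eq_psum => l il lj.
by rewrite /plus_coord (st0_fx st) //; lia.
Qed.

Lemma step0_above v v' kappa cl i j : (1 < i)%N -> (i < j <= N)%N -> step0 v v' -> U kappa cl v ->
  graph_rel K rho co kappa v' i j.
Proof.
move=> i1 ij st Uv; rewrite /graph_rel (step0_psum st) //; try lia.
have := Uv.1 i j ij; rewrite /graph_rel !plus_coordE; try lia.
by rewrite !(st0_fx st).
Qed.

Section Minus.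
Local Notation W := (U (-1) false).

Lemma graph_minus_step0 v : W v ->
  exists z, forall v', step0 v v' -> co 0 1 false v' = z -> W v'.
Proof.
(* The graph relation for (0, 1) solved for the coordinate at e_1 + e_0: the one at e_1 - e_0 is
   unchanged, and the new coordinate at e_l + e_1 is rho times the old one at e_l - e_0. *)
move=> Wv; exists (- co 0 1 true v + (1 - q) / rho ^+ 4 * R (fun l _ => rho * co 0 l true v) 1 2).
move=> v' st zE; split=> // i j ij.
have [i1|i1] := ltnP 1 i; first exact: (step0_above _ _ st Wv).
have rel a b (ab : (a < b <= N)%N) := graph_relE ab (Wv.1 a b ab).
have [jN|j1] := boolP (1 < j <= N)%N; last first.
  have [-> ->] : i = 0%N /\ j = 1%N by lia.
  rewrite /graph_rel psum_skip plus_coordE // (st0_fxm st) zE.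
  have -> : R (P v') 1 2 = R (fun l _ => rho * co 0 l true v) 1 2.
    by apply: eq_psum => l l2 _; rewrite plus_coordC plus_coordE ?(st1p_dn st) //; lia.
  rewrite mulN1r mulrDr mulrA mulrCA divff // mulr1; ring.
have r0 := rel 0%N j ltac:(lia); have r1 := rel 1%N j ltac:(lia).
rewrite psum_head // !plus_coordE /= ?add0r in r0; try lia.
have [-> |i0] := eqVneq i 1%N.
  rewrite /graph_rel (step0_psum st) ?plus_coordE ?(st1m_up st) ?(st1p_dn st) //; try lia.
  by apply: (eqr_lin2 (k := 1 - q) (l := q) r1 r0); rewrite /=; ring.
have -> : i = 0%N by lia.
rewrite /graph_rel psum_head // (step0_psum st) 2?plus_coordE ?(st0m_up st) ?(st0p_dn st) ?(st1p_dn st) //; try lia.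
by apply: (eqr_lin (k := 1) r1); rewrite /=; ring.
Qed.

End Minus.

Section Quadratic.
Local Notation W := (U q true).

(** The closing condition at j removes the tail of the row sum from the graph relations for i = 0
    and i = 1. The result turns the rules of node 0 into those of node 1 on the plus coordinates. *)
Lemma graph_closed_low v j : W v -> (1 < j <= N)%N ->
  [/\ R (P v) j 2 = - (q * co 0 j false v + rho ^+ 3 * co 1 j false v),
      co 0 j true v = co 0 j false v &
      rho * co 1 j true v = rho * co 1 j false v + (1 - q) * co 0 j false v].
Proof.
move=> [rel cl] jN.
have e : R (P v) j 2 = - (q * co 0 j false v + rho ^+ 3 * co 1 j false v).
  have := cl isT j; rewrite psum_head // !plus_coordE; try lia.
  by move=> /= h; apply/eqP; rewrite -addr_eq0 addrC h //; lia.
split=> //; [apply: (mulfI (rX 4))|apply: (mulfI (rX 4))].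
  have := graph_relE _ (rel 0%N j _); rewrite psum_head // e !plus_coordE; try lia.
  by move=> h; apply: (eqr_lin (k := 1) (h _ _)); [lia|lia|rewrite /=; ring].
have := graph_relE _ (rel 1%N j _); rewrite e; try lia.
by move=> h; apply: (eqr_lin (k := 1) (h _ _)); [lia|lia|rewrite /=; ring].
Qed.

Lemma graph_closed_step0 v : W v ->
  exists z, forall v', step0 v v' -> co 0 1 false v' = z -> W v'.
Proof.
move=> Wv; exists (co 0 1 false v) => v' st zE.
have low j := graph_closed_low (j := j) Wv.
have sw : pair_swap N rho 0 (P v) (P v').
  split; try by move=> *; exact: plus_coordC.
  - move=> j jN j0 j1; have jn : (1 < j <= N)%N by lia.
    by rewrite !plus_coordE ?(st1p_dn st) //; [case: (low j jn) => _ -> _|lia|lia].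
  - move=> j jN j0 j1; have jn : (1 < j <= N)%N by lia.
    rewrite !plus_coordE ?(st0p_dn st) //; [|lia..].
    by case: (low j jn) => _ _ ->; rewrite addrC.
  - by rewrite !plus_coordE.
  by move=> l j lN jN lj l0 l1 j0 j1; rewrite /plus_coord (st0_fx st) //; lia.
split=> [i j ij|_ j jN]; last first.
  have [->|j0] := eqVneq j 0%N.
    by rewrite (psum_swap_up _ sw) // !Wv.2 // !mulr0 addr0.
  have [->|j1] := eqVneq j 1%N.
    by rewrite (psum_swap_dn _ sw) // Wv.2 // mulr0.
  by rewrite (psum_swap_other _ sw) // Wv.2.
have [i1|i1] := ltnP 1 i; first exact: (step0_above _ _ st Wv).
have [jN|j1] := boolP (1 < j <= N)%N; last first.
  have [-> ->] : i = 0%N /\ j = 1%N by lia.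
  have := graph_relE _ (Wv.1 0%N 1%N _); rewrite psum_skip => rel.
  have := Wv.2 isT 0%N isT; rewrite psum_skip psum_step // => e0.
  have := Wv.2 isT 1%N isT; rewrite psum_step // psum_skip => e1.
  move: e0 e1; rewrite /pweight /= (plus_coordC co v 1%N) plus_coordE // => e0 e1.
  rewrite /graph_rel psum_skip plus_coordE // (st0_fxm st) zE (psum_swap_dn _ sw) //.
  rewrite rel //.
  by apply: (eqr_lin2 (k := q * (1 - q) * rho) (l := - (q * (1 - q))) e0 e1); ring.
have [E Q0 Q1] := low j jN.
have [-> |i0] := eqVneq i 1%N.
  rewrite /graph_rel (step0_psum st) ?plus_coordE ?(st1m_up st) ?(st1p_dn st) //; try lia.
  by rewrite E Q0; apply: (eqr_lin (k := (1 - q) * rho ^+ 4) Q1); ring.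
have -> : i = 0%N by lia.
rewrite /graph_rel psum_head // (step0_psum st) 2?plus_coordE ?(st0m_up st) ?(st0p_dn st) ?(st1p_dn st) //; try lia.
by rewrite E Q0 Q1 /=; ring.
Qed.

End Quadratic.

Lemma graph_plus_zero kappa cl v : U kappa cl v ->
  (forall i j, (i < j <= N)%N -> co i j false v = 0) -> v = 0.
Proof.
move=> [rel _] z; apply: (co_ext M) => i j s ij; rewrite (co_0 M).
case: s; last exact: z.
have := graph_relE ij (rel i j ij); rewrite z // mulr0.
have -> : R (P v) j i.+1 = 0.
  rewrite /psum big_nat_cond big1 // => l /andP[/andP[_ lN] _].
  by case: ifP => // /andP[il lj]; rewrite /plus_coord z ?mulr0 //; lia.
by rewrite mulr0 subrr mulr0 => /eqP; rewrite mulf_eq0 (negPf (rX _)) => /eqP.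
Qed.

Lemma graph_fork_zero kappa cl v : kappa != 0 -> U kappa cl v ->
  (forall i j s, (i < j <= N)%N -> (if s then (i != 1) || (j != 2) else (i != 0) || (2 < j))%N ->
     co i j s v = 0) -> co 0 1 false v = 0 /\ co 0 2 false v = 0.
Proof.
move=> k0 [rel _] z.
have P0 l j : (0 < l <= N)%N -> (0 < j <= N)%N -> l != j -> P v l j = 0.
  by move=> lN jN lj; rewrite /plus_coord z //; lia.
have R0 j : (0 < j <= N)%N -> R (P v) j 1 = 0.
  move=> jN; rewrite /psum big_nat_cond big1 // => l /andP[/andP[_ lN] _].
  by case: ifP => // /andP[l0 lj]; rewrite P0 ?mulr0 //; lia.
have e j : (0 < j < 3)%N -> co 0 j false v = 0.
  move=> j3; have jN : (0 < j <= N)%N by lia.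
  have := graph_relE jN (rel 0%N j jN); rewrite R0 // z // mulr0 mulr0 subr0.
  by move=> /esym/eqP; rewrite mulf_eq0 (negPf k0) mulf_eq0 (negPf (rX _)) => /eqP.
by split; apply: e.
Qed.

Lemma graph_proper kappa cl : ~ U kappa cl (x 0 1 true).
Proof.
move=> [rel _]; have := graph_relE _ (rel 0%N 1%N isT).
rewrite !(co_x M) //= !mulr1 mulr0.
have -> : R (P (x 0 1 true)) 1 1 = 0.
  rewrite /psum big_nat_cond big1 // => l /andP[/andP[_ lN] _].
  case: ifP => // /andP[l0 lj]; rewrite /plus_coord (co_x M) ?andbF ?mulr0 //; lia.
by rewrite mulr0 subr0 mulr0 => /(_ isT)/eqP; rewrite (negPf (rX _)).
Qed.

(* The coordinates at the e_j + e_i of a vector supported on the subdiagram D_4. *)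
Definition d4_plus (l j : nat) : F :=
  if (l < j)%N then
    match l, j with
    | 0, 2 => - q | 0, 3 => rho | 1, 2 => rho | 1, 3 => -1 | _, _ => 0
    end
  else
    match j, l with
    | 0, 2 => - q | 0, 3 => rho | 1, 2 => rho | 1, 3 => -1 | _, _ => 0
    end.

Lemma d4_plus_sum j : (j <= N)%N -> R d4_plus j 0 = 0.
Proof.
have far l j' : (3 < maxn l j')%N -> d4_plus l j' = 0.
  by rewrite /d4_plus; case: l => [|[|[|[|l]]]]; case: j' => [|[|[|[|j']]]] //=; case: ifP.
have [j3 jN|j3 jN] := ltnP 3 j.
  by rewrite /psum big1 // => l _; rewrite far ?mulr0 ?if_same //; lia.
have R4 : R d4_plus j 4 = 0.
  by rewrite /psum big1 // => l _; case: ifP => // /andP[l4 _]; rewrite far ?mulr0 //; lia.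
case: j j3 jN R4 => [|[|[|[|//]]]] _ _ R4.
- by rewrite psum_skip psum_step // psum_step // psum_step // R4 /pweight /d4_plus /=; ring.
- by rewrite psum_step // psum_skip psum_step // psum_step // R4 /pweight /d4_plus /=; ring.
- by rewrite psum_step // psum_step // psum_skip psum_step // R4 /pweight /d4_plus /=; ring.
by rewrite psum_step // psum_step // psum_step // psum_skip R4 /pweight /d4_plus /=; ring.
Qed.

(** All row sums of [d4_plus] vanish, so one choice of plus coordinates serves both values of
    [kappa]. *)
Lemma graph_nonzero kappa cl : exists v, U kappa cl v /\ v <> 0.
Proof.
have [v vE] := co_surj M (fun i j s => if s then
  kappa * (rho ^+ i.+4 * d4_plus i j - (1 - q) * R d4_plus j i.+1) / rho ^+ i.+4 else d4_plus i j).
have dC l j : d4_plus l j = d4_plus j l.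
  rewrite /d4_plus; have [//|//|->//] := ltngtP l j.
have PE l j : (l <= N)%N -> (j <= N)%N -> l != j -> P v l j = d4_plus l j.
  move=> lN jN lj; rewrite /plus_coord vE; last by lia.
  by have [h|h|h] := ltngtP l j; [|rewrite [RHS]dC|move: lj; rewrite h eqxx].
have RE j i : (j <= N)%N -> R (P v) j i = R d4_plus j i.
  by move=> jN; apply: eq_psum => l lN lj; rewrite PE //; lia.
exists v; split; last first.
  move=> v0; have := vE 1%N 3%N false isT; rewrite v0 (co_0 M) /d4_plus /= => /esym/eqP.
  by rewrite oppr_eq0 oner_eq0.
split=> [i j ij|_ j jN]; last by rewrite RE // d4_plus_sum.
rewrite /graph_rel vE // mulrCA divff // mulr1 PE ?RE //; lia.
Qed.

Lemma graph_weak kappa cl k v : (k < N)%N -> U kappa cl v ->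
  exists z, forall v', stepS k v v' -> co k k.+1 true v' = z -> U kappa cl v'.
Proof.
move=> kN Uv; exists (kappa * (rho ^+ k.+4 * co k k.+1 false v -
  (1 - q) * (rho * R (P v) k k.+2)) / rho ^+ k.+4) => v' st zE.
by apply: (graph_step _ Uv st); rewrite // zE mulrCA divff // mulr1.
Qed.

Definition cw_reducible : Prop := exists U : V -> Prop,
  [/\ subspace_pred U, forall k v, (k <= N)%N -> U v -> U (S k v),
      exists v, U v /\ v <> 0 & exists v, ~ U v].

Lemma cw_reducible_minus : t * rho ^+ 4 = 1 -> cw_reducible.
Proof.
move=> tr; exists (U (-1) false); split.
- exact: (graph_space_sub A).
- move=> k v; apply: (cw_criterion A rho0) => {k v}; first exact: (graph_space_sub A).
  + by move=> k v; exact: graph_weak.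
  + exact: graph_minus_step0.
  + move=> v v'; apply: (graph_top A rho0); first by left.
    by apply: (eqr_lin (k := -1) tr); ring.
  + exact: graph_plus_zero.
  + by move=> v; apply: graph_fork_zero; rewrite oppr_eq0 oner_eq0.
- exact: graph_nonzero.
by exists (x 0 1 true); exact: graph_proper.
Qed.

Lemma cw_reducible_t1 : t = 1 -> cw_reducible.
Proof.
move=> tr; exists (U q true); split.
- exact: (graph_space_sub A).
- move=> k v; apply: (cw_criterion A rho0) => {k v}; first exact: (graph_space_sub A).
  + by move=> k v; exact: graph_weak.
  + exact: graph_closed_step0.
  + move=> v v'; apply: (graph_top A rho0); first by right.
    by rewrite tr; ring.
  + exact: graph_plus_zero.
  + by move=> v; apply: graph_fork_zero.
- exact: graph_nonzero.
by exists (x 0 1 true); exact: graph_proper.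
Qed.

End GraphReducibility.

(** * Submodules for t = r^(4n-4), r^(2n-4) and -r^(2n-2) *)

Section SmallSubmodules.
Variables (F : fieldType) (K : nat) (rho t : F) (V : lmodType F).
Variables (S : nat -> V -> V) (T : nat -> V -> F).
Variables (co : nat -> nat -> bool -> V -> F) (x : nat -> nat -> bool -> V).
Local Notation N := K.+3.
Hypothesis A : cw_action N rho t S T co x.
Local Notation q := (rho ^+ 2).
Hypothesis rho0 : rho != 0.
Let M := cwM A.
Local Notation stepS := (stepS N rho co).
Local Notation step0 := (step0 N rho co).

Let rX m : rho ^+ m != 0. Proof. by rewrite expf_neq0. Qed.

Section Line.

(** The roots e_j + e_i and e_j - e_i have heights i + j and j - i; the factor rho^i avoids
    subtracting exponents. Each generator keeps [e], so it acts trivially on this line. *)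
Definition height_line (v : V) : Prop := exists e, forall i j, (i < j <= N)%N ->
  co i j false v = e * rho ^+ (i + j) /\ rho ^+ i * co i j true v = e * rho ^+ j.
Local Notation U := height_line.

Lemma height_line_sub : subspace_pred U.
Proof.
split=> [|a v w [e He] [f Hf]].
  by exists 0 => i j ij; rewrite !(co_0 M) mulr0 !mul0r.
exists (a * e + f) => i j ij; have [v1 v2] := He i j ij; have [w1 w2] := Hf i j ij.
rewrite !(co_lin M) v1 w1; split; first by ring.
by apply: (eqr_lin2 (k := a) (l := 1) v2 w2); ring.
Qed.

Lemma height_line_step k v : (k < N)%N -> U v ->
  exists2 e, (forall i j, (i < j <= N)%N ->
      co i j false v = e * rho ^+ (i + j) /\ rho ^+ i * co i j true v = e * rho ^+ j) &
    forall v', stepS k v v' -> co k k.+1 true v' = e * rho -> U v'.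
Proof.
move=> kN [e He]; exists e => // v' st zE.
have eP i j ij : co i j false v = e * rho ^+ (i + j) := (He i j ij).1.
have eQ i j ij : rho ^+ i * co i j true v = e * rho ^+ j := (He i j ij).2.
have rk : rho ^+ k.+1 = rho * rho ^+ k by rewrite exprS.
have rkj j : rho ^+ (k + j).+1 = rho * rho ^+ (k + j) by rewrite exprS.
have rik i : rho ^+ (i + k).+1 = rho * rho ^+ (i + k) by rewrite exprS.
exists e => i j ij.
have [ej1|jk1] := eqVneq j k.+1.
  rewrite ej1; have [->|ik] := eqVneq i k.
    by rewrite (st_fxp st) eP ?zE ?leqnn // ?rk; split=> //; ring.
  rewrite !(stj_dn st) ?eP; try lia.
  rewrite addnS ?rk ?rik; split; first by ring.
  by apply: (eqr_lin (k := rho) (eQ i k _)); [lia|ring].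
have [ej|jk] := eqVneq j k.
  rewrite ej !(stj_up st) ?eP ?addnS ?rk ?rik; try lia.
  split; first by ring.
  apply: (eqr_lin2 (k := 1 - q) (l := rho) (eQ i k _) (eQ i k.+1 _)); [lia|lia|].
  by rewrite ?rk; ring.
have [ei|ik] := eqVneq i k.
  rewrite ei !(stp_up st) ?(stm_dn st) ?eP ?addSn ?rk ?rkj; try lia.
  split; first by ring.
  by apply: (eqr_lin (k := 1) (eQ k.+1 j _)); [lia|rewrite ?rk; ring].
have [ei|ik1] := eqVneq i k.+1.
  rewrite ei !(stp_dn st) ?(stm_up st) ?eP ?addSn ?rk ?rkj; try lia.
  split; first by ring.
  apply: (eqr_lin2 (k := 1 - q) (l := q) (eQ k.+1 j _) (eQ k j _)); [lia|lia|].
  by rewrite ?rk; ring.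
by rewrite !(st_fx st) // eP ?eQ.
Qed.

Lemma height_line_step0 v : U v ->
  exists z, forall v', step0 v v' -> co 0 1 false v' = z -> U v'.
Proof.
move=> [e He]; exists (e * rho) => v' st zE; exists e => i j ij.
have [i1|i1] := ltnP 1 i; first by rewrite !(st0_fx st) //; exact: He.
have [jN|j1] := boolP (1 < j <= N)%N; last first.
  have [-> ->] : i = 0%N /\ j = 1%N by lia.
  by rewrite (st0_fxm st) zE (He 0%N 1%N _).2.
have [p0 q0] := He 0%N j ltac:(lia); have [p1 q1] := He 1%N j ltac:(lia).
rewrite mul1r in q0.
have [-> |i0] := eqVneq i 1%N.
  rewrite (st1p_dn st) ?(st1m_up st) // p0 q0 !exprS expr0; split; first by ring.
  by apply: (eqr_lin (k := 1 - q) q1); ring.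
have -> : i = 0%N by lia.
rewrite (st0p_dn st) ?(st0m_up st) // p1 q0 !exprS expr0; split; last by ring.
by apply: (eqr_lin (k := 1) q1); ring.
Qed.

Lemma height_line_top v v' : t * rho ^+ (4 * N) = 1 -> U v ->
  stepS K.+2 v v' -> co K.+2 N true v' = t * T N v -> U v'.
Proof.
move=> tr Uv st zE; have [e He] := height_line_step (ltnSn K.+2) Uv; apply => //.
rewrite zE (T_top A).
(* On the line [rowI] is a sum of two geometric series of ratios q and q^(-1); the factor in front
   clears their denominators. *)
have I m : (m <= N)%N -> (1 - q) * (rho ^+ m * rho * rowI N rho co m v) =
    e * rho ^+ N * (q - (rho ^+ m) ^+ 4 + (1 - q) * (rho ^+ m) ^+ 2).
  elim: m => [|m IH] mN; first by rewrite /= expr0; ring.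
  have [p1 q1] := He m N ltac:(lia).
  rewrite rowIS p1 exprD (exprS rho m) (mulnC 2 m) exprM; have := IH (ltnW mN); move: (rowI _ _ _ _ _) => y IHm.
  apply: (eqr_lin2 (k := q) (l := (1 - q) * rho ^+ 2) IHm q1).
  by move: (rho ^+ m) (rho ^+ N) => a b; ring.
have IN := I N (leqnn N).
have [pN qN] := He K.+2 N ltac:(lia).
have rN : rho ^+ N = rho * rho ^+ K.+2 by rewrite exprS.
have tr' : t * (rho ^+ N) ^+ 4 = 1 by rewrite -exprM mulnC.
have QN : co K.+2 N true v = e * rho.
  by apply: (mulfI (rX K.+2)); rewrite qN rN; ring.
apply: (mulfI (rX K.+2)); apply: (mulfI rho0); apply: (mulfI rho0).
rewrite [N.-1]/= QN pN exprD; move: IN tr'; rewrite rN.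
move: (rowI _ _ _ _ _) (rho ^+ K.+2) => y c IN tr'.
by apply: (eqr_lin2 (k := - t * q) (l := e * q * rho * c) IN tr'); ring.
Qed.

Lemma height_line_coord v e :
  (forall i j, (i < j <= N)%N ->
    co i j false v = e * rho ^+ (i + j) /\ rho ^+ i * co i j true v = e * rho ^+ j) ->
  co 0 1 false v = 0 \/ co 0 1 true v = 0 -> v = 0.
Proof.
move=> He z; have e0 : e = 0.
  have [p1 q1] := He 0%N 1%N isT; rewrite mul1r in q1.
  move: z; rewrite p1 q1; case=> /eqP; rewrite mulf_eq0 (negPf (rX _)) orbF => /eqP //.
apply: (co_ext M) => i j s ij; rewrite (co_0 M); have [p1 q1] := He i j ij.
case: s; last by rewrite p1 e0 mul0r.
by apply: (mulfI (rX i)); rewrite q1 e0 mul0r mulr0.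
Qed.

Lemma cw_reducible_line : t * rho ^+ (4 * N) = 1 -> cw_reducible K S.
Proof.
move=> tr; exists U; split.
- exact: height_line_sub.
- move=> k v; apply: (cw_criterion A rho0) => {k v}; first exact: height_line_sub.
  + by move=> k v kN /(height_line_step kN) [e _ He]; exists (e * rho).
  + exact: height_line_step0.
  + by move=> v v'; exact: height_line_top.
  + by move=> v [e He] z; apply: (height_line_coord He); left; apply: z.
  + move=> v [e He] z; have -> : v = 0; last by rewrite !(co_0 M).
    by apply: (height_line_coord He); right; apply: z.
- have [v vE] := co_surj M (fun i j s => if s then rho ^+ j / rho ^+ i else rho ^+ (i + j)).
  exists v; split.
    by exists 1 => i j ij; rewrite !vE // !mul1r mulrCA divff // mulr1.
  move=> v0; have /eqP := vE 0%N 1%N false isT.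
  by rewrite v0 (co_0 M) eq_sym (negPf (rX _)).
exists (x 0 1 true) => [[e He]].
have /eqP : co 0 1 true (x 0 1 true) = 0.
  by rewrite (height_line_coord He) ?(co_0 M) //; left; rewrite (co_x M).
by rewrite (co_x M) // oner_eq0.
Qed.

End Line.

Section Ramp.
Variable kappa : F.

Definition tail (a : nat -> F) (m : nat) : F := \sum_(m <= l < N.+1) rho ^+ l * a l.

(* kappa = q gives t = r^(2n-4), and kappa = -1 gives t = -r^(2n-2). *)
Definition ramp_coef (a D : nat -> F) : Prop :=
  (1 + kappa) * tail a 0 = 0 /\
  forall i, (i <= N)%N -> rho ^+ i.+2 * D i = kappa * (rho ^+ i.+2 * a i - (1 - q) * tail a i.+1).

(** The sequences a and D play the role of coordinates at the vectors e_i and -e_i: the generators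
    transform them by the same raising and lowering rules as the coordinates at roots. The factor
    rho^i again clears denominators. *)
Definition ramp_at (a D : nat -> F) (v : V) : Prop := forall i j, (i < j <= N)%N ->
  co i j false v = rho ^+ j * a i + rho ^+ i.+2 * a j /\
  rho ^+ i * co i j true v = rho ^+ (i + j) * D i + q * a j.

Definition ramp_space (v : V) : Prop := exists a D, ramp_coef a D /\ ramp_at a D v.
Local Notation U := ramp_space.

Lemma tail_step a m : (m <= N)%N -> tail a m = rho ^+ m * a m + tail a m.+1.
Proof. by move=> mN; rewrite /tail big_ltn. Qed.

Lemma tail_top a : tail a N.+1 = 0.
Proof. by rewrite /tail big_geq. Qed.

Lemma eq_tail a a' m : (forall l, (m <= l <= N)%N -> a l = a' l) -> tail a m = tail a' m.
Proof. by move=> e; apply: eq_big_nat => l lN; rewrite e //; lia. Qed.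

Lemma ramp_space_sub : subspace_pred U.
Proof.
split=> [|b v w [a [D [[a0 aD] av]]] [a' [D' [[a0' aD'] aw]]]].
  have t0 m : tail (fun=> 0) m = 0 by rewrite /tail big1 // => l _; rewrite mulr0.
  exists (fun=> 0), (fun=> 0); split; last by move=> i j ij; rewrite !(co_0 M) !mulr0 addr0.
  by split=> [|i iN]; rewrite t0 !mulr0 ?subr0 ?mulr0.
have tD m : tail (fun l => b * a l + a' l) m = b * tail a m + tail a' m.
  by rewrite /tail mulr_sumr -big_split; apply: eq_bigr => l _ /=; ring.
exists (fun l => b * a l + a' l), (fun l => b * D l + D' l); split.
  split=> [|i iN]; rewrite tD.
    by apply: (eqr_lin2 (k := b) (l := 1) a0 a0'); ring.
  by apply: (eqr_lin2 (k := b) (l := 1) (aD i iN) (aD' i iN)); ring.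
move=> i j ij; rewrite !(co_lin M); have [v1 v2] := av i j ij; have [w1 w2] := aw i j ij.
split; first by apply: (eqr_lin2 (k := b) (l := 1) v1 w1); ring.
by apply: (eqr_lin2 (k := b) (l := 1) v2 w2); ring.
Qed.

Definition swap_coef k (a : nat -> F) (l : nat) : F :=
  if l == k.+1 then rho * a k else if l == k then (1 - q) * a k + rho * a k.+1 else a l.

Definition swap_diag k (D : nat -> F) (l : nat) : F :=
  if l == k then rho * D k.+1 else if l == k.+1 then (1 - q) * D k.+1 + rho * D k else D l.

Lemma tail_swap a k m : (k < N)%N -> m != k.+1 -> tail (swap_coef k a) m = tail a m.
Proof.
move=> kN mk.
have [km|km] := ltnP k m.
  by apply: eq_tail => l lN; rewrite /swap_coef !gtn_eqF //; lia.
have base : tail (swap_coef k a) k = tail a k.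
  rewrite !(@tail_step _ k) ?(@tail_step _ k.+1); try lia.
  have -> : tail (swap_coef k a) k.+2 = tail a k.+2.
    by apply: eq_tail => l lN; rewrite /swap_coef !gtn_eqF //; lia.
  by rewrite /swap_coef !eqxx ltn_eqF // (exprS rho k); ring.
have [d ->] : exists d, m = (k - d)%N by exists (k - m)%N; lia.
elim: d => [|d IH]; first by rewrite subn0.
have [dk|dk] := leqP k d; first by rewrite (_ : k - d.+1 = k - d)%N //; lia.
rewrite !(@tail_step _ (k - d.+1)); try lia.
rewrite (_ : (k - d.+1).+1 = k - d)%N; last by lia.
by rewrite IH /swap_coef !ltn_eqF //; lia.
Qed.

Lemma ramp_coef_swap a D k : (k < N)%N -> ramp_coef a D -> ramp_coef (swap_coef k a) (swap_diag k D).
Proof.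
move=> kN [a0 aD].
have tk : tail (swap_coef k a) k.+1 = rho ^+ k.+2 * a k + tail a k.+2.
  by rewrite (@tail_step _ k.+1) // tail_swap ?gtn_eqF // /swap_coef eqxx (exprS rho k.+1); ring.
have tk' : tail a k.+1 = rho ^+ k.+1 * a k.+1 + tail a k.+2 by rewrite (@tail_step _ k.+1).
have rk : rho ^+ k.+3 = q * rho ^+ k.+1 by rewrite !exprS; ring.
have rk' : rho ^+ k.+2 = rho * rho ^+ k.+1 by rewrite exprS.
have := aD k (ltnW kN); have := aD k.+1 kN; rewrite tk' rk rk' => e1 e2.
split=> [|i iN]; first by rewrite tail_swap.
have [->|ik] := eqVneq i k.
  rewrite tk rk' /swap_coef /swap_diag eqxx ltn_eqF //.
  by apply: (eqr_lin (k := 1) e1); ring.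
have [->|ik1] := eqVneq i k.+1.
  rewrite tail_swap ?gtn_eqF // rk /swap_coef /swap_diag eqxx gtn_eqF //.
  by apply: (eqr_lin2 (k := 1 - q) (l := q) e1 e2); ring.
by rewrite tail_swap // /swap_coef /swap_diag (negPf ik) (negPf ik1) aD.
Qed.

Lemma ramp_step k a D v v' : (k < N)%N -> ramp_coef a D -> ramp_at a D v -> stepS k v v' ->
  rho ^+ k * co k k.+1 true v' = rho ^+ (k + k).+2 * D k.+1 + rho ^+ 3 * a k -> U v'.
Proof.
move=> kN c av st zE; exists (swap_coef k a), (swap_diag k D).
split; first exact: ramp_coef_swap.
have aP i j ij := (av i j ij).1; have aQ i j ij := (av i j ij).2.
have rk : rho ^+ k.+1 = rho * rho ^+ k by rewrite exprS.
have rk2 : rho ^+ k.+2 = q * rho ^+ k by rewrite !exprS; ring.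
have rk3 : rho ^+ k.+3 = rho ^+ 3 * rho ^+ k by rewrite !exprS; ring.
have Sk : (k == k.+1) = false by rewrite ltn_eqF.
have kS : (k.+1 == k) = false by rewrite gtn_eqF.
move=> i j ij.
have [ej1|jk1] := eqVneq j k.+1.
  rewrite ej1; have [ei|ik] := eqVneq i k.
    rewrite ei (st_fxp st) aP ?zE ?leqnn // addnS /swap_coef /swap_diag !eqxx Sk ?kS.
    by split; rewrite ?rk2 ?rk ?[rho ^+ (k + k).+2]exprS; ring.
  have ik1 : (i == k.+1) = false by lia.
  rewrite /swap_coef /swap_diag !eqxx (negPf ik) ik1 !(stj_dn st) ?aP ?addnS ?rk; try lia.
  rewrite [rho ^+ (i + k).+1]exprS; split; first by ring.
  by apply: (eqr_lin (k := rho) (aQ i k _)); [lia|ring].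
have [ej|jk] := eqVneq j k.
  have ik : (i == k) = false by lia.
  have ik1 : (i == k.+1) = false by lia.
  rewrite ej /swap_coef /swap_diag !eqxx ?kS ?Sk ik ik1 !(stj_up st) ?aP ?rk; try lia.
  split; first by ring.
  apply: (eqr_lin2 (k := 1 - q) (l := rho) (aQ i k _) (aQ i k.+1 _)); [lia|lia|].
  by rewrite addnS [rho ^+ (i + k).+1]exprS; ring.
have [ei|ik] := eqVneq i k.
  rewrite ei /swap_coef /swap_diag !eqxx ?kS ?Sk (negPf jk) (negPf jk1).
  rewrite !(stp_up st) ?(stm_dn st) ?aP ?rk3 ?rk2; try lia.
  split; first by ring.
  apply: (eqr_lin (k := 1) (aQ k.+1 j _)); [lia|].
  by rewrite addSn [rho ^+ (k + j).+1]exprS rk; ring.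
have [ei|ik1] := eqVneq i k.+1.
  rewrite ei /swap_coef /swap_diag !eqxx ?kS ?Sk (negPf jk) (negPf jk1).
  rewrite !(stp_dn st) ?(stm_up st) ?aP ?rk3 ?rk2; try lia.
  split; first by ring.
  apply: (eqr_lin2 (k := 1 - q) (l := q) (aQ k.+1 j _) (aQ k j _)); [lia|lia|].
  by rewrite !addSn ![rho ^+ (k + j).+1]exprS rk; ring.
rewrite /swap_coef /swap_diag (negPf jk) (negPf jk1) (negPf ik) (negPf ik1).
by rewrite !(st_fx st) // aP ?aQ.
Qed.

Hypothesis hk : (kappa + 1) * (kappa - q) = 0.

Definition fork_coef (a D : nat -> F) (l : nat) : F :=
  match l with 0 => rho * D 1%N | 1 => rho * D 0%N | _ => a l end.

Definition fork_diag (a D : nat -> F) (l : nat) : F :=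
  match l with
  | 0 => (1 - q) * D 0%N + rho * a 1%N | 1 => (1 - q) * D 1%N + rho * a 0%N | _ => D l
  end.

(** Node 0 mixes a and D at indices 0 and 1. Eliminating D_0 and D_1 makes the required identities
    quadratic in kappa; they follow from [hk] and the tail condition. *)
Lemma ramp_coef_fork a D : ramp_coef a D -> ramp_coef (fork_coef a D) (fork_diag a D).
Proof.
move=> [ez aD].
have tl b : tail b 1 = rho * b 1%N + tail b 2 by rewrite (@tail_step _ 1) // expr1.
have tz b : tail b 0 = b 0%N + rho * b 1%N + tail b 2.
  by rewrite (@tail_step _ 0) // tl expr0 mul1r addrA.
have t2 m : (1 < m)%N -> tail (fork_coef a D) m = tail a m.
  by move=> m1; apply: eq_tail => l lN; case: l lN => [|[|l]] //; lia.
have e0 := aD 0%N isT; have e1 := aD 1%N isT.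
rewrite tz in ez; rewrite tl in e0.
split=> [|i iN].
  rewrite tz t2 //=; apply: (mulfI (rX 2)).
  apply: (eqr_lin2 (k := (1 + kappa) * q) (l := 1 + kappa) e0 e1).
  apply: (eqr_lin2 (k := rho ^+ 3 * a 1%N - (1 - q) * tail a 2 +
    q * (q * a 0%N - (1 - q) * (rho * a 1%N + tail a 2))) (l := q ^+ 3) hk ez); ring.
case: i iN => [|[|i]] iN; last by rewrite /= t2 ?aD.
  rewrite tl t2 //=.
  apply: (eqr_lin2 (k := (1 - q) * (1 + kappa)) (l := - kappa) e0 e1).
  apply: (eqr_lin2 (k := (1 - q) * (q * a 0%N - (1 - q) * (rho * a 1%N + tail a 2)) -
    (rho ^+ 3 * a 1%N - (1 - q) * tail a 2)) (l := (1 - q) * q ^+ 2) hk ez); ring.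
rewrite t2 //=.
apply: (eqr_lin2 (k := - (kappa * q)) (l := 1 - q) e0 e1).
apply: (eqr_lin2 (k := - q * (q * a 0%N - (1 - q) * (rho * a 1%N + tail a 2)))
  (l := (1 - q) * q ^+ 2) hk ez); ring.
Qed.

Lemma ramp_step0 v : U v ->
  exists z, forall v', step0 v v' -> co 0 1 false v' = z -> U v'.
Proof.
move=> [a [D [c av]]]; exists (rho * fork_coef a D 0 + q * fork_coef a D 1) => v' st zE.
exists (fork_coef a D), (fork_diag a D); split; first exact: ramp_coef_fork.
move=> i j ij.
have [i1|i1] := ltnP 1 i.
  have e b : fork_coef b D i = b i by case: (i) i1 => [|[]].
  have e' b : fork_coef b D j = b j by case: (j) ij i1 => [|[|j']] //; lia.
  have e'' : fork_diag a D i = D i by case: (i) i1 => [|[]].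
  by rewrite !(st0_fx st) // e e' e''; exact: av.
have [jN|j1] := boolP (1 < j <= N)%N; last first.
  have [-> ->] : i = 0%N /\ j = 1%N by lia.
  have [p1 q1] := av 0%N 1%N isT; split; first by rewrite zE expr1.
  rewrite (st0_fxm st) q1 /=; ring.
have ej : fork_coef a D j = a j by case: (j) jN => [|[]].
have [p0 q0] := av 0%N j ltac:(lia); have [p1 q1] := av 1%N j ltac:(lia).
rewrite ej; rewrite mul1r in q0; rewrite [rho ^+ (1 + j)]exprS in q1.
have [-> |i0] := eqVneq i 1%N.
  rewrite (st1p_dn st) ?(st1m_up st) // p0 q0 [rho ^+ (1 + j)]exprS /=; split; first by ring.
  by apply: (eqr_lin (k := 1 - q) q1); ring.
have -> : i = 0%N by lia.
rewrite (st0p_dn st) ?(st0m_up st) // p1 q0 /=; split; last by ring.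
by apply: (eqr_lin (k := 1) q1); ring.
Qed.

Lemma ramp_rowI a D v m : ramp_coef a D -> ramp_at a D v -> (m <= N)%N ->
  (1 - q) * (rho ^+ m * rho * rowI N rho co m v) =
  (1 - q) * (rho ^+ N * ((rho ^+ m) ^+ 2 * (tail a 0 - tail a m) +
    kappa * ((rho ^+ m) ^+ 2 * tail a 0 - tail a m))) +
  a N * q * (q - (rho ^+ m) ^+ 4 + (1 - q) * (rho ^+ m) ^+ 2).
Proof.
move=> [_ aD] av; elim: m => [|m IH] mN; first by rewrite /= expr0; ring.
have [p1 q1] := av m N ltac:(lia); have := aD m (ltnW mN); have := IH (ltnW mN).
have rm : rho ^+ m.+2 = q * rho ^+ m by rewrite !exprS; ring.
rewrite rowIS p1 (exprS rho m) (mulnC 2 m) exprM (@tail_step _ m) 1?ltnW // rm.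
rewrite exprD in q1; move: (rowI _ _ _ _ _) => y IHm dm.
apply: (eqr_lin2 (k := q) (l := (1 - q) * q) IHm q1).
apply: (eqr_lin (k := (1 - q) * rho ^+ N) dm).
by move: (rho ^+ m) (rho ^+ N) => b b'; ring.
Qed.

Lemma ramp_top v v' : t * (rho ^+ N) ^+ 2 = kappa -> U v ->
  stepS K.+2 v v' -> co K.+2 N true v' = t * T N v -> U v'.
Proof.
move=> tr [a [D [c av]]] st zE; apply: (ramp_step _ c av st) => //.
have IN := ramp_rowI c av (leqnn N); have [ez aD] := c.
have [pN qN] := av K.+2 N ltac:(lia).
have dk := aD K.+2 (leqnSn _); have dN := aD N (leqnn _).
rewrite tail_top mulr0 subr0 mulrCA in dN.
have {}dN := mulfI (rX _) dN.
have tN : tail a N = rho ^+ N * a N by rewrite (@tail_step _ N) // tail_top addr0.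
have rN : rho ^+ N = rho * rho ^+ K.+2 by rewrite exprS.
have r2 : rho ^+ (K.+2 + K.+2).+2 = q * (rho ^+ K.+2) ^+ 2.
  by rewrite (exprS rho (K.+2 + K.+2).+1) (exprS rho (K.+2 + K.+2)) exprD; ring.
have r4 : rho ^+ K.+4 = q * rho ^+ K.+2 by rewrite !(exprS rho K.+3) (exprS rho K.+2); ring.
rewrite zE (T_top A) [N.-1]/= pN dN r2 r4.
rewrite tN in IN; rewrite tN r4 rN in dk; rewrite exprD rN in qN; rewrite rN in IN tr.
apply: (mulfI (rX 2)); rewrite rN.
move: (rowI _ _ _ _ _) (rho ^+ K.+2) IN tr qN dk => y b IN tr qN dk.
apply: (eqr_lin2 (k := - t * q) (l := t * q * q) IN qN).
apply: (eqr_lin2 (k := t * q * rho * b) (l := - (t * q * (1 - q) * (rho * b) ^+ 3)) dk ez).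
apply: (eqr_lin2 (k := rho * (q * kappa + q - q ^+ 2) * a K.+2 + q * (rho * b) ^+ 2 * a N)
  (l := rho * q * a K.+2) tr hk); ring.
Qed.

Hypothesis qN1 : q != -1.

Let q1n0 : 1 + q != 0. Proof. by rewrite addrC addr_eq0. Qed.

Lemma ramp_coef_zero a D v : ramp_coef a D -> ramp_at a D v ->
  (forall l, (l <= N)%N -> a l = 0) -> v = 0.
Proof.
move=> [_ aD] av a0; have t0 m : tail a m = 0.
  by rewrite /tail big_nat_cond big1 // => l /andP[/andP[_ lN] _]; rewrite a0 ?mulr0.
have D0 i : (i <= N)%N -> D i = 0.
  move=> iN; apply: (mulfI (rX i.+2)); rewrite aD // a0 // t0; ring.
apply: (co_ext M) => i j s ij; rewrite (co_0 M); have [p1 q1] := av i j ij.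
have iN : (i <= N)%N by lia. have jN : (j <= N)%N by lia.
case: s; last by rewrite p1 !a0 // !mulr0 addr0.
by apply: (mulfI (rX i)); rewrite q1 D0 // a0 // !mulr0 addr0.
Qed.

(** The coordinates at e_1 + e_0, e_2 + e_0 and e_2 + e_1 combine to (1 + q) rho^3 a_0. Once a_0 =
    0, the remaining a_l are read off at e_l + e_0. *)
Lemma ramp_plus_zero v : U v ->
  (forall i j, (i < j <= N)%N -> co i j false v = 0) -> v = 0.
Proof.
move=> [a [D [c av]]] z.
have aP i j : (i < j <= N)%N -> rho ^+ j * a i + rho ^+ i.+2 * a j = 0.
  by move=> ij; rewrite -(av i j ij).1 z.
have a0 : a 0%N = 0.
  apply: (mulfI (rX 3)); apply: (mulfI q1n0); rewrite !mulr0.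
  have e01 := aP 0%N 1%N isT; have e02 := aP 0%N 2%N isT; have e12 := aP 1%N 2%N isT.
  apply: (eqr_lin2 (k := q) (l := rho ^+ 3) e01 e02); apply: (eqr_lin (k := - q) e12); ring.
apply: (ramp_coef_zero c av) => -[//|l] lN.
have := aP 0%N l.+1; rewrite a0 mulr0 add0r => /(_ lN)/eqP.
by rewrite mulf_eq0 (negPf (rX _)) => /eqP.
Qed.

Lemma ramp_fork_zero v : U v ->
  (forall i j s, (i < j <= N)%N -> (if s then (i != 1) || (j != 2) else (i != 0) || (2 < j))%N ->
     co i j s v = 0) -> co 0 1 false v = 0 /\ co 0 2 false v = 0.
Proof.
move=> [a [D [c av]]] z.
have [_ q01] := av 0%N 1%N isT; have [_ q02] := av 0%N 2%N isT.
have [p12 _] := av 1%N 2%N isT; have [p13 _] := av 1%N 3%N isT; have [p03 _] := av 0%N 3%N isT.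
rewrite !z // in q01 q02 p12 p13 p03.
have a1 : a 1%N = 0.
  apply: (mulfI (rX 3)); apply: (mulfI q1n0); rewrite !mulr0.
  apply: (eqr_lin2 (k := - rho ^+ 3) (l := q) q01 q02).
  by apply: (eqr_lin (k := - rho) p12); ring.
have a2 : a 2%N = 0.
  by apply: (mulfI (rX 3)); apply: (eqr_lin2 (k := -1) (l := - q) p12 a1); ring.
have a3 : a 3%N = 0.
  by apply: (mulfI (rX 3)); apply: (eqr_lin2 (k := -1) (l := - rho ^+ 3) p13 a1); ring.
have a0 : a 0%N = 0.
  by apply: (mulfI (rX 3)); apply: (eqr_lin2 (k := -1) (l := - q) p03 a3); ring.
by rewrite (av 0%N 1%N isT).1 (av 0%N 2%N isT).1 a0 a1 a2 !mulr0 addr0.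
Qed.

Lemma cw_reducible_ramp : t * (rho ^+ N) ^+ 2 = kappa -> cw_reducible K S.
Proof.
move=> tr; exists U; split.
- exact: ramp_space_sub.
- move=> k v; apply: (cw_criterion A rho0) => {k v}; first exact: ramp_space_sub.
  + move=> k v kN [a [D [c av]]].
    exists ((rho ^+ (k + k).+2 * D k.+1 + rho ^+ 3 * a k) / rho ^+ k) => v' st zE.
    by apply: (ramp_step kN c av st); rewrite zE mulrCA divff // mulr1.
  + exact: ramp_step0.
  + by move=> v v'; exact: ramp_top.
  + exact: ramp_plus_zero.
  + exact: ramp_fork_zero.
(* Chosen so that the weighted sum rho^0 a_0 + rho^1 a_1 vanishes; the tail condition then holds for
   either value of [kappa]. *)
- pose a l := match l with 0 => rho | 1 => -1 | _ => 0 end : F.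
  pose D i := kappa * (rho ^+ i.+2 * a i - (1 - q) * tail a i.+1) / rho ^+ i.+2.
  have [v vE] := co_surj M (fun i j s => if s then
    (rho ^+ (i + j) * D i + q * a j) / rho ^+ i else rho ^+ j * a i + rho ^+ i.+2 * a j).
  have t2 : tail a 2 = 0.
    by rewrite /tail big_nat_cond big1 // => -[|[|l]] //; rewrite mulr0.
  exists v; split; last first.
    move=> v0; have /eqP := vE 0%N 2%N false isT.
    by rewrite v0 (co_0 M) /= mulr0 addr0 -exprSr eq_sym (negPf (rX _)).
  exists a, D; split; last by move=> i j ij; rewrite !vE // mulrCA divff // mulr1.
  split=> [|i iN]; last by rewrite /D mulrCA divff // mulr1.
  by rewrite (@tail_step _ 0) // (@tail_step _ 1) // t2 /=; ring.
exists (x 0 1 true) => Ux; have z : x 0 1 true = 0.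
  by apply: ramp_plus_zero => // i j ij; rewrite (co_x M) ?andbF.
have /eqP := @co_x _ _ _ _ _ _ _ _ _ M 0 1 true 0 1 true isT isT.
by rewrite z (co_0 M) eq_sym oner_eq0.
Qed.

End Ramp.
End SmallSubmodules.

(** * The submodule for t = -1 *)

Section HeckeKernel.
Variables (F : fieldType) (K : nat) (rho t : F) (V : lmodType F).
Variables (S : nat -> V -> V) (T : nat -> V -> F).
Variables (co : nat -> nat -> bool -> V -> F) (x : nat -> nat -> bool -> V).
Local Notation N := K.+3.
Hypothesis A : cw_action N rho t S T co x.
Local Notation q := (rho ^+ 2).
Local Notation sr := (sroot x).
Local Notation sr2 := (sroot2 x).
Local Notation sc := (scoord co).
Hypotheses (rho0 : rho != 0) (t0 : t != 0).
Let M := cwM A.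

(* (s_k - 1)(s_k + q) has rank one; this is its coefficient at the simple root. *)
Definition hecke_val (k : nat) (v : V) : F :=
  sc k (S k (S k v)) - (1 - q) * sc k (S k v) - q * sc k v.
Local Notation f := hecke_val.

Lemma hecke_valE k v : (k <= N)%N -> S k (S k v) = (1 - q) *: S k v + q *: v + f k v *: sr k.
Proof.
move=> kN; have [b e] := hecke_mod A v kN.
have -> : f k v = b.
  have := congr1 (sc k) e; rewrite (sc_Z M) (sc_sroot M) // eqxx mulr1 => <-.
  by rewrite -!scaleNr !(sc_D M, sc_Z M) /f; ring.
by rewrite -e [RHS]addrC -[_ - _ - _]addrA -opprD subrK.
Qed.

Lemma hecke_val_lin k a v w : f k (a *: v + w) = a * f k v + f k w.
Proof. by rewrite /f !(S_lin M) !(sc_D M) !(sc_Z M); ring. Qed.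

Lemma hecke_val_unique k v b : (k <= N)%N ->
  S k (S k v) = (1 - q) *: S k v + q *: v + b *: sr k -> f k v = b.
Proof.
move=> kN e; rewrite /f e !(sc_D M) !(sc_Z M) (sc_sroot M) // eqxx mulr1; ring.
Qed.

Lemma S_sroot k : (k <= N)%N -> S k (sr k) = (t * rho ^+ 4) *: sr k.
Proof. by move=> kN; rewrite (S_self M) // (T_self A). Qed.

Lemma S2_sroot j k : (j <= N)%N -> (k <= N)%N -> adj j k -> S k (S j (sr k)) = q *: sr j.
Proof.
move=> jN kN jk; have kj : adj k j by rewrite adjC.
have -> : S j (sr k) = (1 - q) *: sr k + rho *: sr2 j k.
  by rewrite (S_adjr M) // (T_off A) ?adj_neq // mulr0 scale0r addr0.
rewrite (S_D M) !(S_Z M) S_sroot // (sr2C x) (S_root2 M) // (T_root2 A) //.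
rewrite !scalerDr !scalerA addrC -addrA -scalerDl -[RHS]addr0; congr (_ + _).
by rewrite (_ : _ + _ = 0) ?scale0r //; ring.
Qed.

(** Needed to write an arbitrary vector as S_k S_j S_i w when an identity is conjugated. The
    quadratic relation inverts S_k up to a multiple of [sr k], itself an eigenvector with nonzero
    eigenvalue. *)
Lemma S_surj k w : (k <= N)%N -> exists v, S k v = w.
Proof.
move=> kN; have q0 : q != 0 by rewrite expf_neq0.
have u0 : t * rho ^+ 4 != 0 by rewrite mulf_neq0 ?expf_neq0.
exists (q^-1 *: (S k w - (1 - q) *: w - (f k w / (t * rho ^+ 4)) *: sr k)).
rewrite (S_Z M) !(S_B M) !(S_Z M) S_sroot // scalerA divfK // hecke_valE //.
by rewrite [X in _ *: X]addrAC addrK addrAC subrr add0r scalerA mulVf // scale1r.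
Qed.

Lemma hecke_val_self k v : (k <= N)%N -> f k (S k v) = t * rho ^+ 4 * f k v.
Proof.
move=> kN; apply: hecke_val_unique => //.
by rewrite {1}(hecke_valE v) // !(S_D M) !(S_Z M) S_sroot // scalerA mulrC.
Qed.

Lemma hecke_val_nonadj j k v : (j <= N)%N -> (k <= N)%N -> j != k -> ~~ adj j k ->
  f k (S j v) = f k v.
Proof.
move=> jN kN jk nad; apply: hecke_val_unique => //.
have C w : S k (S j w) = S j (S k w).
  by apply: (cw_act A).2; rewrite // 1?eq_sym // adjC.
rewrite !C hecke_valE // !(S_D M) !(S_Z M) (S_nadj M) // (T_off A) //.
by rewrite mulr0 scale0r addr0.
Qed.

(** S_j S_k intertwines S_j with S_k and sends [sr j] to q times [sr k], so it carries the quadratic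
    relation of node j to that of node k. *)
Lemma hecke_val_adj2 j k v : (j <= N)%N -> (k <= N)%N -> adj j k ->
  f k (S j (S k v)) = q * f j v.
Proof.
move=> jN kN jk; have kj : adj k j by rewrite adjC.
apply: hecke_val_unique => //.
have B w : S k (S j (S k w)) = S j (S k (S j w)) by apply: (cw_act A).1.
rewrite !B hecke_valE // !(S_D M) !(S_Z M) S2_sroot //.
by rewrite -B scalerA mulrC.
Qed.

(** Here the row index of [rowI] varies: node k+1 exchanges the rows of e_k and e_(k+1), so row sums
    follow the rules of single coordinates. *)
Lemma rowI_shift k m v : (m <= k)%N -> (k < N)%N ->
  rowI k.+1 rho co m (S k.+1 v) = rho * rowI k rho co m v.
Proof.
elim: m => [|m IH] mk kN /=; first by rewrite mulr0.
by rewrite IH ?(coj_dn M) //; try lia; ring.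
Qed.

Lemma rowI_up k m v : (m <= k)%N -> (k < N)%N ->
  rowI k rho co m (S k.+1 v) = (1 - q) * rowI k rho co m v + rho * rowI k.+1 rho co m v.
Proof.
elim: m => [|m IH] mk kN /=; first by rewrite !mulr0 addr0.
by rewrite IH ?(coj_up M) //; try lia; ring.
Qed.

Lemma rowI_far k l m v : (m <= l < k)%N -> (k < N)%N ->
  rowI l rho co m (S k.+1 v) = rowI l rho co m v.
Proof.
elim: m => [|m IH] mk kN //=.
by rewrite IH ?(co_fxS M) //; lia.
Qed.

Section Base.
Local Notation cQ := (co K.+2 N true).
Local Notation cP := (co K.+2 N false).
Local Notation cA := (co K.+1 N true).
Local Notation cB := (co K.+1 N false).
Local Notation cC := (co K.+1 K.+2 true).
Local Notation cE := (co K.+1 K.+2 false).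
Local Notation cX := (rowI N rho co K.+1).
Local Notation cY := (rowI K.+2 rho co K.+1).
Local Notation cZ := (rowI K.+1 rho co K.+1).
Local Notation u := (rho ^+ (2 * K.+1)).

Lemma T_topE v : T N v = q * cQ v -
  (q - rho ^+ 4) * (rho * (rho * cX v + cA v + u * cB v) + cQ v + u * q * cP v - cP v).
Proof. by rewrite (T_top A) (rowIS _ _ _ K.+2) (rowIS _ _ _ K.+1) (expr2S _ K.+1). Qed.

Lemma T_top_low v : T N (S K.+2 v) = q * ((1 - q) * cQ v + rho * cA v) -
  (q - rho ^+ 4) * (rho * (rho * cX v + rho * cQ v + u * ((1 - q) * cB v + rho * cP v)) +
    ((1 - q) * cQ v + rho * cA v) + u * q * (rho * cB v) - rho * cB v).
Proof.
have k1 : (K.+2 < N <= N)%N by lia.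
rewrite T_topE (rowI_low M) // !(com_up M, com_dn M, cop_up M, cop_dn M) //.
Qed.

Lemma T_top_top v : T N (S N v) = q * (t * T N v) -
  (q - rho ^+ 4) * (rho * (rho * (rho * cY v) + rho * cC v + u * (rho * cE v)) + t * T N v +
    u * q * cP v - cP v).
Proof.
have dn s : co K.+1 N s (S N v) = rho * co K.+1 K.+2 s v by apply: (coj_dn M).
rewrite T_topE (@rowI_shift K.+2) // !dn (co_fxSp M) //.
by have /= -> := sc_self M v (leqnn N).
Qed.

Lemma T_low v : q * T K.+2 v = T N (S K.+2 (S N v)) - (1 - q) * T N (S K.+2 v).
Proof.
have ad : adj N K.+2 by rewrite /adj /dynkinD_edge; lia.
by rewrite (tval_braid M (cw_act A) t0) //; ring.
Qed.

(** A computation in the coordinates of v. The only unknown quantities are the values of [T K.+2] at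
    v and S_N v; [T_low] expresses them through [T N]. *)
Lemma hecke_val_base v : t = -1 -> f N (S K.+2 (v - S N v)) = f N v.
Proof.
move=> tm1; set w := v - S N v.
have dn s y : co K.+1 N s (S N y) = rho * co K.+1 K.+2 s y by apply: (coj_dn M).
have up s y : co K.+1 K.+2 s (S N y) = (1 - q) * co K.+1 K.+2 s y + rho * co K.+1 N s y.
  by apply: (coj_up M).
have fx y : cP (S N y) = cP y by rewrite (co_fxSp M).
have tq y : cQ (S N y) = t * T N y by exact: (sc_self M y (leqnn N)).
have fE y : f N y = t * T N (S N y) - (1 - q) * (t * T N y) - q * cQ y.
  by rewrite /f /scoord !tq.
have k1 : (K.+2 < N <= N)%N by lia.
have lowC y : cC (S K.+2 y) = t * T K.+2 y by exact: (sc_self M y (leqnSn K.+2)).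
have lowE y : cE (S K.+2 y) = cE y by rewrite (co_fxSp M).
have lowQ y : cQ (S K.+2 y) = (1 - q) * cQ y + rho * cA y by rewrite (com_up M).
have lowP y : cP (S K.+2 y) = rho * cB y by rewrite (cop_dn M).
have lowY y : cY (S K.+2 y) = rho * cZ y by rewrite rowI_shift.
have shX y : cX (S N y) = rho * cY y by rewrite rowI_shift.
have upY y : cY (S N y) = (1 - q) * cY y + rho * cX y by rewrite rowI_up.
have farZ y : cZ (S N y) = cZ y by rewrite rowI_far // leqnn ltnSn.
have ev := T_low v; have es := T_low (S N v).
have -> : f N (S K.+2 w) = f N (S K.+2 v) - f N (S K.+2 (S N v)).
  by rewrite (S_B M) -scaleN1r addrC hecke_val_lin mulN1r addrC.
rewrite !fE tm1 in ev es *.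
rewrite !(T_top_low, T_top_top, lowC, lowE, lowQ, lowP, lowY, tq, fx, dn, up, shX, upY, farZ) in ev es *.
rewrite (T_topE v) tm1 in ev es *.
move: ev es; move: (T K.+2 v) (T K.+2 (S N v)) (cQ v) (cP v) (cA v) (cB v) (cC v) (cE v) (cX v) (cY v) (cZ v) u.
move=> T1 T2 Q P A' B C E X Y Z u ev es.
apply: (eqr_lin2 (k := - (q - rho ^+ 4)) (l := q - rho ^+ 4) ev es); ring.
Qed.

End Base.

Hypothesis tm1 : t = -1.

Local Notation adj_rel k j := (forall v, f k (S j v) = f k v + q * f j v).

Let hB k v w : f k (v - w) = f k v - f k w.
Proof. by rewrite -scaleN1r addrC hecke_val_lin mulN1r addrC. Qed.

(** Take the relation at S_k v and compare with [hecke_val_adj2]. Here t = -1 makes f_k(S_k v) equal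
    to -q^2 f_k(v), and division by q gives the reversed edge. *)
Lemma adj_rel_sym k j : (k <= N)%N -> (j <= N)%N -> adj k j -> adj_rel k j -> adj_rel j k.
Proof.
move=> kN jN kj E v; have jk : adj j k by rewrite adjC.
have q0 : q != 0 by rewrite expf_neq0.
have := hecke_val_adj2 v jN kN jk; rewrite E hecke_val_self // tm1 => e.
by apply: (mulfI q0); apply: (eqr_lin (k := 1) e); ring.
Qed.

(* Conjugation by s_k s_j s_i moves the edge (j, i) to the edge (k, j).         *)
Lemma adj_rel_transport k j i : (k <= N)%N -> (j <= N)%N -> (i <= N)%N ->
  adj k j -> adj j i -> i != k -> ~~ adj i k -> adj_rel k j -> adj_rel j i.
Proof.
move=> kN jN iN kj ji ik nik E v.
have jk : adj j k by rewrite adjC. have ij : adj i j by rewrite adjC.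
have q0 : q != 0 by rewrite expf_neq0.
have nki : ~~ adj k i by rewrite adjC. have ki : k != i by rewrite eq_sym.
have [v1 e1] := S_surj v kN; have [v2 e2] := S_surj v1 jN; have [w e3] := S_surj v2 iN.
rewrite -e1 -e2 -e3.
have C y : S i (S k y) = S k (S i y) by apply: (cw_act A).2.
have B y : S i (S j (S i y)) = S j (S i (S j y)) by apply: (cw_act A).1.
rewrite C B !(hecke_val_adj2 _ kN jN kj).
rewrite (hecke_val_nonadj _ kN iN ki nki) (hecke_val_adj2 _ jN iN ji).
by rewrite !(hecke_val_nonadj _ iN kN ik nik) E; ring.
Qed.

(** Conjugation leads from the last edge down to (2, 1); the branch (2, 0) is obtained from (3, 2)
    in the same way. *)
Lemma adj_rel_all k j : (k <= N)%N -> (j <= N)%N -> adj k j -> adj_rel k j.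
Proof.
have base : adj_rel N K.+2.
  move=> v; have := hecke_val_base v tm1.
  rewrite (S_B M) hB (hecke_val_adj2 v (leqnSn _) (leqnn N)); last by rewrite /adj /dynkinD_edge; lia.
  by move=> e; apply: (eqr_lin (k := 1) e); ring.
have chain d : (d <= K.+1)%N -> adj_rel (N - d)%N (K.+2 - d)%N.
  elim: d => [|d IH] dK; first by rewrite !subn0.
  have e1 : (N - d.+1 = K.+2 - d)%N by lia.
  rewrite e1; apply: (adj_rel_transport (k := N - d)%N); try lia; rewrite /adj /dynkinD_edge; try lia.
  by apply: IH; lia.
have up m j' : (0 < j' < N)%N -> m = j'.+1 -> adj_rel m j'.
  move=> jN ->; have e1 : (N - (K.+2 - j') = j'.+1)%N by lia.
  have e2 : (K.+2 - (K.+2 - j') = j')%N by lia.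
  by have := @chain (K.+2 - j')%N ltac:(lia); rewrite e1 e2.
have fork : adj_rel 2 0.
  by apply: (adj_rel_transport (k := 3)) => //; exact: up.
move=> kN jN kj.
have [h|[h|[h|h]]] : (0 < j < N)%N /\ k = j.+1 \/ (0 < k < N)%N /\ j = k.+1 \/
    k = 2%N /\ j = 0%N \/ k = 0%N /\ j = 2%N.
  by move: kj; rewrite /adj /dynkinD_edge; lia.
- by apply: up; case: h.
- by apply: adj_rel_sym => //; [rewrite adjC|apply: up; case: h].
- by case: h => -> ->.
by case: h => -> ->; apply: adj_rel_sym.
Qed.

Definition hecke_kernel (v : V) : Prop := forall k, (k <= N)%N -> f k v = 0.

Lemma hecke_kernel_sub : subspace_pred hecke_kernel.
Proof.
split=> [k kN|a v w v0 w0 k kN]; last by rewrite hecke_val_lin v0 // w0 // mulr0 addr0.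
by have := hB k 0 0; rewrite !subrr.
Qed.

Lemma hecke_kernel_stable j v : (j <= N)%N -> hecke_kernel v -> hecke_kernel (S j v).
Proof.
move=> jN v0 k kN; have [->|jk] := eqVneq j k.
  by rewrite hecke_val_self // v0 // mulr0.
have [ad|nad] := boolP (adj j k); last by rewrite hecke_val_nonadj // v0.
by rewrite adj_rel_all 1?adjC // !v0 // mulr0 addr0.
Qed.

Lemma hecke_kernel_proper : q != 1 -> ~ hecke_kernel (sr 1).
Proof.
move=> q1 /(_ 2 isT)/eqP; have ad : adj 2 1 by [].
rewrite /f (S_adjr M) // (T_off A) // mulr0 scale0r addr0 !(S_D M, S_Z M) (S_adjr M) // (S_root2 M) //.
have [_ _ _ c4] := sc_rank2 M (isT : 2 <= N)%N (isT : 1 <= N)%N ad.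
rewrite (T_off A) // (T_root2 A) // !(sc_D M, sc_Z M) c4 !(sc_sroot M) //=.
rewrite !(mulr0, mul0r, mulr1, addr0, subr0, add0r) tm1.
rewrite (_ : rho * _ = rho ^+ 4 * (1 - q)); last by ring.
by rewrite mulf_eq0 expf_eq0 (negPf rho0) subr_eq0 eq_sym (negPf q1).
Qed.

Lemma hecke_kernel_nonzero : exists v, hecke_kernel v /\ v <> 0.
Proof.
(* A dimension count: these are the 2N basis vectors at the e_j - e_0 and e_j + e_0, against N + 1
   linear forms, and 2N > N + 1. *)
pose y (l : 'I_(N + N)) := x 0 (l./2).+1 (odd l).
have yP (l : 'I_(N + N)) : (0 < (l./2).+1 <= N)%N by have := ltn_ord l; lia.
pose B := \matrix_(l < N + N, k < N.+1) f k (y l).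
have : kermx B != 0.
  rewrite -mxrank_eq0 mxrank_ker -lt0n subn_gt0.
  by apply: leq_ltn_trans (rank_leq_col B) _; lia.
case/rowV0Pn => r /sub_kermxP rB r0.
exists (\sum_l r 0 l *: y l); split.
  move=> k kN; have := congr1 (fun A' : 'rV_N.+1 => A' 0 (Ordinal (kN : k < N.+1)%N)) rB.
  rewrite !mxE => e; rewrite -[RHS]e.
  have : forall s : seq 'I_(N + N), f k (\sum_(l <- s) r 0 l *: y l) = \sum_(l <- s) r 0 l * f k (y l).
    elim=> [|l s IH]; first by rewrite !big_nil (hecke_kernel_sub.1 k kN).
    by rewrite !big_cons hecke_val_lin IH.
  by move=> ->; apply: eq_bigr => l _; rewrite mxE.
move=> e; case/negP: r0; apply/eqP/rowP => l; rewrite mxE.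
have := congr1 (co 0 (l./2).+1 (odd l)) e; rewrite (co_0 M) => <-.
have -> : forall s : seq 'I_(N + N), co 0 (l./2).+1 (odd l) (\sum_(l <- s) r 0 l *: y l) =
    \sum_(l' <- s) r 0 l' * co 0 (l./2).+1 (odd l) (y l').
  elim=> [|l' s IH]; first by rewrite !big_nil (co_0 M).
  by rewrite !big_cons (co_lin M) IH.
rewrite (bigD1 l) //= big1 ?addr0 => [|l' ll]; first by rewrite (co_x M) // !eqxx mulr1.
rewrite (co_x M) //; case: (boolP [&& _, _ & _]) => [/and3P[_ /eqP[h] /eqP o]|_]; last by rewrite mulr0.
by case/eqP: ll; apply: val_inj; rewrite -[LHS]odd_double_half -[RHS]odd_double_half h o.
Qed.

Lemma cw_reducible_hecke : q != 1 -> cw_reducible K S.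
Proof.
move=> q1; exists hecke_kernel; split.
- exact: hecke_kernel_sub.
- by move=> k v kN; exact: hecke_kernel_stable.
- exact: hecke_kernel_nonzero.
by exists (sr 1); exact: hecke_kernel_proper.
Qed.

End HeckeKernel.

(** * Specialization and conclusion *)

Section RationalFunctions.

Lemma horner_intr_rho_gen (g : {poly int}) : (map_poly intr g).[rho_gen] = tofrac (g%:P).
Proof.
pose h : {rmorphism {poly int} -> ratfun2} := (@tofrac _) \o (@polyC {poly int}).
have -> : map_poly intr g = map_poly h (map_poly polyC g) :> {poly ratfun2}.
  rewrite -map_poly_comp; apply: eq_map_poly => m /=.
  have -> : m%:P = m%:~R :> {poly int} by rewrite -[in LHS](intz m) (rmorph_int (@polyC int)).
  by rewrite -[RHS]/(h m%:~R) rmorph_int.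
have -> : rho_gen = h 'X by [].
rewrite horner_map /=; congr (tofrac _%:P).
by have := comp_polyXr g; rewrite /comp_poly.
Qed.

(** An equality at the indeterminate rho is an identity of integer polynomials after clearing X^m,
    hence holds at each nonzero point of any field. *)
Lemma laurent_transfer (f : laurent) (g : {poly int}) :
  laurent_eval f rho_gen = (map_poly intr g).[rho_gen] ->
  forall (F : fieldType) (y : F), y != 0 -> laurent_eval f y = (map_poly intr g).[y].
Proof.
have X0 : tofrac ('X%:P : {poly {poly int}}) != 0.
  by rewrite tofrac_eq0 polyC_eq0 polyX_eq0.
rewrite /laurent_eval !horner_intr_rho_gen => /(canRL (mulfVK (expf_neq0 f.1 X0))).
rewrite /rho_gen -tofracXn -tofracM => /eqP; rewrite tofrac_eq => /eqP.
rewrite -polyC_exp -polyCM => /polyC_inj e F y y0.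
by rewrite e rmorphM /= map_polyXn hornerM hornerXn mulfK ?expf_neq0.
Qed.

Lemma rho_gen_neq0 : rho_gen != 0.
Proof. by rewrite tofrac_eq0 polyC_eq0 polyX_eq0. Qed.

Lemma t_gen_neq0 : t_gen != 0.
Proof. by rewrite tofrac_eq0 polyX_eq0. Qed.

(** The outer variable is t; the two sides differ in their constant term in t. *)
Lemma t_rho_gen_neq1 : t_gen * rho_gen ^+ 4 != 1.
Proof.
rewrite -tofracXn -tofracM -tofrac1 tofrac_eq; apply/eqP => e.
have /eqP := congr1 (fun p : {poly {poly int}} => p`_0) e.
by rewrite coefXM /= coef1 eq_sym oner_eq0.
Qed.

Lemma t_rho_gen_neqN : t_gen * rho_gen ^+ 4 != - rho_gen ^+ 2.
Proof.
rewrite -!tofracXn -tofracM -tofracN tofrac_eq; apply/eqP => e.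
have /eqP := congr1 (fun p : {poly {poly int}} => p`_0) e.
by rewrite coefXM /= coefN -polyC_exp coefC /= eq_sym oppr_eq0 expf_eq0 polyX_eq0.
Qed.

End RationalFunctions.

Lemma adj_inord N i j : (i <= N)%N -> (j <= N)%N ->
  dynkinD_adj (inord i : 'I_N.+1) (inord j) = adj i j.
Proof. by move=> iN jN; rewrite /dynkinD_adj !inordK. Qed.

Lemma artin_actionP (F : fieldType) N (V : vectType F) (s : 'I_N.+1 -> 'End(V)) :
  artinD_relations (fun f g => (f \o g)%VF) s -> artin_action N (fun k v => s (inord k) v).
Proof.
move=> [br cm]; split=> i j v iN jN.
  by rewrite -(adj_inord iN jN) => /br /(congr1 (fun f : 'End(V) => f v)); rewrite !lfunE /= !lfunE /= => ->.
move=> ij; rewrite -(adj_inord iN jN) => ad.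
have nij : inord i != inord j :> 'I_N.+1.
  by apply: contraNneq ij => /(congr1 val) /=; rewrite !inordK // => ->.
by have := congr1 (fun f : 'End(V) => f v) (cm _ _ nij ad); rewrite !lfunE /= => ->.
Qed.

Section RowSum.
Variables (F : fieldType) (N : nat) (rho t : F) (V : lmodType F).
Variables (S : nat -> V -> V) (T : nat -> V -> F).
Variables (co : nat -> nat -> bool -> V -> F) (x : nat -> nat -> bool -> V).
Hypothesis M : cw_model N rho t S T co x.

Lemma rowI_low_x m i j s : (i < j < N)%N -> (m <= N)%N -> rowI N rho co m (x i j s) = 0.
Proof.
move=> ij; elim: m => [//|m IH] mN; rewrite rowIS IH; last exact: ltnW.
rewrite !(co_x M); try lia.
have -> : (N == j) = false by lia.
by rewrite !andbF !mulr0 !addr0.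
Qed.

Lemma rowI_x m i s : (i < N)%N -> (m <= N)%N -> rowI N rho co m (x i N s) =
  if (i < m)%N then rho ^+ (m - i.+1) * (if s then 1 else rho ^+ (2 * i)) else 0.
Proof.
move=> iN; elim: m => [//|m IH] mN; rewrite rowIS IH; last exact: ltnW.
rewrite !(co_x M) ?iN ?leqnn ?mN // eqxx ltnS.
have [im|mi|->] := ltngtP i m.
- by rewrite /= mulr0 !addr0 mulrA -exprS; congr (rho ^+ _ * _); lia.
- by rewrite /= !mulr0 !addr0.
by rewrite subnn expr0; case: (s) => /=; ring.
Qed.

End RowSum.

Section Transfer.
Variables (K : nat) (T : 'I_K.+4 -> posroot K.+4 -> laurent).
Local Notation N := K.+3.
Hypothesis HT : cw_coefficients T.

Let c0 (k : 'I_K.+4) b := laurent_eval (T k b) rho_gen.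
Let M0 : cw_model N rho_gen t_gen _ _ _ _ := @cw_modelP ratfun2 N c0 rho_gen t_gen isT.

Let act0 : artin_action N (fun k v => sig c0 rho_gen t_gen k v).
Proof. exact: artin_actionP HT.2. Qed.

Let T_self0 k : (k <= N)%N -> tval c0 k (sroot (xr ratfun2 N) k) = rho_gen ^+ 4.
Proof.
move=> kN; have [b e] := simple_root_vec (isT : 1 < N)%N kN.
by rewrite sroot_alpha // /alpha -e tval_xvec /c0 HT.1.
Qed.

Variables (F : fieldType) (rho t : F).
Hypothesis rho0 : rho != 0.
Let c (k : 'I_K.+4) b := laurent_eval (T k b) rho.

Let transfer k i j s (g : {poly int}) : (i < j <= N)%N ->
  tval c0 k (xr ratfun2 N i j s) = (map_poly intr g).[rho_gen] ->
  tval c k (xr F N i j s) = (map_poly intr g).[rho].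
Proof.
move=> ij; have [b e _] := posroot_of s ij.
by rewrite /xr -e !tval_xvec => /laurent_transfer; apply.
Qed.

Let ev (E : fieldType) (y : E) (g : {poly int}) : E := (map_poly intr g).[y].
Let ev0 (E : fieldType) (y : E) : ev y 0 = 0. Proof. by rewrite /ev rmorph0 horner0. Qed.
Let ev1 (E : fieldType) (y : E) : ev y 1 = 1. Proof. by rewrite /ev rmorph1 hornerC. Qed.
Let evX (E : fieldType) (y : E) m : ev y 'X^m = y ^+ m. Proof. by rewrite /ev map_polyXn hornerXn. Qed.
Let evM (E : fieldType) (y : E) g h : ev y (g * h) = ev y g * ev y h.
Proof. by rewrite /ev rmorphM hornerM. Qed.
Let evB (E : fieldType) (y : E) g h : ev y (g - h) = ev y g - ev y h.
Proof. by rewrite /ev rmorphB hornerD hornerN. Qed.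

Let nz := rho_gen_neq0.
Let tz := t_gen_neq0.
Let tn1 := t_rho_gen_neq1.
Let tnq := t_rho_gen_neqN.

Let X53 (E : fieldType) (y : E) : ev y ('X^5 - 'X^3) = y ^+ 5 - y ^+ 3.
Proof. by rewrite evB !evX. Qed.

Let T_off_F i j : (i <= N)%N -> (j <= N)%N -> i != j -> tval c i (sroot (xr F N) j) = 0.
Proof.
move=> iN jN ij; have := tval_sroot M0 act0 T_self0 nz tz tn1 tnq iN jN ij.
by case: j jN {ij} => [|j] jN; rewrite -{1}(ev0 rho_gen) -(ev0 rho) => /transfer; apply; lia.
Qed.

Let T_self_F k : (k <= N)%N -> tval c k (sroot (xr F N) k) = rho ^+ 4.
Proof.
move=> kN; have := T_self0 kN.
by case: k kN => [|k] kN; rewrite -!evX => /transfer; apply; lia.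
Qed.

Let T_root2_F i j : (i <= N)%N -> (j <= N)%N -> adj i j ->
  tval c i (sroot2 (xr F N) i j) = rho ^+ 5 - rho ^+ 3.
Proof.
move=> iN jN ij; have := tval_sroot2 M0 act0 T_self0 nz tz tn1 tnq iN jN ij.
rewrite /sroot2; case: ifP => ij0; rewrite -!X53 => /transfer; apply=> //.
by have := adj_neq ij; lia.
Qed.

Let N2 : (2 < N <= N)%N. Proof. by rewrite leqnn. Qed.

Let T_low_F i j s : (i < j < N)%N -> tval c N (xr F N i j s) = 0.
Proof.
move=> ij; have := @tval_low _ _ _ _ _ _ _ _ _ M0 act0 T_self0 nz tz tn1 tnq N i j s N2 ij.
by rewrite -{1}(ev0 rho_gen) -(ev0 rho) => /transfer; apply; lia.
Qed.

Let T_high_F i : (i.+1 < N)%N ->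
  tval c N (xr F N i N true) = rho ^+ (N - i.+2) * (rho ^+ 5 - rho ^+ 3) /\
  tval c N (xr F N i N false) = rho ^+ (N + i - 2) * (rho ^+ 5 - rho ^+ 3).
Proof.
move=> iN; have [] := tval_top M0 act0 T_self0 nz tz tn1 tnq N2 iN.
rewrite -!X53 -!evX -!evM => /transfer e1 /transfer e2.
by rewrite e1 ?e2 //; lia.
Qed.

Let T_highest_F : tval c N (xr F N K.+2 N false) = (rho ^+ 2 - rho ^+ 4) * (1 - rho ^+ (2 * K.+2)).
Proof.
have eP (E : fieldType) (y : E) : (y ^+ 2 - y ^+ 4) * (1 - y ^+ (2 * K.+2)) =
    ev y (('X^2 - 'X^4) * (1 - 'X^(2 * K.+2))) by rewrite evM !evB ev1 !evX.
have := tval_highest M0 act0 T_self0 nz tz tn1 tnq (ltnSn K.+2).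
by rewrite -exprM !eP => /transfer; apply; rewrite ltnSn.
Qed.

(** Both sides of [T_top] are linear, so it is checked on basis vectors, with the values computed
    generically and specialized by [transfer]. *)
Lemma cw_actionP : artin_action N (fun k v => sig c rho t k v) ->
  cw_action N rho t (fun k v => sig c rho t k v) (tval c) (@co F N) (xr F N).
Proof.
move=> act.
have M : cw_model N rho t (fun k v => sig c rho t k v) (tval c) (@co F N) (xr F N).
  exact: cw_modelP.
split=> //; apply: (x_ind M).
- by rewrite (T_0 M) !(co_0 M) (_ : rowI _ _ _ _ _ = 0) ?mulr0 ?subrr ?mulr0 ?subr0 //;
    rewrite -(scale0r 0) (rowI_Z M) mul0r.
- move=> a u v hu hv; rewrite (T_lin M) hu hv !(co_lin M) (rowI_D M) (rowI_Z M); ring.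
move=> i j s ij.
have [jN|jN] := ltnP j N.
  have jn : (N == j) = false by lia.
  have ij' : (i < j < N)%N by lia.
  rewrite T_low_F // (rowI_low_x M) // !(co_x M) ?ltnSn ?leqnn //= jn !andbF /=.
  by ring.
have -> : j = N by lia.
have iN : (i < N)%N by lia.
rewrite (rowI_x M) // iN !(co_x M) ?ltnSn ?leqnn ?iN // eqxx.
have [k1|k1] := ltnP i.+1 N.
  have [e1 e2] := T_high_F k1.
  have -> : (K.+2 == i) = false by lia.
  rewrite !mulr0 subr0; case: s {ij}; rewrite ?e1 ?e2.
    rewrite mulr1 (_ : N - i.+1 = (N - i.+2).+1)%N; last by lia.
    by rewrite (exprS rho (N - i.+2)); ring.
  rewrite -exprD (_ : N - i.+1 + 2 * i = (N + i - 2).+1)%N; last by lia.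
  by rewrite (exprS rho (N + i - 2)); ring.
have -> : i = K.+2 by lia.
rewrite subnn expr0 eqxx; case: s {ij} => /=.
  by have /= -> := T_self_F (leqnn N); ring.
by rewrite T_highest_F; ring.
Qed.

End Transfer.

Section Representation.
Variables (n : nat) (F : fieldType) (V : vectType F) (phi : artin_group n -> 'End(V)).
Hypothesis rep : is_representation phi.

Let phiM u v : phi (artin_class (u ++ v)) = (phi (artin_class u) \o phi (artin_class v))%VF.
Proof. by rewrite -artin_classM; exact: rep.2. Qed.

Lemma rep_relations : artinD_relations (fun f g => (f \o g)%VF) (fun k => phi (artin_gen k)).
Proof.
split=> [i j ij|i j ij nad]; rewrite /artin_gen -!phiM; congr (phi _); apply/artin_classE.
  exact: ArtinBraid.
exact: ArtinComm.
Qed.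

(** For inverse letters finite dimension is used: a generator is injective, so it maps U onto U, and
    its inverse preserves U too. *)
Lemma rep_invariant (U : {vspace V}) :
  (forall k, (phi (artin_gen k) @: U <= U)%VS) -> invariant_subspace phi U.
Proof.
move=> Ugen; have phi1 : phi (artin_class [::]) = \1%VF by exact: rep.1.
have letter x : (phi (artin_class [:: x]) @: U <= U)%VS.
  case: x => k [|]; first exact: Ugen.
  have inv : (phi (artin_class [:: (k, false)]) \o phi (artin_gen k))%VF = \1%VF.
    by rewrite -phiM -phi1; congr (phi _); apply/artin_classE; exact: (ArtinCancel k false).
  have ker0 : (U :&: lker (phi (artin_gen k)) = 0)%VS.
    apply/eqP; rewrite -subv0; apply/subvP => v; rewrite memv_cap memv_ker => /andP[_ /eqP v0].
    have := congr1 (fun f : 'End(V) => f v) inv; rewrite lfunE /= v0 linear0 id_lfunE => <-.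
    exact: mem0v.
  have eqU : (phi (artin_gen k) @: U)%VS = U.
    by apply/eqP; rewrite eqEdim Ugen (limg_dim_eq ker0) leqnn.
  by rewrite -{1}eqU -limg_comp inv lim1g.
move=> g; rewrite -(artin_class_repr g); elim: (repr g) => [|x u IH].
  by rewrite phi1 lim1g.
by rewrite -[x :: u]cat1s phiM limg_comp; apply: subv_trans (letter x); exact: limgS.
Qed.

End Representation.

(** Take a subspace inside U of maximal dimension; a vector of U outside it could be adjoined. *)
Lemma subspace_pred_vspace (F : fieldType) (V : vectType F) (U : V -> Prop) :
  subspace_pred U -> exists W : {vspace V}, forall v, v \in W <-> U v.
Proof.
move=> Usub.
pose P d := boolp.asbool (exists W : {vspace V}, \dim W = d /\ forall v, v \in W -> U v).
have P0 : exists d, P d.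
  exists 0%N; apply/boolp.asboolP; exists 0%VS; split; first exact: dimv0.
  by move=> v; rewrite memv0 => /eqP->; exact: Usub.1.
have Pb d : P d -> (d <= \dim {:V})%N.
  by move=> /boolp.asboolP[W [<- _]]; apply/dimvS/subvf.
case: (ex_maxnP P0 Pb) => d /boolp.asboolP[W [dW WU]] max.
exists W => v; split=> [|Uv]; first exact: WU.
apply: contraT => vW; have : P (\dim (W + <[v]>)).
  apply/boolp.asboolP; exists (W + <[v]>)%VS; split=> // w /memv_addP[w1 W1 [w2 /vlineP[a ->] ->]].
  by rewrite addrC; apply: Usub.2 => //; exact: WU.
move/max; rewrite -dW; apply: contraLR => _; rewrite -ltnNge.
rewrite ltn_neqAle (dimvS (addvSl _ _)) andbT; apply: contra vW => /eqP e.
have /eqP -> : W == (W + <[v]>)%VS by rewrite eqEdim addvSl -e leqnn.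
by apply: (subvP (addvSr _ _)); exact: memv_line.
Qed.

Section Glue.
Variables (F : fieldType) (K : nat) (rho t : F).
Local Notation N := K.+3.
Local Notation V := (cw_space N.+1 F).
Variables (T : 'I_N.+1 -> posroot N.+1 -> laurent) (phi : artin_group N.+1 -> 'End(V)).
Hypotheses (rho0 : rho != 0) (t0 : t != 0).
Hypotheses (rep : is_representation phi) (HT : cw_coefficients T).
Hypothesis phiE : forall k, phi (artin_gen k) = cw_sigma T rho t k.
Let c (k : 'I_N.+1) b := laurent_eval (T k b) rho.
Local Notation q := (rho ^+ 2).
Local Notation a := (rho ^+ (2 * K.+2)).

Let sigE k : sig c rho t k = phi (artin_gen (inord k)).
Proof. by rewrite phiE. Qed.

Let A : cw_action N rho t (fun k v => sig c rho t k v) (tval c) (@co F N) (xr F N).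
Proof.
apply: (cw_actionP HT rho0); have := artin_actionP (rep_relations rep).
by case=> br cm; split=> i j v iN jN ij *; rewrite !sigE; [exact: br|exact: cm].
Qed.

Lemma cw_irreducible_rep : q != 1 -> q != -1 -> a != -1 -> q * a != 1 ->
  t * (a * q) ^+ 2 \notin
    [:: 1; (q * a) ^+ 2; a ^+ 2; q * (q * a); - (q * a); - (q ^+ 2 * a ^+ 2)] ->
  irreducible_rep phi.
Proof.
move=> q1 qN1 aN1 qa1 sn; split.
  apply/eqP => V0; have : xr F N 0 1 true \in (fullv : {vspace V}) by exact: memvf.
  rewrite V0 memv0 => /eqP x0.
  have := @co_x _ _ _ _ _ _ _ _ _ (cwM A) 0 1 true 0 1 true isT isT.
  by rewrite x0 (co_0 (cwM A)) => /eqP; rewrite eq_sym oner_eq0.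
move=> U Uinv.
have Usub : subspace_pred (fun v => v \in U).
  by split=> [|b v w Uv Uw]; [exact: mem0v|rewrite memvD // memvZ].
have Ustab k v : (k <= N)%N -> v \in U -> sig c rho t k v \in U.
  by move=> _ Uv; rewrite sigE; apply: (subvP (Uinv _)); exact: memv_img.
have [U0|UT] := cw_irreducible A rho0 t0 q1 qN1 aN1 qa1 Usub Ustab sn.
  by left; apply/eqP; rewrite -subv0; apply/subvP => v /U0->; exact: mem0v.
by right; apply/eqP; rewrite eqEsubv subvf; apply/subvP => v _; exact: UT.
Qed.

Lemma cw_reducible_rep : cw_reducible K (fun k v => sig c rho t k v) -> reducible_rep phi.
Proof.
move=> [U [Usub UinvS [v [Uv v0]] [w nUw]]].
have [W WU] := subspace_pred_vspace Usub; exists W; split.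
- apply: rep_invariant => // k; apply/subvP => _ /memv_imgP[u Wu ->].
  apply/WU; have := UinvS k u; rewrite sigE inord_val; apply; last exact/WU.
  by rewrite -ltnS.
- by move=> W0; apply: v0; apply/eqP; rewrite -memv0 -W0; apply/WU.
by move=> WT; apply: nUw; apply/WU; rewrite WT memvf.
Qed.

Lemma cw_reducible_rep_exceptional : q != 1 -> q != -1 ->
  t \in [:: rho ^- (4 * N); rho ^- (2 * N - 2); - rho ^- (2 * N); 1; rho ^- 4; -1] ->
  reducible_rep phi.
Proof.
move=> q1 qN1 tE; apply: cw_reducible_rep; move: tE.
have rX m : rho ^+ m != 0 by rewrite expf_neq0.
rewrite !inE => /or4P[/eqP tE|/eqP tE|/eqP tE|/or3P[/eqP tE|/eqP tE|/eqP tE]].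
- by apply: (cw_reducible_line A rho0); rewrite tE mulVf.
- apply: (cw_reducible_ramp A rho0 (kappa := q)) => //; first by rewrite subrr mulr0.
  rewrite tE -exprM (_ : N * 2 = 2 * N - 2 + 2)%N; last by lia.
  by rewrite exprD mulrA mulVf // mul1r.
- apply: (cw_reducible_ramp A rho0 (kappa := -1)) => //; first by rewrite addNr mul0r.
  by rewrite tE -exprM mulnC mulNr mulVf.
- exact: (cw_reducible_t1 A rho0).
- by apply: (cw_reducible_minus A rho0); rewrite tE mulVf.
exact: (cw_reducible_hecke A rho0 t0).
Qed.

(** Here s = t (a q)^2 with a q = r^(-(2n-2)). The squares of the eigenvalues 1, q a, -a give t =
    r^(4n-4), 1, r^4; the products q mu nu give r^(2n-4), -r^(2n-2), -1. *)
Lemma cw_parameter_list :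
  t * (a * q) ^+ 2 \in
    [:: 1; (q * a) ^+ 2; a ^+ 2; q * (q * a); - (q * a); - (q ^+ 2 * a ^+ 2)] ->
  t \in [:: rho ^- (4 * N); rho ^- (2 * N - 2); - rho ^- (2 * N); 1; rho ^- 4; -1].
Proof.
have a0 : a != 0 by rewrite expf_neq0. have q0 : q != 0 by rewrite expf_neq0.
have u0 : (a * q) ^+ 2 != 0 by apply: expf_neq0; exact: mulf_neq0.
have e2 : rho ^+ (2 * N) = a * q by rewrite -exprD; congr (_ ^+ _); lia.
have e4 : rho ^+ (4 * N) = (a * q) ^+ 2 by rewrite -e2 -exprM; congr (_ ^+ _); lia.
have e22 : rho ^+ (2 * N - 2) = a by congr (_ ^+ _); lia.
have eq4 : rho ^+ 4 = q ^+ 2 by rewrite -exprM.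
rewrite e2 e4 e22 eq4; move: a q a0 q0 u0 {e2 e4 e22 eq4} => y z y0 z0 u0.
have sol v w : w * (y * z) ^+ 2 = v -> (t * (y * z) ^+ 2 == v) = (t == w).
  by move=> <-; rewrite (inj_eq (mulIf u0)).
rewrite !inE [z * y]mulrC (sol _ ((y * z) ^- 2)); last by rewrite mulVf.
rewrite (sol _ 1); last by rewrite mul1r.
rewrite (sol _ (z ^- 2)); last by field.
rewrite (sol _ (y^-1)); last by field.
rewrite (sol _ (- (y * z)^-1)); last by rewrite mulNr expr2 mulKf ?mulf_neq0.
rewrite (sol _ (-1)); last by ring.
by do 6! case: (t == _).
Qed.

End Glue.
Local Open Scope complex_scope.

Theorem mainTheorem1 (R : realType) (n : nat) (t r : R[i])
    (phi : artin_group n -> 'End(cw_space n (gen_field [:: t; r]))) :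
  (4 <= n)%N -> t != 0 -> r != 0 ->
  (forall k : nat, (1 <= k <= n)%N -> r ^+ (2 * k) != 1) ->
  (forall k : nat, (1 <= k <= n - 1)%N -> r ^+ (2 * k) != -1) ->
  is_cohen_wales phi ->
  let exceptional := [:: r ^+ (4 * n - 4); r ^+ (2 * n - 4);
                         - r ^+ (2 * n - 2); 1; r ^+ 4; -1] in
  (t \notin exceptional -> irreducible_rep phi) /\
  (t \in exceptional -> reducible_rep phi).
Proof.
case: n phi => [|[|[|[|K]]]] // phi _ t0 r0 r1 rN1 [rep [T [HT phiE]]] exceptional.
set t' := gen_fst t r in phiE; set r' := gen_snd t r in phiE.
(* The representation lives over Q(t, r), while the hypotheses concern complex numbers; the
   injective [iota] carries them over. Below, a corresponds to r^(-2(n-2)) and q a to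
   r^(-2(n-1)). *)
pose iota : {rmorphism gen_field [:: t; r] -> R[i]} := val.
have it : iota t' = t by []. have ir : iota r' = r by [].
have inj : injective iota := fmorph_inj iota.
have t0' : t' != 0 by rewrite -(fmorph_eq0 iota) it.
have r0' : r' != 0 by rewrite -(fmorph_eq0 iota) ir.
have rho0 : r'^-1 != 0 by rewrite invr_eq0.
have i1 m : (r'^-1 ^+ m == 1) = (r ^+ m == 1).
  by rewrite exprVn invr_eq1 -(inj_eq inj) rmorphXn rmorph1 ir.
have iN1 m : (r'^-1 ^+ m == -1) = (r ^+ m == -1).
  rewrite exprVn -(inj_eq invr_inj) invrK invrN1.
  by rewrite -(inj_eq inj) rmorphXn rmorphN rmorph1 ir.
have q1 : r'^-1 ^+ 2 != 1 by rewrite i1 (r1 1%N).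
have qN1 : r'^-1 ^+ 2 != -1 by rewrite iN1 (rN1 1%N).
have aN1 : r'^-1 ^+ (2 * K.+2) != -1 by rewrite iN1 rN1 //; lia.
have qa1 : r'^-1 ^+ 2 * r'^-1 ^+ (2 * K.+2) != 1.
  by rewrite -exprD -mulnS i1 r1 //; lia.
have tE : (t \in exceptional) = (t' \in [:: r'^-1 ^- (4 * K.+3); r'^-1 ^- (2 * K.+3 - 2);
    - r'^-1 ^- (2 * K.+3); 1; r'^-1 ^- 4; -1]).
  rewrite -(mem_map inj) /exceptional; congr (t \in _).
  have iX m : iota (r'^-1 ^- m) = r ^+ m by rewrite exprVn invrK rmorphXn ir.
  rewrite !map_cons !(rmorphN iota) (rmorph1 iota) !iX.
  have -> : (4 * K.+4 - 4 = 4 * K.+3)%N by lia.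
  have -> : (2 * K.+4 - 4 = 2 * K.+3 - 2)%N by lia.
  by have -> : (2 * K.+4 - 2 = 2 * K.+3)%N by lia.
rewrite tE; split=> tH.
  apply: (cw_irreducible_rep rho0 t0' rep HT phiE) => //.
  by apply: contra tH; exact: cw_parameter_list.
exact: (cw_reducible_rep_exceptional rho0 t0' rep HT phiE).
Qed.
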